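(* Let $\mathcal C$ be a class of colored graphs which has low shrubdepth covers. Then every transduction $\mathsf I$ is equivalent on $\mathcal C$ to some almost quantifier-free transduction $\mathsf J$.
   Context: Graphs are finite, simple, undirected, viewed as structures over a binary edge relation $E$; a colored graph is a graph with finitely many additional unary predicates (a class uses a fixed finite set of predicates). Structures: a signature is a finite set of relation symbols and unary function symbols; a structure $\mathbf A$ has finite universe $V(\mathbf A)$, relations interpreted as sets of tuples and function symbols as partial functions $V(\mathbf A)\rightharpoonup V(\mathbf A)$. $\mathbf A[X]$ is the induced substructure, where $f(x)$ becomes undefined if $f(x)\notin X$. First-order formulas use terms (compositions of function symbols applied to a variable) and atomic formulas $R(\tau_1(x_1),\dots,\tau_k(x_k))$, $\tau_1(x_1)=\tau_2(x_2)$, $\mathrm{dom}_f(\tau(x))$; atomic formulas with an undefined term are false. Transductions: finite compositions of atomic operations mapping an input structure to a set of outputs: extension (add a new relation $R$ defined by a formula $\varphi(x_1,\dots,x_k)$); restriction (pass to the substructure induced by the elements satisfying a formula $\psi(x)$); reduct (remove a relation symbol); copying (disjoint union of two copies of the input with a new unary predicate marking the new copy and a symmetric binary relation joining each element to its copy); function extension (add a partial function $f$ with $f(x)=y$ iff $y$ is the unique element satisfying $\varphi(x,y)$, undefined otherwise); unary lift (given a map $\sigma$ assigning to each structure a nonempty family of subsets of its universe, add a unary predicate interpreted as any member of $\sigma(\mathbf A)$, one output per choice). A transduction is almost quantifier-free if all formulas parameterizing its atomic operations are quantifier-free. Two transductions are equivalent on $\mathcal C$ if for every $\mathbf A\in\mathcal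 C$ they have exactly the same set of outputs. Shrubdepth: a connection model with labels from $\Lambda$ is a rooted tree whose leaves carry labels $\lambda(x)\in\Lambda$ and whose internal nodes $v$ carry symmetric relations $C(v)\subseteq\Lambda\times\Lambda$; it defines the graph on the leaves where distinct leaves $x,y$ are adjacent iff $(\lambda(x),\lambda(y))\in C(v)$ with $v$ the least common ancestor. A class of (colored) graphs has bounded shrubdepth if for some $h$ and finite $\Lambda$ every graph in it has a connection model of depth at most $h$ with labels from $\Lambda$ (for colored graphs the label of a leaf also determines which unary predicates contain it). Covers: a $p$-cover of $G$ is a family $\mathcal U_G$ of subsets of $V(G)$ covering $V(G)$ such that every set of at most $p$ vertices lies in some member. A $p$-cover of a class $\mathcal C$ is a family $(\mathcal U_G)_{G\in\mathcal C}$ of $p$-covers; it is finite if $\sup_G|\mathcal U_G|<\infty$, and has bounded shrubdepth if the class $\{G[U]:G\in\mathcal C,U\in\mathcal U_G\}$ has bounded shrubdepth. $\mathcal C$ has low shrubdepth covers if for every $p$ it has a finite $p$-cover of bounded shrubdepth.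
   Formalization: Reducts may remove function symbols as well as relation symbols, for both I and J; if only relation symbols could be removed, auxiliary functions would stay in the output and the claim would fail (e.g. on paths, replacing edges by ''distance at most 2''). *)

(* Defs.v *)
(* MathComp, with finmap for finite sets of symbols. *)
From mathcomp Require Import all_boot.
From mathcomp Require Import finmap.

Set Implicit Arguments.
Unset Strict Implicit.
Unset Printing Implicit Defensive.

Local Open Scope fset_scope.
Local Open Scope nat_scope.

(* A relation symbol is a pair (name, arity); a function symbol is a name,
   and all function symbols are unary. *)
Notation rsym := (nat * nat)%type (only parsing).
Definition arity (R : rsym) : nat := R.2.
Notation fsym := nat (only parsing).

Record signature := Signature { rels : {fset rsym}; funs : {fset fsym} }.

(* A structure interprets every symbol; a structure over the signature s is
   one that interprets trivially all the symbols outside s (see [over_sig]). *)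
Record structure := Structure {
  univ :> finType;
  srel : forall R : rsym, (arity R).-tuple univ -> bool;
  sfun : fsym -> univ -> option univ
}.

Definition over_sig (s : signature) (A : structure) : Prop :=
  (forall R, R \notin rels s -> forall t, srel (s := A) (R := R) t = false) /\
  (forall f, f \notin funs s -> forall x : A, sfun f x = None).

Definition isomorphic (A B : structure) : Prop :=
  exists h : A -> B,
    [/\ bijective h,
        forall (R : rsym) (t : (arity R).-tuple A),
          srel (s := B) (R := R) [tuple of map h t] = srel t
      & forall f (x : A), sfun f (h x) = omap h (sfun f x)].

(* Terms and formulas whose free variables are indexed by 'I_n.  In [FEx phi]
   the bound variable is variable 0 of phi, the others being shifted by 1. *)
Inductive term (n : nat) : Type :=
  | Var of 'I_n
  | App of fsym & term n.

Inductive formula (n : nat) : Type :=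
  | FRel (R : rsym) of (arity R).-tuple (term n)
  | FEq of term n & term n
  | FDom of fsym & term n
  | FNot of formula n
  | FAnd of formula n & formula n
  | FEx of formula n.+1.

Fixpoint eval (A : structure) n (v : n.-tuple A) (t : term n) : option A :=
  match t with
  | Var i => Some (tnth v i)
  | App f t => obind (sfun f) (eval v t)
  end.

Fixpoint sat (A : structure) n (phi : formula n) : n.-tuple A -> bool :=
  match phi with
  | FRel R ts => fun v =>
      [exists u : (arity R).-tuple A,
        (map (eval v) ts == map Some u) && srel u]
  | FEq t1 t2 => fun v =>
      [exists x : A, (eval v t1 == Some x) && (eval v t2 == Some x)]
  | FDom f t => fun v => isSome (obind (sfun f) (eval v t))
  | FNot phi => fun v => ~~ sat phi v
  | FAnd phi psi => fun v => sat phi v && sat psi v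
  | FEx phi => fun v => [exists x : A, sat phi [tuple of x :: v]]
  end.

Fixpoint term_over (s : signature) n (t : term n) : bool :=
  match t with
  | Var _ => true
  | App f t => (f \in funs s) && term_over s t
  end.

Fixpoint formula_over (s : signature) n (phi : formula n) : bool :=
  match phi with
  | FRel R ts => (R \in rels s) && all (term_over s (n := n)) ts
  | FEq t1 t2 => term_over s t1 && term_over s t2
  | FDom f t => (f \in funs s) && term_over s t
  | FNot phi => formula_over s phi
  | FAnd phi psi => formula_over s phi && formula_over s psi
  | FEx phi => formula_over s phi
  end.

Fixpoint quantifier_free n (phi : formula n) : bool :=
  match phi with
  | FRel _ _ | FEq _ _ | FDom _ _ => true
  | FNot phi => quantifier_free phi
  | FAnd phi psi => quantifier_free phi && quantifier_free psi
  | FEx _ => false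
  end.

(* The test on Q does not make Q convertible to R, hence the detour through
   the underlying sequences of the tuples t and u. *)
Definition set_rel (A : structure) (R : rsym) (P : pred ((arity R).-tuple A)) :
    structure :=
  {| univ := univ A;
     srel := fun Q t => if Q == R
               then [exists u : (arity R).-tuple A,
                      (u == t :> seq A) && P u]
               else srel t;
     sfun := @sfun A |}.

Definition set_fun (A : structure) (f : fsym) (F : A -> option A) : structure :=
  {| univ := univ A;
     srel := @srel A;
     sfun := fun g => if g == f then F else sfun g |}.

Definition unary (A : structure) (U : nat) (X : {set A}) : structure :=
  set_rel (R := (U, 1)) (fun t => thead t \in X).

Definition induced (A : structure) (X : {set A}) : structure :=
  {| univ := {x : A | x \in X};
     srel := fun R t => srel [tuple of map val t];
     sfun := fun f x => obind insub (sfun f (val x)) |}.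

(* inl x is the original element and inr x is its copy. *)
Definition disjoint_double (A : structure) : structure :=
  {| univ := (A + A)%type;
     srel := fun R t =>
       [exists u : (arity R).-tuple A,
         ((t == map inl u :> seq (A + A)) || (t == map inr u :> seq (A + A)))
         && srel u];
     sfun := fun f z => match z with
       | inl x => omap inl (sfun f x)
       | inr x => omap inr (sfun f x)
       end |}.

Definition twins (T : eqType) (y z : T + T) : bool :=
  match y, z with
  | inl a, inr b | inr a, inl b => a == b
  | _, _ => false
  end.

Definition copying (A : structure) (U M : nat) : structure :=
  let B := unary (A := disjoint_double A) U [set z : A + A | ~~ is_inl z] in
  set_rel (A := B) (R := (M, 2))
    (fun t => @twins A (tnth t ord0) (tnth t ord_max)).

Definition graph_function (A : structure) (phi : formula 2) (x : A) : option A :=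
  [pick y | [forall z, sat phi [tuple x; z] == (z == y)]].

(* Reducts may forget function symbols as well as relation symbols: an
   auxiliary function introduced by FunctionExtension could otherwise never
   disappear from the output. *)
Inductive operation : Type :=
  | Extension (R : rsym) of formula (arity R)
  | Restriction of formula 1
  | Reduct of rsym
  | FunctionReduct of fsym
  | Copying (U M : nat)
  | FunctionExtension of fsym & formula 2
  | UnaryLift (U : nat) (sigma : forall A : structure, {set {set A}})
      of (forall A, sigma A != set0).

Definition op_output (o : operation) (A B : structure) : Prop :=
  match o with
  | Extension R phi => B = set_rel (sat (A := A) phi)
  | Restriction psi => B = induced [set x : A | sat psi [tuple x]]
  | Reduct R => B = set_rel (A := A) (R := R) pred0
  | FunctionReduct f => B = set_fun (A := A) f (fun=> None)
  | Copying U M => B = copying A U M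
  | FunctionExtension f phi =>
      B = set_fun (A := A) f (graph_function (A := A) phi)
  | UnaryLift U sigma _ => exists2 X, X \in sigma A & B = unary U X
  end.

(* New symbols must be fresh, and relation symbols have positive arity. *)
Definition op_wf (s : signature) (o : operation) : bool :=
  match o with
  | Extension R phi =>
      [&& 0 < arity R, R \notin rels s & formula_over s phi]
  | Restriction psi => formula_over s psi
  | Reduct R => R \in rels s
  | FunctionReduct f => f \in funs s
  | Copying U M => ((U, 1) \notin rels s) && ((M, 2) \notin rels s)
  | FunctionExtension f phi => (f \notin funs s) && formula_over s phi
  | UnaryLift U _ _ => (U, 1) \notin rels s
  end.

Definition op_sig (s : signature) (o : operation) : signature :=
  match o with
  | Extension R _ => Signature (R |` rels s) (funs s)
  | Restriction _ => s
  | Reduct R => Signature (rels s `\ R) (funs s)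
  | FunctionReduct f => Signature (rels s) (funs s `\ f)
  | Copying U M => Signature ((U, 1) |` ((M, 2) |` rels s)) (funs s)
  | FunctionExtension f _ => Signature (rels s) (f |` funs s)
  | UnaryLift U _ _ => Signature ((U, 1) |` rels s) (funs s)
  end.

Definition op_qf (o : operation) : bool :=
  match o with
  | Extension _ phi => quantifier_free phi
  | Restriction psi => quantifier_free psi
  | FunctionExtension _ phi => quantifier_free phi
  | _ => true
  end.

(* The operations are applied from left to right. *)
Definition transduction : Type := seq operation.

Fixpoint output (I : transduction) (A B : structure) : Prop :=
  match I with
  | [::] => B = A
  | o :: I' => exists2 A', op_output o A A' & output I' A' B
  end.

(* [transduction_from s t I]: I maps structures over s to structures over t. *)
Fixpoint transduction_from (s t : signature) (I : transduction) : Prop :=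
  match I with
  | [::] => t = s
  | o :: I' => op_wf s o /\ transduction_from (op_sig s o) t I'
  end.

Definition almost_quantifier_free (I : transduction) : bool := all op_qf I.

(* Disjoint unions are defined up to isomorphism only, so sets of outputs are
   understood as closed under isomorphism. *)
Definition output_iso (I : transduction) (A B : structure) : Prop :=
  exists2 B', output I A B' & isomorphic B' B.

Definition equivalent_on (C : structure -> Prop) (I J : transduction) : Prop :=
  forall A, C A -> forall B, output_iso I A B <-> output_iso J A B.

Definition edge : rsym := (0, 2).
Definition color (p : nat) : rsym := (p, 1).

Definition graph_sig (P : {fset nat}) : signature :=
  Signature (edge |` [fset color p | p in P]) fset0.

Definition adj (G : structure) (x y : G) : bool :=
  srel (s := G) (R := edge) [tuple x; y].

Definition colored (G : structure) (p : nat) (x : G) : bool :=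
  srel (s := G) (R := color p) [tuple x].

Definition colored_graph (P : {fset nat}) (G : structure) : Prop :=
  [/\ over_sig (graph_sig P) G, symmetric (adj (G := G))
    & irreflexive (adj (G := G))].

(* The root is its own parent.  It is exempted from [childless_leaf] so that
   the empty graph has a connection model, consisting of the root alone. *)
Record connection_model (L V : finType) := ConnectionModel {
  node : finType;
  tree_root : node;
  parent : node -> node;
  parent_root : parent tree_root = tree_root;
  root_reachable : forall v, fconnect parent v tree_root;
  leaf : V -> node;
  leaf_inj : injective leaf;
  leaf_childless : forall x v, parent v = leaf x -> v = leaf x;
  childless_leaf : forall v, v != tree_root ->
    (forall w, parent w = v -> w = v) -> exists x, v = leaf x;
  label : V -> L;
  conn : node -> rel L;
  conn_sym : forall v, symmetric (conn v)
}.

Definition depth_at_most L V (M : connection_model L V) (h : nat) : Prop :=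
  forall v : node M, iter h (@parent L V M) v = tree_root M.

Definition is_lca L V (M : connection_model L V) (v x y : node M) : Prop :=
  [/\ fconnect (@parent L V M) x v, fconnect (@parent L V M) y v
    & forall w, fconnect (@parent L V M) x w -> fconnect (@parent L V M) y w ->
        fconnect (@parent L V M) v w].

Definition defines (P : {fset nat}) (G : structure) (L : finType)
    (M : connection_model L G) : Prop :=
  (forall (x y : G) (v : node M), x != y -> is_lca v (leaf M x) (leaf M y) ->
     adj x y = conn v (label M x) (label M y)) /\
  (exists c : L -> pred nat, forall (x : G) p, p \in P ->
     colored p x = c (label M x) p).

Definition bounded_shrubdepth (P : {fset nat}) (D : structure -> Prop) : Prop :=
  exists (h : nat) (L : finType), forall G, D G ->
    exists2 M : connection_model L G, depth_at_most M h & defines P M.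

Definition pcover (p : nat) (G : structure) (U : {set {set G}}) : Prop :=
  cover U = [set: G] /\
  forall X : {set G}, #|X| <= p -> exists2 Y, Y \in U & X \subset Y.

Definition low_shrubdepth_covers (P : {fset nat}) (C : structure -> Prop) :
    Prop :=
  forall p : nat, exists U : forall G : structure, {set {set G}},
    [/\ forall G, C G -> pcover p (U G),
        exists N : nat, forall G, C G -> #|U G| <= N
      & bounded_shrubdepth P (fun H =>
          exists G, C G /\ exists2 X, X \in U G & H = induced X)].

(* Main.v *)
(* By bounded-size covers of bounded shrubdepth, everything is reduced to a connection model
   of bounded depth, seen as a nested sequence of equivalence relations (same ancestor at
   level d).  The model is first made visible: inside a class of level d, the edges are flipped
   according to the connection at this level, and the next classes are taken to be the
   connected components of the resulting graph.  They have bounded diameter, and each vertex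
   can be given a colour singling out one neighbour closer to the root of its component, so
   that "same class" becomes an equation between iterated unary functions, each of which is
   quantifier-free definable from the previous classes, finitely many colours and the edges.

   In such a model, a relation which depends only on the colours of its arguments and on the
   levels at which they are separated keeps this property under existential quantification:
   it suffices to count, up to a threshold, the classes containing an element of a given
   colour.  As a visible class is witnessed by boundedly many vertices, quantifiers over the
   whole graph reduce to quantifiers over the members of a p-cover, for p large enough.  Hence
   every structure along a run of the transduction is described by relations of this kind
   over the input graph.

   The choices made by all the lifts are finally guessed at once as colours of the input: the
   new lifts only allow those sets which can be completed to a run producing an output of the
   original transduction, which makes the two sets of outputs equal. *)
Require Import Defs.
From mathcomp Require Import all_boot.
From mathcomp Require Import finmap.
From mathcomp Require Import zify.
From Stdlib Require Import ClassicalEpsilon FunctionalExtensionality.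

Set Implicit Arguments.
Unset Strict Implicit.
Unset Printing Implicit Defensive.

Local Open Scope fset_scope.
Local Open Scope nat_scope.

(** Everything is done for a whole family of structures at once. The index set is in the end the
    collection of all pairs of a graph of [C] and an output of [I] on it, so one finite set of
    colours and one rule must serve all inputs and all outputs; this uniformity is what finally
    yields one formula, hence one transduction. In return, the colouring of each member may be
    arbitrary: unary lifts can guess any sets, so colours never have to be definable, and the sets
    chosen by the lifts of [I] are just further colours. The obstacle is binary information, which
    no lift can guess. The ancestor relations of a connection model are not given by the graph, and
    quantifier-free formulas see only equality, edges and terms; this is why the model is traded for
    one whose classes are computed by definable functions. Even then a class is recognized inside a
    member of the cover only if the iterates of these functions stay there. This fixes the size of
    the sets to be covered: the number of variables times the number of witnesses of one vertex. *)

Lemma dep_choice (I : Type) (T : I -> Type) (P : forall i, T i -> Prop) :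
  (forall i, exists y, P i y) -> exists f : forall i, T i, forall i, P i (f i).
Proof.
move=> H; exists (fun i => proj1_sig (constructive_indefinite_description _ (H i))).
by move=> i; case: constructive_indefinite_description.
Qed.

(** * Relations determined by colours and pair information *)

Section Determined.
Variable Idx : Type.

(* The value of [rho] depends only on a finite colouring of the arguments, on a constant [g] of
   the structure, and on [lam] for each pair of arguments; the colouring may depend on the
   index [i], but the way to compute [rho] may not. *)
Definition determined (T : Idx -> Type) (L : Type) (lam : forall i, T i -> T i -> L)
    (X Y : Type) (rho : forall i, (X -> T i) -> Y) : Prop :=
  exists (K : finType) (kap : forall i, T i -> K) (g : Idx -> K),
    forall i j (x : X -> T i) (y : X -> T j), g i = g j ->
      (forall a, kap i (x a) = kap j (y a)) ->
      (forall a b, lam i (x a) (x b) = lam j (y a) (y b)) ->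
      rho i x = rho j y.

Section OneFamily.
Variables (T : Idx -> Type) (L : Type) (lam : forall i, T i -> T i -> L).

Lemma det_ext X Y (rho rho' : forall i, (X -> T i) -> Y) :
  (forall i x, rho i x = rho' i x) -> determined lam rho -> determined lam rho'.
Proof.
by move=> H [K [kap [g D]]]; exists K, kap, g => i j x y *; rewrite -!H; apply: D.
Qed.

Lemma det_const X Y (c : Y) : determined lam (fun i (x : X -> T i) => c).
Proof. by exists unit, (fun _ _ => tt), (fun=> tt). Qed.

Lemma det_app X Y Z (F : Y -> Z) (rho : forall i, (X -> T i) -> Y) :
  determined lam rho -> determined lam (fun i x => F (rho i x)).
Proof.
by move=> [K [kap [g D]]]; exists K, kap, g => i j x y *; congr F; apply: D.
Qed.

Lemma det_pair X Y Z (r1 : forall i, (X -> T i) -> Y)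
    (r2 : forall i, (X -> T i) -> Z) :
  determined lam r1 -> determined lam r2 -> determined lam (fun i x => (r1 i x, r2 i x)).
Proof.
move=> [K1 [k1 [g1 D1]]] [K2 [k2 [g2 D2]]].
exists (K1 * K2)%type, (fun i x => (k1 i x, k2 i x)), (fun i => (g1 i, g2 i)).
move=> i j x y [eg1 eg2] ek el; congr pair; [apply: D1|apply: D2] => // a.
  by case: (ek a).
by case: (ek a).
Qed.

Lemma det_op X Y Z W (F : Y -> Z -> W) (r1 : forall i, (X -> T i) -> Y)
    (r2 : forall i, (X -> T i) -> Z) :
  determined lam r1 -> determined lam r2 -> determined lam (fun i x => F (r1 i x) (r2 i x)).
Proof.
by move=> D1 D2; apply: (det_app (fun p => F p.1 p.2) (det_pair D1 D2)).
Qed.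

Lemma det_has X Z (s : seq Z) (r : Z -> forall i, (X -> T i) -> bool) :
  (forall z, determined lam (r z)) -> determined lam (fun i x => has (fun z => r z i x) s).
Proof.
move=> D; elim: s => [|z s IH] /=; first exact: det_const.
exact: det_op (D z) IH.
Qed.

Lemma det_map X Y Z (s : seq Z) (r : Z -> forall i, (X -> T i) -> Y) :
  (forall z, determined lam (r z)) -> determined lam (fun i x => [seq r z i x | z <- s]).
Proof.
move=> D; elim: s => [|z s IH] /=; first exact: det_const.
exact: det_op (D z) IH.
Qed.

Lemma det_ffun X Y (Z : finType) (r : Z -> forall i, (X -> T i) -> Y) :
  (forall z, determined lam (r z)) -> determined lam (fun i x => [ffun z => r z i x]).
Proof.
move=> D; have [K [k [g Dm]]] := det_map (enum Z) D.
exists K, k, g => i j x y eg ek el.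
have em := Dm i j x y eg ek el.
apply/ffunP=> z; rewrite !ffunE.
by move/eq_in_map: em => /(_ z); rewrite mem_enum; apply.
Qed.

Lemma det_reindex X X' Y (s : X -> X') (rho : forall i, (X -> T i) -> Y) :
  determined lam rho -> determined lam (fun i (x : X' -> T i) => rho i (fun a => x (s a))).
Proof.
by move=> [K [kap [g D]]]; exists K, kap, g => i j x y *; apply: D.
Qed.

(** The constant [g] needs a value even when [K] is empty, hence [option K]. *)
Lemma det_color X (K : finType) (kap : forall i, T i -> K) (a : X) :
  determined lam (fun i x => kap i (x a)).
Proof.
by exists (option K), (fun i x => Some (kap i x)), (fun=> None)
  => i j x y _ /(_ a) [].
Qed.

Lemma det_info X (a b : X) : determined lam (fun i x => @lam i (x a) (x b)).
Proof. by exists unit, (fun _ _ => tt), (fun=> tt). Qed.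

End OneFamily.

Lemma det_pull (T T' : Idx -> Type) (io : forall i, T' i -> T i) L
    (lam : forall i, T i -> T i -> L) X Y (rho : forall i, (X -> T i) -> Y) :
  determined lam rho ->
  determined (fun i x y => lam i (io i x) (io i y))
      (fun i (x : X -> T' i) => rho i (fun a => io i (x a))).
Proof.
move=> [K [kap [g D]]]; exists K, (fun i x => kap i (io i x)), g.
by move=> i j x y *; apply: D.
Qed.

Definition two (T : Type) (x y : T) (b : bool) : T := if b then x else y.

Lemma det_trans (T : Idx -> Type) L L' (lam : forall i, T i -> T i -> L)
    (lam' : forall i, T i -> T i -> L') X Y (rho : forall i, (X -> T i) -> Y) :
  determined lam' (fun i (x : bool -> T i) => lam i (x true) (x false)) ->
  determined lam rho -> determined lam' rho.
Proof.
move=> [K1 [k1 [g1 D1]]] [K2 [k2 [g2 D2]]].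
exists (K1 * K2)%type, (fun i x => (k1 i x, k2 i x)), (fun i => (g1 i, g2 i)).
move=> i j x y [eg1 eg2] ek el; apply: D2 => // a.
  by case: (ek a).
move=> b; apply: (D1 i j (two (x a) (x b)) (two (y a) (y b)) eg1).
  by case; [case: (ek a)|case: (ek b)].
by case; case; apply: el.
Qed.

(** Later the information on a pair is available only where both elements have their witnesses in
    the current member of the cover. If all arguments are safe nothing is lost, and otherwise the
    value is [false] anyway. *)
Lemma det_safe (T : Idx -> Type) L (lam : forall i, T i -> T i -> L)
    (X : finType) (rho : forall i, (X -> T i) -> bool)
    (safe : forall i, pred (T i)) :
  determined lam rho ->
  determined (fun i x y => if safe i x && safe i y then Some (lam i x y) else None)
      (fun i x => [forall a, safe i (x a)] && rho i x).
Proof.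
move=> [K [kap [g D]]].
exists (K * bool)%type, (fun i x => (kap i x, safe i x)), (fun i => (g i, true)).
move=> i j x y [eg] ek el.
have -> : [forall a, safe i (x a)] = [forall a, safe j (y a)].
  by apply: eq_forallb => a; case: (ek a).
case: forallP => //= sy; apply: D => // [a|a b]; first by case: (ek a).
by have:= el a b; case: (ek a) (ek b) => _ -> [_ ->]; rewrite !sy => -[].
Qed.

End Determined.

(** * Quantification in a nested sequence of equivalence relations *)

Definition ocons (X T : Type) (x : X -> T) (y : T) (o : option X) : T :=
  if o is Some a then x a else y.

Record hierarchy (T : finType) (n : nat) (V : {set T}) (e : nat -> rel T) : Prop :=
  Hierarchy {
    hier_sym : forall d, symmetric (e d);
    hier_trans : forall d, transitive (e d);
    hier_top : forall x y, e 0 x y = (x \in V) && (y \in V);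
    hier_refl : forall d x, x \in V -> e d x x;
    hier_nest : forall d x y, e d.+1 x y -> e d x y;
    hier_bot : forall x y, e n x y -> x = y
  }.

Definition levels (Idx : Type) (T : Idx -> finType)
    (e : forall i, nat -> rel (T i)) n i (x y : T i) : {ffun 'I_n.+1 -> bool} :=
  [ffun d : 'I_n.+1 => e i d x y].

Section Hierarchy.
Variables (T : finType) (n : nat) (V : {set T}) (e : nat -> rel T).
Hypothesis He : hierarchy n V e.

Lemma hier_le d d' x y : d <= d' -> e d' x y -> e d x y.
Proof.
move=> /subnK <-; elim: (d' - d) => [|k IH] //=.
by rewrite addSn => /(hier_nest He).
Qed.

Lemma hier_in d x y : e d x y -> (x \in V) && (y \in V).
Proof. by move/(hier_le (leq0n d)); rewrite (hier_top He). Qed.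

Lemma hier_left d : left_transitive (e d).
Proof. exact: (sym_left_transitive (hier_sym He d) (hier_trans He (d := d))). Qed.

Lemma hier_right d : right_transitive (e d).
Proof. exact: (sym_right_transitive (hier_sym He d) (hier_trans He (d := d))). Qed.

Definition class d (x : T) : {set T} := [set y | e d x y].

Lemma class_eq d x y : y \in V -> (class d x == class d y) = e d x y.
Proof.
move=> yV; apply/eqP/idP => [/setP/(_ y)|exy].
  by rewrite !inE (hier_refl He).
by apply/setP=> z; rewrite !inE (hier_left exy).
Qed.

End Hierarchy.

Lemma card_imset_kernel (X : finType) (Y Z : finType) (f : X -> Y) (g : X -> Z)
    (P : {set X}) :
  {in P &, forall a b, (f a == f b) = (g a == g b)} ->
  #|f @: P| <= #|g @: P|.
Proof.
move=> H.
case: (set_0Vmem P) => [->|[a0 a0P]]; first by rewrite !imset0 !cards0.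
pose h z := f (odflt a0 [pick a in P | g a == z]).
apply: leq_trans (leq_imset_card h _).
apply/subset_leq_card/subsetP => _ /imsetP[a aP ->].
apply/imsetP; exists (g a); first exact: imset_f.
rewrite /h; case: pickP => [b /andP[bP]|/(_ a)]; last by rewrite aP eqxx.
by rewrite -H // => /eqP.
Qed.

Section Exists.
Variables (Idx : Type) (T : Idx -> finType) (n : nat).
Variables (V : forall i, {set T i}) (e : forall i, nat -> rel (T i)).
Hypothesis He : forall i, hierarchy n (@V i) (@e i).
Variables (K : finType) (kap : forall i, T i -> K).

Definition has_color i d k (x : T i) : bool := [exists y, e d x y && (kap y == k)].

Definition color_classes i d k (x : T i) : {set {set T i}} :=
  [set class (@e i) d.+1 y | y in [set y | e d x y && (kap y == k)]].

Definition reached (X : finType) i d k (x : X -> T i) (b : X) : {set X} :=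
  [set a | e d (x b) (x a) && has_color d.+1 k (x a)].

(* Whether a class at level [d] around [x b] contains an element of colour [k]
   outside the classes at level [d+1] of the parameters is a matter of comparing
   the number of classes of colour [k] with the number of those that are hit. *)
Lemma reached_count (X : finType) i d k (x : X -> T i) (b : X) y :
  e d (x b) y -> kap y = k -> (forall a, ~~ e d.+1 (x a) y) ->
  #|[set class (@e i) d.+1 (x a) | a in reached d k x b]|
    < #|color_classes d k (x b)|.
Proof.
move=> eby ky Hy; apply/proper_card/properP; split.
  apply/subsetP=> C /imsetP[a]; rewrite inE => /andP[eba /existsP[z /andP[eaz kz]]] ->{C}.
  apply/imsetP; exists z; first rewrite inE kz andbT.
    by apply: hier_trans (He i) _ _ _ _ eba _; apply: hier_nest (He i) _ _ _ eaz.
  by apply/eqP; rewrite (class_eq (He i)) //; case/andP: (hier_in (He i) eaz).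
exists (class (@e i) d.+1 y).
  by apply/imsetP; exists y; rewrite ?inE ?eby ?ky /=.
apply/negP=> /imsetP[a _ /eqP].
rewrite eq_sym (class_eq (He i)); first by apply/negP.
by case/andP: (hier_in (He i) eby).
Qed.

Lemma count_reached (X : finType) i d k (x : X -> T i) (b : X) :
  #|[set class (@e i) d.+1 (x a) | a in reached d k x b]|
    < #|color_classes d k (x b)| ->
  exists y, [/\ e d (x b) y, kap y = k & forall a, ~~ e d.+1 (x a) y].
Proof.
rewrite ltnNge => lt.
have /subsetPn[C]: ~~ (color_classes d k (x b) \subset
    [set class (@e i) d.+1 (x a) | a in reached d k x b]).
  by apply: contra lt => /subset_leq_card.
case/imsetP=> y; rewrite inE => /andP[eby /eqP ky] -> nC.
exists y; split=> // a; apply: contra nC => eay.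
have eayd := hier_nest (He i) eay.
apply/imsetP; exists a; first rewrite inE.
  rewrite (hier_trans (He i) eby) 1?(hier_sym (He i)) //=.
  by apply/existsP; exists y; rewrite eay ky eqxx.
apply/eqP; rewrite eq_sym (class_eq (He i)) //.
by case/andP: (hier_in (He i) eay).
Qed.

End Exists.

(** A witness [z] is carried from [i] to [j] by keeping its colour and the deepest level [d] at
    which it shares a class with a parameter [x b]. One level further [z] lies in a class that no
    parameter hits; comparing the truncated number of classes containing this colour with the number
    of those that are hit shows that such a class exists on the other side as well. *)
Lemma det_exists (Idx : Type) (T : Idx -> finType) n (V : forall i, {set T i})
    (e : forall i, nat -> rel (T i)) (X : finType)
    (rho : forall i, (option X -> T i) -> bool) :
  (forall i, hierarchy n (V i) (e i)) ->
  determined (levels e n) rho ->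
  determined (levels e n)
    (fun i (x : X -> T i) => [exists y in V i, rho i (ocons x y)]).
Proof.
move=> He [K [kap [g D]]].
(* At most [#|X|] classes are hit by the parameters, so counts truncated at [#|X|.+1] still tell
   whether another class exists. *)
pose N := #|X|.+1.
pose cnt i d k x := inord (minn N #|color_classes e kap (i := i) d k x|) : 'I_N.+1.
pose kap' i x := (kap i x,
  [ffun dk : 'I_n.+1 * K => has_color e kap (i := i) dk.1 dk.2 x],
  [ffun dk : 'I_n.+1 * K => cnt i dk.1 dk.2 x]).
pose g' i := (g i, [ffun k => [exists y in V i, kap i y == k]]).
exists _, (fun i x => inl (kap' i x)), (fun i => inr (g' i)).
suff H i j (x : X -> T i) (y : X -> T j) : g' i = g' j ->
    (forall a, kap' i (x a) = kap' j (y a)) ->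
    (forall a b, levels e n (x a) (x b) = levels e n (y a) (y b)) ->
    [exists z in V i, rho i (ocons x z)] -> [exists z in V j, rho j (ocons y z)].
  move=> i j x y [eg1 eg2] ek el; apply/idP/idP; apply: H => //.
  - by rewrite /g' eg1 eg2.
  - by move=> a; case: (ek a) => e1 e2 e3; rewrite /kap' e1 e2 e3.
  - by rewrite /g' eg1 eg2.
  - by move=> a; case: (ek a) => e1 e2 e3; rewrite /kap' e1 e2 e3.
move=> [eg1 /ffunP eg2] ek el /exists_inP[z zV rz].
have ekc a : kap i (x a) = kap j (y a) by case: (ek a).
have ekh a d k : d <= n -> has_color e kap d k (x a) = has_color e kap d k (y a).
  move=> dn; case: (ek a) => _ /ffunP/(_ (inord d, k)) + _.
  by rewrite !ffunE /= !inordK.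
have ekn a d k : d <= n -> minn N #|color_classes e kap d k (x a)|
    = minn N #|color_classes e kap d k (y a)|.
  move=> dn; case: (ek a) => _ _ /ffunP/(_ (inord d, k)).
  rewrite !ffunE /= /cnt !inordK // => /(congr1 val) /=.
  by rewrite !inordK // ltnS geq_minl.
have ele a b d : d <= n -> e i d (x a) (x b) = e j d (y a) (y b).
  by move=> dn; have /ffunP/(_ (inord d)) := el a b; rewrite !ffunE /= inordK.
have fin (w : T j) : w \in V j -> kap i z = kap j w ->
    (forall a d, d <= n -> e i d (x a) z = e j d (y a) w) ->
    [exists z in V j, rho j (ocons y z)].
  move=> wV kw ew; apply/exists_inP; exists w => //.
  rewrite -(D i j (ocons x z)) //; first by case.
  move=> [a|] [b|] /=; first exact: el.
  - by apply/ffunP=> d; rewrite !ffunE ew // -ltnS.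
  - by apply/ffunP=> d; rewrite !ffunE (hier_sym (He i)) ew 1?(hier_sym (He j)) // -ltnS.
  - by apply/ffunP=> d; rewrite !ffunE (hier_refl (He i)) ?(hier_refl (He j)).
(* If [z] shares no class of level 0 with a parameter, then no parameter lies in [V i], and any
   element of [V j] of the right colour will do; [g'] ensures that there is one. *)
have [/existsP[a0 ea0]|/existsPn nV] := boolP [exists a, e i 0 (x a) z]; last first.
  have := eg2 (kap i z); rewrite !ffunE.
  have -> : [exists y0 in V i, kap i y0 == kap i z] by apply/exists_inP; exists z.
  move/esym/exists_inP=> [w wV /eqP kw]; apply: (fin w) => // a d dn.
  have nx : x a \notin V i.
    by apply: contra (nV a) => xV; rewrite (hier_top (He i)) xV zV.
  have ny : y a \notin V j.
    by have := ele a a 0 isT; rewrite (hier_top (He i)) (hier_top (He j)) !andbb (negPf nx) => <-.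
  have -> : e i d (x a) z = false.
    by apply/negP=> /(hier_in (He i))/andP[xV _]; rewrite xV in nx.
  by apply/esym/negP=> /(hier_in (He j))/andP[yV _]; rewrite yV in ny.
(* The deepest level at which [z] meets a parameter. *)
pose Q d := (d <= n) && [exists a, e i d (x a) z].
have exQ : exists d, Q d by exists 0; rewrite /Q /=; apply/existsP; exists a0.
have ubQ d : Q d -> d <= n by case/andP.
case: (ex_maxnP exQ ubQ) => d /andP[dn /existsP[b eb]] maxd.
have [dltn|] := ltnP d n; last first.
  move=> nd; have ? : d = n by lia.
  subst d; have ? := hier_bot (He i) eb; subst z.
  apply: (fin (y b)) => //; last by move=> a d' dn'; rewrite ele.
  by have := ele b b 0 isT; rewrite !(hier_top (He _)) zV !andbb.
have nz a : ~~ e i d.+1 (x a) z.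
  apply/negP=> eaz; suff: d.+1 <= d by rewrite ltnn.
  by apply: maxd; rewrite /Q dltn; apply/existsP; exists a.
have := reached_count He eb (erefl (kap i z)) nz.
set m := #|_| => ltm.
have mN : m < N by rewrite ltnS (leq_trans (leq_imset_card _ _)) // max_card.
have eqR : reached e kap d (kap i z) x b = reached e kap d (kap i z) y b.
  by apply/setP=> a; rewrite !inE ele // ekh.
(* The two sets of classes live in different structures; they are compared through the coincidences
   between parameters, which are the same on both sides. *)
have lem : #|[set class (e j) d.+1 (y a) | a in reached e kap d (kap i z) y b]| <= m.
  rewrite /m -eqR; apply: card_imset_kernel => a a'.
  rewrite !inE => /andP[ea _] /andP[ea' _].
  have /andP[_ xV] := hier_in (He i) ea'.
  have /andP[_ yV] : (y b \in V j) && (y a' \in V j).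
    by apply: (hier_in (He j) (d := d)); rewrite -ele.
  by rewrite (class_eq (He i)) // (class_eq (He j)) // ele.
have ec := ekn b d (kap i z) dn.
have /(count_reached He)[w [ebw kw nw]] :
    #|[set class (e j) d.+1 (y a) | a in reached e kap d (kap i z) y b]|
      < #|color_classes e kap d (kap i z) (y b)|.
  by rewrite /minn in ec; case: ifP ec; case: ifP; lia.
apply: (fin w) => //; first by case/andP: (hier_in (He j) ebw).
move=> a d' dn'; have [led|ltd] := leqP d' d.
  have -> : e i d' (x a) z = e i d' (x a) (x b).
    by apply/esym/(hier_right (He i))/(hier_le (He i) led).
  have -> : e j d' (y a) w = e j d' (y a) (y b).
    by apply/esym/(hier_right (He j))/(hier_le (He j) led).
  exact: ele.
have -> : e i d' (x a) z = false.
  by apply/negP=> /(hier_le (He i) ltd); apply/negP/nz.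
by apply/esym/negP=> /(hier_le (He j) ltd); apply/negP/nw.
Qed.

Definition determined2 (Idx : Type) (T : Idx -> Type) L (lam : forall i, T i -> T i -> L)
    Y (R : forall i, T i -> T i -> Y) : Prop :=
  determined lam (fun i (x : bool -> T i) => R i (x true) (x false)).

Lemma det2_at (Idx : Type) (T : Idx -> Type) L (lam : forall i, T i -> T i -> L)
    Y (R : forall i, T i -> T i -> Y) X (a b : X) :
  determined2 lam R -> determined lam (fun i (x : X -> T i) => R i (x a) (x b)).
Proof. by move/(det_reindex (fun t : bool => if t then a else b)). Qed.

Lemma det2_eq (Idx : Type) (T : Idx -> finType) n (V : forall i, {set T i})
    (e : forall i, nat -> rel (T i)) :
  (forall i, hierarchy n (V i) (e i)) ->
  determined2 (levels e n) (fun i x y => (x \in V i) && (x == y)).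
Proof.
move=> He.
have := det_app (fun l : {ffun 'I_n.+1 -> bool} => l ord_max)
  (det_info (levels e n) true false).
apply: det_ext => i x; rewrite ffunE /=.
apply/idP/andP => [exy|[xV /eqP <-]]; last exact: hier_refl (He i) _ _ xV.
by rewrite (hier_bot (He i) exy) eqxx; case/andP: (hier_in (He i) exy).
Qed.

Lemma card_bigcup (I T : finType) (F : I -> {set T}) :
  #|\bigcup_i F i| <= \sum_i #|F i|.
Proof.
elim/big_rec2: _ => [|i m A _ le]; rewrite ?cards0 //.
by rewrite (leq_trans (leq_card_setU _ _)) ?leq_add2l.
Qed.

(** Iteration of [g], written with quantifiers ranging over [V] so that [det_exists] applies to each
    step. *)
Fixpoint chain (T : finType) (V : {set T}) (safe : pred T) (g : rel T) r x y :=
  if r is r'.+1 then [exists z in V, chain V safe g r' x z && g z y]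
  else safe x && ((x \in V) && (x == y)).

(** * Visible equivalence relations *)

Section Visible.
Variables (Idx : Type) (G : Idx -> finType) (E : forall i, rel (G i)).

(* Partial equivalence relations whose classes can be recognized by quantifier-free formulas:
   [visible_fun] refines [e] by the equality of [iter D f], where the graph of [f] is
   definable from [e], the edges and finitely many colours. *)
Inductive visible : (forall i, rel (G i)) -> Prop :=
| visible_set (V : forall i, {set G i}) : visible (fun i x y => (x \in V i) && (y \in V i))
| visible_fun e (f : forall i, G i -> G i) (K : finType) (kap : forall i, G i -> K)
    (Psi : K -> K -> bool -> bool -> bool) (D : nat) :
    visible e ->
    (forall i x, e i x x -> forall y,
       (f i x == y) = e i x y && Psi (kap i x) (kap i y) (x == y) (@E i x y)) ->
    visible (fun i x y => [&& e i x x, e i y y & iter D (f i) x == iter D (f i) y]).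

Lemma visible_per e : visible e -> forall i, symmetric (e i) /\ transitive (e i).
Proof.
elim=> [V|{}e f K kap Psi D _ _ _] i; split.
- by move=> x y; rewrite andbC.
- by move=> y x z /andP[-> _] /andP[_ ->].
- by move=> x y; rewrite eq_sym andbCA.
- by move=> y x z /and3P[-> _ /eqP->] /and3P[_ -> ->].
Qed.

Lemma visible_left e : visible e -> forall i x y, e i x y -> e i x x /\ e i y y.
Proof.
move=> ve i x y exy; have [sy tr] := visible_per ve i.
by split; [apply: (tr y) | apply: (tr x)]; rewrite // sy.
Qed.

(* On any member [V] of a cover, [e] is determined by the levels of [V] for those elements
   [x] whose witnesses [S x] are all in [V]. *)
Definition local (e : forall i, rel (G i)) (S : forall i, G i -> {set G i}) : Prop :=
  forall n V (lev : forall i, nat -> rel (G i)),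
    (forall i, hierarchy n (V i) (lev i)) ->
    determined2 (levels lev n) (fun i x y => [&& x \in V i, y \in V i & @E i x y]) ->
    determined2 (levels lev n)
      (fun i x y => [&& S i x \subset V i, S i y \subset V i & e i x y]).

(** For [visible_fun], the witnesses of [x] are those of its first [D] iterates together with its
    own. When they all lie in [V], the graph of [f] along the orbit is determined by the levels, and
    equality of the last iterates is a quantification over [V]. Being in the domain of [e] is a
    property of one element, hence a mere colour. *)
Lemma visible_local e : visible e -> exists (S : forall i, G i -> {set G i}) p,
  [/\ forall i x, #|S i x| <= p, forall i x, x \in S i x & local e S].
Proof.
elim=> [U|{}e f K kap Psi D ve [S [p [Sp xS loc]]] fP].
  exists (fun i x => [set x]), 1; split=> [i x|i x|n V lev Hl HE].
  - by rewrite cards1.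
  - by rewrite set11.
  apply: det_ext (det_op (fun a b : bool => a && b)
    (det_color _ (fun i x => (x \in V i) && (x \in U i)) true)
    (det_color _ (fun i x => (x \in V i) && (x \in U i)) false)) => i x.
  by rewrite !sub1set; case: (_ \in _); case: (_ \in _); rewrite ?andbF.
pose S' i x := \bigcup_(r < D.+1) S i (iter r (f i) x).
exists S', (D.+1 * p); split=> [i x|i x|n V lev Hl HE].
- apply: (leq_trans (card_bigcup _)).
  rewrite -[X in _ <= X * _]card_ord -sum_nat_const.
  by apply: leq_sum => r _; apply: Sp.
- by apply/bigcupP; exists ord0.
have {}loc := loc n V lev Hl HE.
have Deq := det2_eq Hl.
pose safe i x := S i x \subset V i.
have safeV i x : safe i x -> x \in V i by move/subsetP; apply; apply: xS.
pose g i x y := [&& safe i x, safe i y, e i x y &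
  Psi (kap i x) (kap i y) (x == y) (@E i x y)].
have Dg : determined2 (levels lev n) g.
  have := det_op (fun (a : bool) b => a && b) loc
    (det_op (fun a b => Psi a.1 a.2 b.1 b.2)
      (det_op pair (det_color (levels lev n) kap true)
                   (det_color (levels lev n) kap false))
      (det_op pair Deq HE)).
  apply: det_ext => i x; rewrite /g /safe /=.
  have [sx|//] /= := boolP (S i (x true) \subset V i).
  have [sy|//] /= := boolP (S i (x false) \subset V i).
  by rewrite !safeV.
pose c r i := chain (V i) (safe i) (g i) r.
have Dc r : determined2 (levels lev n) (c r).
  elim: r => [|r IH].
    exact: det_op (det_color _ safe true) Deq.
  apply: (det_exists (rho := fun i (x : option bool -> G i) =>
    c r i (x (Some true)) (x None) && g i (x None) (x (Some false))) Hl).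
  by apply: det_op; apply: det2_at.
(* [c r] is the graph of the [r]-th iterate as long as all the iterates met are safe. *)
have cE r i x y : e i x x -> c r i x y =
    [forall k : 'I_r.+1, safe i (iter k (f i) x)] && (iter r (f i) x == y).
  move=> ex; elim: r y => [|r IH] y.
    apply/and3P/andP => [[sx _ ->]|[/forallP/(_ ord0) /= sx ->]]; last by rewrite safeV.
    by split=> //; apply/forallP=> k; rewrite ord1.
  (* Since [f] never leaves a class of [e], the orbit stays where [fP] applies. *)
  have exr k : e i (iter k (f i) x) (iter k (f i) x).
    elim: k => // k IHk; have := fP i _ IHk (f i (iter k (f i) x)).
    by rewrite eqxx => /esym/andP[/(visible_left ve)[]].
  have -> : c r.+1 i x y = [exists z in V i, c r i x z && g i z y] by [].
  apply/exists_inP/andP => [[z zV]|[/forallP sf /eqP <-]].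
    rewrite IH => /andP[/andP[/forallP sk /eqP zr] /and4P[sz sy ezy Pzy]].
    have fzy : iter r.+1 (f i) x == y by rewrite iterS zr fP -?zr ?exr ?zr ?ezy.
    split=> //; apply/forallP=> k; have [kr|] := ltnP k r.+1.
      by have := sk (Ordinal kr).
    move=> rk; have -> : nat_of_ord k = r.+1 by have := ltn_ord k; lia.
    by rewrite (eqP fzy).
  exists (iter r (f i) x); first by apply: safeV; have := sf (inord r); rewrite inordK.
  rewrite IH eqxx andbT; apply/andP; split.
    apply/forallP=> k; have := sf (inord k); rewrite inordK //.
    by have := ltn_ord k; lia.
  have := sf (inord r); have := sf (inord r.+1); rewrite !inordK // /g => -> -> /=.
  by rewrite -fP.
have := det_op (fun a b : bool => a && b)
  (det_op (fun a b : bool => a && b)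
    (det_color (levels lev n) (fun i x => S' i x \subset V i) true)
    (det_color (levels lev n) (fun i x => S' i x \subset V i) false))
  (det_op (fun a b : bool => a && b)
    (det_op (fun a b : bool => a && b)
      (det_color (levels lev n) (fun i x => e i x x) true)
      (det_color (levels lev n) (fun i x => e i x x) false))
    (det_exists (rho := fun i (x : option bool -> G i) =>
      c D i (x (Some true)) (x None) && c D i (x (Some false)) (x None)) Hl
      (det_op (fun a b : bool => a && b) (det2_at _ _ (Dc D)) (det2_at _ _ (Dc D))))).
apply: det_ext => i x; rewrite /= -!andbA.
have [sx|//] /= := boolP (S' i (x true) \subset V i).
have [sy|//] /= := boolP (S' i (x false) \subset V i).
have [ex|//] /= := boolP (e i (x true) (x true)).
have [ey|//] /= := boolP (e i (x false) (x false)).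
have Ssafe b : S' i (x b) \subset V i ->
    [forall k : 'I_D.+1, safe i (iter k (f i) (x b))].
  by move=> sb; apply/forallP=> k; apply: subset_trans sb; apply: bigcup_sup.
apply/exists_inP/eqP => [[z _]|eq].
  by rewrite !cE // => /andP[/andP[_ /eqP->] /andP[_ /eqP->]].
exists (iter D (f i) (x true)).
  by apply: safeV; have /forallP/(_ ord_max) := Ssafe _ sx.
by rewrite !cE // !Ssafe //= eqxx eq eqxx.
Qed.

End Visible.

(** * Components of the flipped graph *)

(** A step may stay in place, so these are walks of length at most [t], and the relation is monotone
    in [t]. *)
Fixpoint reach (T : finType) (H : rel T) t (x y : T) :=
  if t is t'.+1 then [exists z, reach H t' x z && ((z == y) || H z y)] else x == y.

(** The value is [#|T|.+1] when [y] cannot be reached. *)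
Definition dist (T : finType) (H : rel T) (x y : T) : nat :=
  find (fun t => reach H t x y) (iota 0 #|T|.+1).

Section Dist.
Variables (T : finType) (H : rel T).

Lemma reachS t x y : reach H t.+1 x y =
  [exists z, reach H t x z && ((z == y) || H z y)].
Proof. by []. Qed.

Lemma reach_step t x y z : reach H t x y -> H y z -> reach H t.+1 x z.
Proof. by move=> r h; rewrite reachS; apply/existsP; exists y; rewrite r h orbT. Qed.

Lemma reach_leq t t' x y : t <= t' -> reach H t x y -> reach H t' x y.
Proof.
move=> /subnK <-; elim: (t' - t) => // k IH r.
by rewrite addSn reachS; apply/existsP; exists y; rewrite eqxx IH.
Qed.

Lemma reach_connect t x y : reach H t x y -> connect H x y.
Proof.
elim: t y => [|t IH] y; first by move/eqP->.
rewrite reachS => /existsP[z /andP[/IH xz /orP[/eqP <- //|/connect1]]].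
exact: connect_trans.
Qed.

Lemma reach_trans s t x y z : reach H s x y -> reach H t y z -> reach H (s + t) x z.
Proof.
move=> r; elim: t z => [|t IH] z; first by rewrite addn0 => /eqP <-.
rewrite reachS => /existsP[w /andP[/IH xw h]].
by rewrite addnS reachS; apply/existsP; exists w; rewrite xw.
Qed.

Lemma path_reach x p : path H x p -> reach H (size p) x (last x p).
Proof.
elim/last_ind: p => [|p y IH] //=; rewrite rcons_path => /andP[/IH r h].
by rewrite size_rcons last_rcons; apply: reach_step h.
Qed.

Lemma connect_reach x y : connect H x y -> reach H #|T| x y.
Proof.
case/connectP=> p /shortenP[q hq uq _] ->.
apply: reach_leq (path_reach hq).
by have := max_card (mem (x :: q)); rewrite (card_uniqP uq) => /ltnW.
Qed.

Lemma dist_reach x y : connect H x y -> reach H (dist H x y) x y.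
Proof.
move/connect_reach=> r.
have h : has (fun t => reach H t x y) (iota 0 #|T|.+1).
  by apply/hasP; exists #|T|; rewrite // mem_iota ltnSn.
have := nth_find 0 h; rewrite nth_iota //.
by have := h; rewrite has_find size_iota.
Qed.

Lemma dist_leq t x y : reach H t x y -> dist H x y <= t.
Proof.
have main s : s <= #|T| -> reach H s x y -> dist H x y <= s.
  move=> sT r; rewrite leqNgt; apply/negP=> /(before_find 0).
  by rewrite nth_iota // r.
move=> r; have [tT|Tt] := leqP t #|T|; first exact: main.
apply: leq_trans (ltnW Tt); apply: main => //.
exact/connect_reach/reach_connect/r.
Qed.

Lemma dist0 x y : connect H x y -> dist H x y = 0 -> x = y.
Proof. by move/dist_reach=> + e0; rewrite e0 => /eqP. Qed.

Lemma dist_step x y z t : connect H x y -> reach H t y z ->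
  dist H x z <= dist H x y + t.
Proof. by move=> /dist_reach r h; apply/dist_leq/reach_trans/h. Qed.

Lemma dist_pred x y t : connect H x y -> dist H x y = t.+1 ->
  exists z, [/\ H z y, connect H x z & dist H x z = t].
Proof.
move=> xy dt; have := dist_reach xy; rewrite dt reachS.
case/existsP=> z /andP[r /orP[/eqP zy|hzy]].
  by have := dist_leq r; rewrite zy dt ltnn.
exists z; split=> //; first exact: reach_connect r.
have lt := dist_leq r; have := dist_step (reach_connect r) (t := 1) (z := y).
have r1 : reach H 1 z y by rewrite reachS; apply/existsP; exists z; rewrite /= eqxx hzy orbT.
by move/(_ r1); rewrite dt; lia.
Qed.

Lemma dist_mid x y t : connect H x y -> t <= dist H x y ->
  exists z, connect H x z /\ dist H x z = t.
Proof.
move=> xy /subnKC; move: (_ - t) => k; elim: k y xy => [|k IH] y xy.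
  by rewrite addn0 => ->; exists y.
rewrite addnS => /esym/(dist_pred xy)[z [_ xz /esym/IH]]; exact.
Qed.

End Dist.

(** Unlike in [hierarchy], level 0 may have several classes. Dropping the first level therefore
    gives a sequence of the same kind, which is what the inductions on [n] use. *)
Record nested (T : finType) (n : nat) (e : nat -> rel T) : Prop := Nested {
  nested_sym : forall d, symmetric (e d);
  nested_trans : forall d, transitive (e d);
  nested_refl : forall d x, e 0 x x -> e d x x;
  nested_nest : forall d x y, e d.+1 x y -> e d x y;
  nested_bot : forall x y, e n x y -> x = y
}.

Lemma nested_le (T : finType) n (e : nat -> rel T) : nested n e ->
  forall d d' x y, d <= d' -> e d' x y -> e d x y.
Proof.
move=> ne d d' x y /subnK <-; elim: (d' - d) => [|k IH] //=.
by rewrite addSn => /(nested_nest ne).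
Qed.

Lemma nested_left (T : finType) n (e : nat -> rel T) : nested n e ->
  forall d x y, e d x y -> e d x x.
Proof. by move=> ne d x y h; apply: (nested_trans ne h); rewrite (nested_sym ne). Qed.

Lemma nested_shift (T : finType) n (e : nat -> rel T) :
  nested n.+1 e -> nested n (fun d => e d.+1).
Proof.
move=> ne; split=> [d|d|d x h|d|x y];
  [exact: nested_sym ne _|exact: nested_trans ne _| | exact: nested_nest ne _|exact:
    nested_bot ne _ _].
exact/(nested_refl ne)/(nested_nest ne)/h.
Qed.

(** Abstract form of a connection model: [d] is the level of the least common ancestor, and [c d]
    the relation prescribed there. *)
Definition by_levels (T K : Type) (H : rel T) (e : nat -> rel T) (kap : T -> K)
    (c : nat -> K -> K -> bool) : Prop :=
  forall d x y, e d x y -> ~~ e d.+1 x y -> H x y = c d (kap x) (kap y).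

Section Special.
Variables (T K : finType) (e : nat -> rel T) (kap : T -> K).

(* Two elements of colour [k] in the class of [x], in distinct classes of level 1 if possible:
   a vertex adjacent to some element of colour [k] outside its own class of level 1 is adjacent
   to one of them. *)
Definition special1 (x : T) k : T := odflt x [pick z | e 0 x z && (kap z == k)].

Definition special (x : T) k (b : bool) : T :=
  if b then special1 x k else
  odflt x [pick z | [&& e 0 x z, kap z == k & ~~ e 1 (special1 x k) z]].

Variables (n : nat) (c : nat -> K -> K -> bool) (H : rel T).
Hypotheses (ne : nested n e) (He : by_levels H e kap c).

Lemma class_rel x z y : e 0 x z -> e 0 x y = e 0 z y.
Proof. by move=> xz; apply: (sym_left_transitive (nested_sym ne 0) (nested_trans ne (d := 0))).
  Qed.

Lemma special1_eq x z k : e 0 x z -> kap z = k -> special1 x k = special1 z k.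
Proof.
move=> xz kz; rewrite /special1 (@eq_pick _ _ (fun y => e 0 z y && (kap y == k))).
  by case: pickP => // /(_ z); rewrite -(class_rel _ xz) xz kz eqxx.
by move=> y; rewrite /= (class_rel _ xz).
Qed.

Lemma special_eq x z k b : e 0 x z -> kap z = k ->
  b || ~~ e 1 (special1 x k) z -> special x k b = special z k b.
Proof.
case: b => [xz kz _|xz kz /=]; first exact: special1_eq.
rewrite /special -(special1_eq xz kz) => nz.
rewrite (@eq_pick _ _ (fun y => [&& e 0 z y, kap y == k & ~~ e 1 (special1 x k) y])).
  by case: pickP => // /(_ z); rewrite -(class_rel _ xz) xz kz eqxx nz.
by move=> y; rewrite /= (class_rel _ xz).
Qed.

Lemma specialP r x y : e 0 r x -> e 0 x y -> ~~ e 1 x y -> H x y ->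
  exists b, let s := special r (kap y) b in
    [/\ e 0 x s, kap s = kap y, ~~ e 1 x s, H x s & b || ~~ e 1 (special1 r (kap y)) s].
Proof.
move=> rx xy nxy hxy.
suff [b [h1 h2 h3 h4]] : exists b, let s := special r (kap y) b in
    [/\ e 0 x s, kap s = kap y, ~~ e 1 x s & b || ~~ e 1 (special1 r (kap y)) s].
  by exists b; split=> //; rewrite (He h1) // h2 -(He xy).
have ry := nested_trans ne rx xy.
have [z1 [rz1 kz1 z1E]] : exists z, [/\ e 0 r z, kap z = kap y & special1 r (kap y) = z].
  rewrite /special1; case: pickP => [z /andP[rz /eqP kz]|/(_ y)]; first by exists z.
  by rewrite ry eqxx.
have xz z : e 0 r z -> e 0 x z by apply: (nested_trans ne); rewrite (nested_sym ne).
have [e1|ne1] := boolP (e 1 x z1); last by exists true; rewrite /= z1E; split; auto.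
exists false; rewrite /special z1E.
case: pickP => [z /and3P[rz /eqP kz nz]|/(_ y)].
  split; auto; apply: contra nz => /=; apply: (nested_trans ne).
  by rewrite (nested_sym ne).
rewrite ry eqxx /= => /negbFE z1y; case/negP: nxy.
exact: (nested_trans ne e1 z1y).
Qed.

End Special.

(* Among the neighbours of [x] outside its own class at level 1, one is special;
   otherwise all neighbours are in this class and the next level applies. *)
Lemma guide n (K : finType) : exists J : finType,
  forall (T : finType) (e : nat -> rel T) (kap : T -> K) c (H : rel T),
    nested n e -> by_levels H e kap c -> subrel H (e 0) -> irreflexive H ->
    exists beta : T -> {set J}, forall x, [exists y, H x y] ->
      exists j y, [/\ H x y, j \in beta y &
        forall y', H x y' -> j \in beta y' -> y' = y].
Proof.
elim: n => [|n [J IH]].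
  exists unit => T e kap c H ne _ He Hi; exists (fun=> set0) => x /existsP[y h].
  by have := nested_bot ne (He _ _ h) => xy; rewrite xy Hi in h.
exists (J + K * bool)%type => T e kap c H ne Hk He Hi.
have [beta bP] : exists beta : T -> {set J}, forall x, [exists y, H x y && e 1 x y] ->
    exists j y, [/\ H x y && e 1 x y, j \in beta y &
      forall y', H x y' && e 1 x y' -> j \in beta y' -> y' = y].
  apply: (IH T (fun d => e d.+1) kap (fun d => c d.+1)
    (fun x y => H x y && e 1 x y) (nested_shift ne)).
  - by move=> d x y /= exy nxy; rewrite (nested_le ne _ exy) // andbT (Hk _ _ _ exy nxy).
  - by move=> x y /andP[].
  - by move=> x; rewrite Hi.
(* The mark is computed from [y] itself, so that each class of level 0 has at most one vertex marked
   [(k, b)]. *)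
pose sel k b y := [&& kap y == k, y == special e kap y k b &
  b || ~~ e 1 (special1 e kap y k) y].
exists (fun y => [set j | match j with
  | inl j => j \in beta y | inr (k, b) => sel k b y end]) => x hx.
have [/existsP[y /andP[h nxy]]|/existsPn no] := boolP [exists y, H x y && ~~ e 1 x y].
  have xx := nested_left ne (He _ _ h).
  have [b] := specialP ne Hk xx (He _ _ h) nxy h.
  set s := special _ _ _ _ _ => -[xs ks _ hs bs].
  exists (inr (kap y, b)), s; split=> //.
    rewrite inE /sel ks eqxx -(special1_eq ne xs ks) bs andbT /=.
    by rewrite -(special_eq ne xs ks bs) /s.
  move=> y' h'; rewrite inE => /and3P[/eqP ky' /eqP sy' by'].
  have xy' := He _ _ h'.
  by rewrite sy' -(special_eq ne xy' ky') // (special1_eq ne xy' ky').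
have [j [y [/andP[h _] jy uy]]] : exists j y, [/\ H x y && e 1 x y, j \in beta y &
      forall y', H x y' && e 1 x y' -> j \in beta y' -> y' = y].
  apply: bP; case/existsP: hx => y h; apply/existsP; exists y; rewrite h /=.
  by have := no y; rewrite h /= negbK.
exists (inl j), y; split=> //; first by rewrite inE.
move=> y' h'; rewrite inE; apply: uy; rewrite h' /=.
by have := no y'; rewrite h' /= negbK.
Qed.

(** By induction, the components of the edges inside classes of level 1 have diameter at most [D].
    On a shortest path longer than this, every vertex is close to an edge leaving its class of level
    1, hence within [D.+1] of one of the [2 * #|K|] special vertices of the class of level 0. Each
    of these can serve only [2 * D + 3] consecutive distances from the starting point, which bounds
    the length of the path. *)
Lemma diameter n (K : finType) : exists D,
  forall (T : finType) (e : nat -> rel T) (kap : T -> K) c (H : rel T),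
    nested n e -> by_levels H e kap c -> subrel H (e 0) -> symmetric H ->
    forall x y, connect H x y -> reach H D x y.
Proof.
elim: n => [|n [D IH]].
  exists 0 => T e kap c H ne _ He _ x y /connectP[p hp ->].
  elim: p x hp => [|z p IHp] x //= /andP[h /IHp].
  by rewrite (nested_bot ne (He _ _ h)).
exists (#|{: K * bool * 'I_((2 * D).+3)}|) => T e kap c H ne Hk He Hs r y ry.
pose H1 x y := H x y && e 1 x y.
have {}IH x z : connect H1 x z -> reach H1 D x z.
  apply: (IH T (fun d => e d.+1) kap (fun d => c d.+1)) => //.
  - exact: nested_shift.
  - by move=> d u v /= euv nuv; rewrite /H1 (nested_le ne _ euv) // andbT (Hk _ _ _ euv nuv).
  - by move=> u v /andP[].
  by move=> u v; rewrite /H1 Hs (nested_sym ne).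
have sub t x z : reach H1 t x z -> reach H t x z.
  elim: t z => //= t IHt z /existsP[w /andP[/IHt rw h]].
  apply/existsP; exists w; rewrite rw /=.
  by case/orP: h => [->//|/andP[->]]; rewrite orbT.
apply: reach_leq (dist_reach ry).
rewrite leqNgt; apply/negP=> lt.
have big : D < #|{: K * bool * 'I_((2 * D).+3)}|.
  rewrite !card_prod card_bool card_ord.
  have : 0 < #|K| by apply/card_gt0P; exists (kap r).
  nia.
have nr1 : ~ connect H1 r y by move/IH/sub/dist_leq; lia.
have H1s : connect_sym H1.
  by apply: sym_connect_sym => u v; rewrite /H1 Hs (nested_sym ne).
have Hcs : connect_sym H by apply: sym_connect_sym.
have near z : connect H r z -> exists kb : K * bool,
    [/\ connect H r (special e kap r kb.1 kb.2),
      dist H r z <= dist H r (special e kap r kb.1 kb.2) + D.+1 &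
      dist H r (special e kap r kb.1 kb.2) <= dist H r z + D.+1].
  move=> rz.
  have [/existsP[w /existsP[u /and3P[zw hwu nwu]]]|no] :=
      boolP [exists w, exists u, [&& connect H1 z w, H w u & ~~ e 1 w u]]; last first.
    (* With no edge leaving the class of level 1, the [H1]-component of [z] would be its whole
       component in [H] and would contain both [r] and [y]. *)
    case: nr1; suff cl u v : connect H1 z u -> connect H u v -> connect H1 z v.
      have zr : connect H1 z r by apply: (cl z); rewrite // Hcs.
      have zy : connect H1 z y by apply: (cl z) => //; apply: connect_trans ry; rewrite Hcs.
      by apply: connect_trans zy; rewrite H1s.
    move=> zu /connectP[p hp ->]; elim: p u zu hp => //= w p IHp u zu /andP[h].
    apply: IHp; apply: (connect_trans zu); apply: connect1; rewrite /H1 h /=.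
    apply: contraNT no => nuw; apply/existsP; exists u; apply/existsP; exists w.
    by rewrite zu h.
  have zwD := sub _ _ _ (IH _ _ zw).
  have rw : connect H r w := connect_trans rz (reach_connect zwD).
  have rew : e 0 r w.
    have ww := nested_left ne (He _ _ hwu).
    have : connect H w r by rewrite Hcs.
    case/connectP=> p hp ->; rewrite (nested_sym ne).
    elim/last_ind: p hp => //= p v IHp; rewrite rcons_path last_rcons => /andP[/IHp lw h].
    exact: (nested_trans ne lw (He _ _ h)).
  have [b /= [ws ks _ hs _]] := specialP ne Hk rew (He _ _ hwu) nwu hwu.
  have zs := reach_step zwD hs.
  exists (kap u, b); split=> /=.
  - exact: connect_trans rz (reach_connect zs).
  - have sz : reach H D.+1 (special e kap r (kap u) b) z.
      have wzD : reach H D w z by apply/sub/IH; rewrite H1s.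
      have sw : reach H 1 (special e kap r (kap u) b) w.
        by rewrite reachS; apply/existsP; exists (special e kap r (kap u) b);
          rewrite /= eqxx Hs hs orbT.
      exact: reach_trans sw wzD.
    apply: dist_step sz; exact: connect_trans rz (reach_connect zs).
  - exact: dist_step zs.
pose N := #|{: K * bool * 'I_((2 * D).+3)}|.
have /dep_choice[f fP] : forall t : 'I_N.+1, exists kb : K * bool,
    t <= dist H r (special e kap r kb.1 kb.2) + D.+1 /\
    dist H r (special e kap r kb.1 kb.2) <= t + D.+1.
  move=> t.
  have tN : t <= dist H r y by apply: leq_trans (ltnW lt); rewrite -ltnS ltn_ord.
  have [z [rz <-]] := dist_mid ry tN.
  by have [kb [_ h1 h2]] := near z rz; exists kb.
(* A distance [t] is recovered from a special vertex near it and from its offset to the distance of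
   that vertex, shifted by [D.+1] to be nonnegative. *)
pose g (t : 'I_N.+1) : K * bool * 'I_((2 * D).+3) :=
  (f t, inord (t + D.+1 - dist H r (special e kap r (f t).1 (f t).2))).
have injg : injective g.
  move=> t t' gg; have ef : f t = f t' := congr1 fst gg.
  have := congr1 (fun o => nat_of_ord o.2) gg.
  have [h1 h2] := fP t; have [h1' h2'] := fP t'; rewrite -ef in h1' h2'.
  rewrite /= -ef !inordK; [move=> h; apply: val_inj => /=; lia|lia|lia].
by have := leq_card g injg; rewrite card_ord ltnn.
Qed.

Section VisLevels.
Variables (Idx : Type) (G : Idx -> finType) (E : forall i, rel (G i)).
Hypothesis Esym : forall i, symmetric (@E i).

(* Exclusive or with the adjacency prescribed at level 0; the two disjuncts make it symmetric
   without any assumption on [c]. *)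
Definition flipped i (K : Type) (e : rel (G i)) (kap : G i -> K)
  (c : K -> K -> bool) : rel (G i) :=
  fun x y => [&& e x y, x != y &
    (@E i x y != c (kap x) (kap y)) || (@E i x y != c (kap y) (kap x))].

Definition component i (e H : rel (G i)) : rel (G i) :=
  fun x y => [&& e x x, e y y & connect H x y].

Lemma flip_sym n i K e kap c : @nested (G i) n e -> symmetric (@flipped i K (e 0) kap c).
Proof.
by move=> ne x y; rewrite /flipped (nested_sym ne) eq_sym Esym orbC.
Qed.

(** Vertices separated at level 1 have exactly the adjacency prescribed at level 0, so flipping
    leaves no edge between them. Hence the components of the flipped graph refine level 1. *)
Lemma flip_level1 n i K e kap c : @nested (G i) n e -> @by_levels _ K (@E i) e kap c ->
  subrel (flipped (e 0) kap (c 0)) (e 1).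
Proof.
move=> ne He x y /and3P[exy _]; apply: contraTT => nxy.
have yx : e 0 y x by rewrite (nested_sym ne).
have nyx : ~~ e 1 y x by rewrite (nested_sym ne).
by rewrite -(He _ _ _ exy nxy) -(He _ _ _ yx nyx) Esym eqxx.
Qed.

(** The flipped graph again follows the shifted levels, so [diameter] bounds its depth by [D] and
    [guide] lets colours single out one neighbour of each vertex among those closer to the root.
    Following this neighbour [D] times, with the root fixed, ends at the root of the component. *)
Lemma visible_component n (e : forall i, nat -> rel (G i)) (K : finType)
    (kap : forall i, G i -> K) c :
  visible E (fun i => e i 0) -> (forall i, nested n.+1 (e i)) ->
  (forall i, by_levels (@E i) (e i) (@kap i) c) ->
  visible E (fun i => component (e i 0) (flipped (e i 0) (@kap i) (c 0))).
Proof.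
move=> v0 ne He.
pose H i := flipped (e i 0) (@kap i) (c 0).
have Hs i : symmetric (H i) by apply: flip_sym (ne i).
have Hcs i : connect_sym (H i) by apply: sym_connect_sym.
have H0 i : subrel (H i) (e i 0) by move=> x y /and3P[].
have H1 i : subrel (H i) (e i 1) by apply: flip_level1 (ne i) (He i).
have Hirr i : irreflexive (H i) by move=> x; rewrite /H /flipped eqxx andbF.
pose c' d a b := (c d.+1 a b != c 0 a b) || (c d.+1 a b != c 0 b a).
have H1l i : by_levels (H i) (fun d => e i d.+1) (@kap i) c'.
  move=> d x y exy nxy; rewrite /H /flipped (nested_le (ne i) _ exy) //.
  have -> : x != y.
    apply: contraNneq nxy => xy; rewrite -xy in exy *.
    exact/(nested_refl (ne i))/(nested_le (ne i) _ exy).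
  by rewrite (He _ _ _ _ exy nxy).
have [D Dia] := diameter n K; have [J Gui] := guide n (K * 'I_D.+1)%type.
have {}Dia i x y : connect (H i) x y -> dist (H i) x y <= D.
  move=> xy; apply/dist_leq.
  exact: (Dia _ _ _ _ _ (nested_shift (ne i)) (H1l i) (@H1 i) (Hs i)).
pose de i x := dist (H i) (root (H i) x) x.
have deD i x : de i x < D.+1 by rewrite ltnS Dia // Hcs connect_root.
have cr i x : connect (H i) (root (H i) x) x by rewrite Hcs connect_root.
(* Edges leading one step closer to the root. This relation is not symmetric, but colours paired
   with depths still prescribe it level by level, as [guide] requires. *)
pose H' i x y := H i x y && (de i x == (de i y).+1).
have rootE i x y : H i x y -> root (H i) x = root (H i) y.
  by move/connect1/(rootP (Hcs i)).
have up i x : de i x != 0 -> [exists y, H' i x y].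
  case dx : (de i x) => [//|t] _.
  have [y [yx ry dy]] := dist_pred (cr i x) dx.
  apply/existsP; exists y; rewrite /H' Hs yx dx eqSS /de.
  by rewrite (rootE _ _ _ yx) dy eqxx.
have dP : forall i, exists p : (G i -> {set J}) * (G i -> option J) * (G i -> G i),
    forall x, if de i x == 0 then p.2 x = x else
      exists j, [/\ p.1.2 x = Some j, H' i x (p.2 x), j \in p.1.1 (p.2 x) &
        forall y', H' i x y' -> j \in p.1.1 y' -> y' = p.2 x].
  move=> i.
  have [|||beta bP] := Gui _ (fun d => e i d.+1) (fun x => (kap i x, inord (de i x)))
    (fun d a b => c' d a.1 b.1 && (a.2 == b.2.+1 :> nat)) (H' i) (nested_shift (ne i)).
  - by move=> d x y exy nxy; rewrite /H' (H1l _ _ _ _ exy nxy) /= !inordK.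
  - by move=> u v /andP[/H1].
  - by move=> u; rewrite /H' Hirr.
  have /dep_choice[g gP] : forall x, exists q : option J * G i,
      if de i x == 0 then q.2 = x else
      exists j, [/\ q.1 = Some j, H' i x q.2, j \in beta q.2 &
        forall y', H' i x y' -> j \in beta y' -> y' = q.2].
    move=> x; case dx: (de i x == 0); first by exists (None, x).
    have hx := up i x (negbT dx).
    have [j [y [h jy uy]]] := bP x hx.
    by exists (Some j, y), j.
  by exists (beta, fun x => (g x).1, fun x => (g x).2).
have {dP} [p pP] := dep_choice dP.
pose f i := (p i).2; pose beta i := (p i).1.1; pose io i := (p i).1.2.
pose kap' i x := (kap i x, inord (de i x) : 'I_D.+1, beta i x, io i x).
pose Psi (a b : K * 'I_D.+1 * {set J} * option J) (eqb Eb : bool) : bool :=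
  if a.1.1.2 == 0 :> nat then eqb else
  [&& ~~ eqb, (Eb != c 0 a.1.1.1 b.1.1.1) || (Eb != c 0 b.1.1.1 a.1.1.1),
      a.1.1.2 == b.1.1.2.+1 :> nat & if a.2 is Some j then j \in b.1.2 else false].
have fP i x : e i 0 x x -> forall y,
    (f i x == y) = e i 0 x y && Psi (kap' i x) (kap' i y) (x == y) (@E i x y).
  move=> xx y; rewrite /Psi /= !inordK //; have := pP i x; rewrite -/(f i) -/(beta i) -/(io i).
  case: ifP => [_ ->|_ [j [-> h jb uy]]].
    by apply/eqP/andP => [<-|[_ /eqP]].
  apply/eqP/and5P => [<-|[exy nxy hxy dxy jy]].
    by case/andP: h => /and3P[-> -> ->] ->; rewrite jb.
  by apply/esym/uy => //; rewrite /H' /H /flipped exy nxy hxy dxy.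
have fstep i x : root (H i) (f i x) = root (H i) x /\ de i (f i x) = (de i x).-1.
  have := pP i x; rewrite -/(f i); case: ifP => [/eqP dx ->|_ [j [_ /andP[h /eqP dx] _ _]]].
    by rewrite dx.
  by rewrite dx (rootE _ _ _ h).
have iterE i x k : root (H i) (iter k (f i) x) = root (H i) x /\
    de i (iter k (f i) x) = de i x - k.
  elim: k => [|k [IH1 IH2]] /=; first by rewrite subn0.
  by case: (fstep i (iter k (f i) x)) => -> ->; rewrite IH1 IH2; split=> //; lia.
have toroot i x : iter D (f i) x = root (H i) x.
  have [rx dx] := iterE i x D; rewrite -rx; apply/esym/dist0; first exact: cr.
  by apply/eqP; rewrite -/(de _ _) dx subn_eq0 -ltnS.
have := visible_fun D v0 fP.
congr visible; apply: functional_extensionality_dep => i.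
apply: functional_extensionality => x; apply: functional_extensionality => y.
rewrite /component !toroot; congr [&& _, _ & _].
by apply/eqP/idP => [/(rootP (Hcs i))|/(rootP (Hcs i))].
Qed.

(** Level 1 is replaced by the components of the flipped graph and the deeper levels are intersected
    with them; the induction then treats the rest. Although the new level 1 may be finer, vertices
    that become separated lie in distinct components and so still have the adjacency prescribed at
    level 0. *)
Lemma visible_levels n : forall (e : forall i, nat -> rel (G i)) (K : finType)
    (kap : forall i, G i -> K) c,
  visible E (fun i => e i 0) -> (forall i, nested n (e i)) ->
  (forall i, by_levels (@E i) (e i) (@kap i) c) ->
  exists (e' : forall i, nat -> rel (G i)) (K' : finType)
    (kap' : forall i, G i -> K') c',
  [/\ forall i, e' i 0 = e i 0, forall d, visible E (fun i => e' i d),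
      forall i, nested n (e' i) &
      forall i, by_levels (@E i) (e' i) (@kap' i) c'].
Proof.
elim: n => [|n IH] e K kap c v0 ne He.
  exists (fun i _ => e i 0), K, kap, c; split=> // i; last first.
    by move=> d x y ->.
  split=> [d|d|d x|d x y|x y] //; [exact: nested_sym (ne i) _|exact: nested_trans (ne i) _|].
  exact: nested_bot (ne i) _ _.
pose H i := flipped (e i 0) (@kap i) (c 0).
pose C i := component (e i 0) (H i).
pose e1 i d x y := C i x y && e i d.+1 x y.
have Hs i : symmetric (H i) by apply: flip_sym (ne i).
have Cs i : symmetric (C i).
  by move=> x y; rewrite /C /component andbCA (sym_connect_sym (Hs i)).
have Ct i : transitive (C i).
  move=> y x z /and3P[xx yy xy] /and3P[_ zz yz]; rewrite /C /component xx zz.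
  exact: connect_trans yz.
have Cr i x : e i 0 x x -> C i x x by move=> xx; rewrite /C /component xx connect0.
have C1 i x y : C i x y -> e i 1 x y.
  case/and3P=> xx _ /connectP[p hp ->].
  elim/last_ind: p hp => [_|p z IHp]; first exact: nested_refl (ne i) _ _ xx.
  rewrite rcons_path last_rcons => /andP[/IHp h1 h2].
  exact: (nested_trans (ne i) h1 (flip_level1 (ne i) (He i) h2)).
have e10 : (fun i => e1 i 0) = C.
  apply: functional_extensionality_dep => i.
  apply: functional_extensionality => x; apply: functional_extensionality => y.
  by rewrite /e1; apply/andb_idr/C1.
have ne1 i : nested n (e1 i).
  have nse := nested_shift (ne i).
  split=> [d x y|d y x z|d x|d x y|x y].
  - by rewrite /e1 Cs (nested_sym nse).
  - move=> /andP[h1 h2] /andP[h3 h4]; rewrite /e1 (Ct _ _ _ _ h1 h3).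
    exact: (nested_trans nse h2 h4).
  - move=> /andP[h1 h2]; rewrite /e1 h1; exact: (nested_refl nse).
  - by move=> /andP[h1 h2]; rewrite /e1 h1; apply: (nested_nest nse).
  - by case/andP=> _; apply: (nested_bot nse).
have He1 i : by_levels (@E i) (e1 i) (@kap i) (fun d => c d.+1).
  move=> d x y /andP[h1 h2]; rewrite /e1 h1 /=; exact: He.
have v1 : visible E (fun i => e1 i 0) by rewrite e10; apply: visible_component.
have [e' [K' [kap' [c' [e'0 ve' ne' He']]]]] := IH _ _ _ _ v1 ne1 He1.
have ee i x y : e' i 0 x y -> e i 0 x y.
  by rewrite e'0 => /andP[_]; apply: (nested_nest (ne i)).
exists (fun i d => if d is d'.+1 then e' i d' else e i 0), (K * K')%type,
  (fun i x => (kap i x, kap' i x)),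
  (fun d a b => if d is d'.+1 then c' d' a.2 b.2 else c 0 a.1 b.1).
split=> // [[|d]|i|i] //.
  split=> [[|d]|[|d]|[|d] x|[|d] x y|x y] //.
  - exact: nested_sym (ne i) _.
  - exact: nested_sym (ne' i) _.
  - exact: nested_trans (ne i) _.
  - exact: nested_trans (ne' i) _.
  - move=> xx; apply: (nested_refl (ne' i)); rewrite e'0 /e1 Cr //=.
    exact: (nested_refl (ne i)).
  - exact: ee.
  - exact: nested_nest (ne' i) _ _ _.
  - exact: nested_bot (ne' i) _ _.
move=> [|d] x y /=; last exact: He'.
rewrite e'0 => exy nxy.
have xx := nested_left (ne i) exy.
have yy : e i 0 y y by rewrite (nested_left (ne i) (y := x)) // (nested_sym (ne i)).
have nC : ~~ C i x y by apply: contra nxy => h; rewrite /e1 h C1.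
have xy : x != y by apply: contraNneq nC => <-; apply: Cr.
(* An adjacency differing from the prescribed one would be a flipped edge, putting [x] and [y] in
   one component. *)
apply/eqP; apply: contraNT nC => ne0; rewrite /C /component xx yy connect1 //.
by rewrite /H /flipped exy xy ne0.
Qed.

End VisLevels.

(** * Connection models *)

Section Depth.
Variables (L V : finType) (M : connection_model L V) (h : nat).
Hypothesis Mh : depth_at_most M h.
Notation par := (@parent L V M).
Notation root := (tree_root M).

Definition depth (v : node M) : nat := find (fun j => iter j par v == root) (iota 0 h.+1).

Lemma iter_root k : iter k par root = root.
Proof. by elim: k => //= k ->; apply: parent_root. Qed.

Lemma depth_has v : has (fun j => iter j par v == root) (iota 0 h.+1).
Proof. by apply/hasP; exists h; rewrite ?mem_iota ?ltnSn // Mh. Qed.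

Lemma depth_leq v : depth v <= h.
Proof. by have := depth_has v; rewrite has_find size_iota. Qed.

Lemma iter_depth v : iter (depth v) par v = root.
Proof.
have := nth_find 0 (depth_has v); rewrite nth_iota ?ltnS ?depth_leq //.
by rewrite add0n => /eqP.
Qed.

Lemma depth_min v k : iter k par v = root -> depth v <= k.
Proof.
move=> vk; have [kh|hk] := leqP k h; last by apply: leq_trans (depth_leq v) (ltnW hk).
rewrite leqNgt; apply/negP => /[dup] lt /(before_find 0).
by rewrite nth_iota ?ltnS // add0n vk eqxx.
Qed.

Lemma iter_ge m v : depth v <= m -> iter m par v = root.
Proof. by move=> le; rewrite -(subnK le) iterD iter_depth iter_root. Qed.

Lemma depth_iter k v : depth (iter k par v) = depth v - k.
Proof.
apply/eqP; rewrite eqn_leq; apply/andP; split.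
  by apply: depth_min; rewrite -iterD iter_ge //; lia.
rewrite leq_subLR addnC; apply: depth_min.
by rewrite iterD iter_depth.
Qed.

(** By truncated subtraction, [v] is its own ancestor at every level beyond its depth. Thus leaves
    of different depths all become singletons at level [h]. *)
Definition ancestor d (v : node M) : node M := iter (depth v - d) par v.

Lemma anc0 v : ancestor 0 v = root.
Proof. by rewrite /ancestor subn0 iter_depth. Qed.

Lemma anc_h v : ancestor h v = v.
Proof. by rewrite /ancestor; move: (depth_leq v); rewrite -subn_eq0 => /eqP->. Qed.

Lemma anc_anc d d' v : d <= d' -> ancestor d (ancestor d' v) = ancestor d v.
Proof.
move=> le; rewrite {1 3}/ancestor depth_iter /ancestor -iterD; congr iter; lia.
Qed.

Lemma anc_iter k v : iter k par v = ancestor (depth v - k) v.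
Proof.
rewrite /ancestor; have [dk|/ltnW kd] := leqP (depth v) k.
  have -> : depth v - k = 0 by lia.
  by rewrite subn0 iter_depth iter_ge.
by congr iter; lia.
Qed.

(** A common ancestor deeper than [d] would make the ancestors at level [d.+1] agree. *)
Lemma anc_lca d x y : ancestor d x = ancestor d y -> ancestor d.+1 x <> ancestor d.+1 y ->
  is_lca (ancestor d x) x y.
Proof.
move=> ed nd; split; first exact: fconnect_iter.
  by rewrite ed; apply: fconnect_iter.
move=> w /iter_findex <- /iter_findex; set b := findex _ _ _; set a := findex _ _ _.
move=> ew; have := congr1 depth ew; rewrite !depth_iter => dw.
rewrite !anc_iter dw in ew *.
have le : depth x - a <= d.
  rewrite leqNgt; apply/negP=> lt; apply: nd.
  by rewrite -(anc_anc x lt) -ew anc_anc.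
by rewrite -(anc_anc x le) {2}/ancestor; apply: fconnect_iter.
Qed.

End Depth.

(** Besides its label, a vertex carries the relations of all its ancestors, so that adjacency can be
    read from the colours alone. [None] is for the vertices outside the member of the cover. *)
Definition model_color (L : finType) (h : nat) :=
  option (L * {ffun 'I_h.+1 -> {ffun L * L -> bool}})%type.

(** Looking up the relation on one side is enough: it is used for vertices with the same ancestor at
    level [d]. *)
Definition model_conn (L : finType) h d (a b : model_color L h) : bool :=
  if a is Some a' then if b is Some b' then a'.2 (inord d) (a'.1, b'.1) else false else false.

Lemma model_levels P (G : structure) (X : {set G}) h (L : finType)
    (M : connection_model L (induced X)) :
  depth_at_most M h -> defines P M ->
  exists (e : nat -> rel G) (kap : G -> model_color L h),
    hierarchy h X e /\ by_levels (@adj G) e kap (@model_conn L h).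
Proof.
move=> Mh [Ma _].
pose lf (x : G) : option (node M) := omap (leaf M) (insub x).
pose e d (x y : G) := if lf x is Some u then if lf y is Some v then
  ancestor h d u == ancestor h d v else false else false.
pose kap (x : G) : model_color L h := if insub x is Some u then
  Some (label M u, [ffun d : 'I_h.+1 => [ffun p => conn (ancestor h d (leaf M u)) p.1 p.2]])
  else None.
exists e, kap; split.
  split=> [d x y|d y x z|x y|d x xX|d x y|x y].
  - by rewrite /e; case: (lf x) (lf y) => [u|] [v|]; rewrite // eq_sym.
  - by rewrite /e; case: (lf x) (lf y) (lf z) => [u|] [v|] [w|] // /eqP->.
  - rewrite /e /lf; case: insubP => [u -> _|/negPf-> //].
    by case: insubP => [v -> _|/negPf-> //]; rewrite /= !anc0 ?eqxx.
  - by rewrite /e /lf insubT /=.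
  - rewrite /e; case: (lf x) (lf y) => [u|] [v|] // /eqP h1.
    by rewrite -(anc_anc Mh u (leqnSn d)) h1 anc_anc.
  - rewrite /e /lf; case: insubP => // u _ <-; case: insubP => // v _ <- /=.
    by rewrite !anc_h // => /eqP/leaf_inj ->.
move=> d x y; rewrite /e /lf /kap; case: insubP => // u _ <-; case: insubP => // v _ <- /=.
move=> /eqP h1 /eqP h2.
have uv : u != v by apply/eqP=> uv; apply: h2; rewrite uv.
have dh : d < h.
  rewrite ltnNge; apply/negP=> hd; apply: h2.
  have deep k (w : node M) : h <= k -> ancestor h k w = w.
    by move=> hk; rewrite /ancestor (_ : depth h w - k = 0) //; have := depth_leq Mh w; lia.
  by rewrite !deep ?(leqW hd) //; move: h1; rewrite !deep.
rewrite !ffunE /= inordK ?ltnS 1?ltnW //.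
rewrite -(Ma u v _ uv (anc_lca Mh h1 h2)) /adj /=; congr srel.
by apply: val_inj.
Qed.

(** The levels of a pair in [V] show where it is separated, and [by_levels] then gives the
    adjacency; a pair that is never separated is a single vertex, where irreflexivity decides. *)
Lemma determined_edge (Idx : Type) (G : Idx -> finType) (E : forall i, rel (G i))
    n (V : forall i, {set G i}) (e : forall i, nat -> rel (G i))
    (K : finType) (kap : forall i, G i -> K) c :
  (forall i, irreflexive (E i)) ->
  (forall i, hierarchy n (V i) (e i)) -> (forall i, by_levels (E i) (e i) (kap i) c) ->
  determined2 (levels e n) (fun i x y => [&& x \in V i, y \in V i & E i x y]).
Proof.
move=> Ei He Hb.
exists (option (K * bool)), (fun i x => Some (kap i x, x \in V i)), (fun=> None).
move=> i j x y _ ek el.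
have eV b : (x b \in V i) = (y b \in V j) by case: (ek b).
have eK b : kap i (x b) = kap j (y b) by case: (ek b).
have elv d : d <= n -> e i d (x true) (x false) = e j d (y true) (y false).
  by move=> dn; have /ffunP/(_ (inord d)) := el true false; rewrite !ffunE inordK.
rewrite !eV; have [yt|//] := boolP (y true \in V j).
have [yf|//] := boolP (y false \in V j); rewrite /=.
have [eqx|nx] := boolP (e i n (x true) (x false)).
  rewrite (hier_bot (He i) eqx) Ei; move: eqx; rewrite elv // => /(hier_bot (He j)) ->.
  by rewrite Ei.
have [d [dn h1 h2]] : exists d, [/\ d < n, e i d (x true) (x false) &
    ~~ e i d.+1 (x true) (x false)].
  have : e i 0 (x true) (x false) by rewrite (hier_top (He i)) !eV yt.
  elim: n nx {He el elv} => [|m IH] nx e0; first by rewrite e0 in nx.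
  have [em|nm] := boolP (e i m (x true) (x false)); first by exists m.
  by have [d [dm h1 h2]] := IH nm e0; exists d; split=> //; apply: ltnW.
by rewrite (Hb i _ _ _ h1 h2) (Hb j d) ?eK -?elv // ltnW.
Qed.

(** The members of all covers are numbered below a common [N], so that the [l]-th members form a
    family over [Idx] to which the previous lemmas apply. *)
Definition low_covers (Idx : Type) (G : Idx -> finType) (E : forall i, rel (G i)) : Prop :=
  forall p, exists N n (V : 'I_N -> forall i, {set G i})
    (e : 'I_N -> forall i, nat -> rel (G i)),
    [/\ forall l d, visible E (fun i => e l i d),
        forall l i, hierarchy n (V l i) (e l i),
        forall l, determined2 (levels (e l) n) (fun i x y =>
          [&& x \in V l i, y \in V l i & E i x y]) &
        forall i (S : {set G i}), #|S| <= p -> exists l, S \subset V l i].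

Lemma visible_cover P C (Idx : Type) (G : Idx -> structure) :
  (forall A, C A -> colored_graph P A) -> low_shrubdepth_covers P C ->
  (forall i, C (G i)) -> low_covers (fun i => @adj (G i)).
Proof.
move=> HC Hlow CG p.
have Gsym i : symmetric (@adj (G i)) by case: (HC _ (CG i)).
have Girr i : irreflexive (@adj (G i)) by case: (HC _ (CG i)).
have [U [Ucov [N UN] [h [L HM]]]] := Hlow p.
(* Covers with fewer than [N] members are completed by the empty set. *)
pose V (l : 'I_N) i : {set G i} := nth set0 (enum (U (G i))) l.
have lev (l : 'I_N) : exists (e : forall i, nat -> rel (G i)) (K : finType)
    (kap : forall i, G i -> K) c,
    (forall i, hierarchy h (V l i) (e i)) /\
    (forall i, by_levels (@adj (G i)) (e i) (kap i) c).
  have /dep_choice[ek ekP] : forall i, exists ek : (nat -> rel (G i)) * (G i -> model_color L h),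
      hierarchy h (V l i) ek.1 /\ by_levels (@adj (G i)) ek.1 ek.2 (@model_conn L h).
    move=> i; have [lt|ge] := ltnP l (size (enum (U (G i)))).
      have VU : V l i \in U (G i) by rewrite -mem_enum mem_nth.
      have [|M Mh Md] := HM (induced (V l i)).
        by exists (G i); split=> //; exists (V l i).
      by have [e [kap ekP]] := model_levels Mh Md; exists (e, kap).
    have V0 : V l i = set0 by rewrite /V nth_default.
    exists (fun _ _ _ => false, fun=> None); split=> //; rewrite V0.
    by split=> // [x y|d x]; rewrite !inE.
  exists (fun i => (ek i).1), (model_color L h), (fun i => (ek i).2), (@model_conn L h).
  by split=> i; case: (ekP i).
have vlev (l : 'I_N) : exists e : forall i, nat -> rel (G i),
    [/\ forall d, visible (fun i => @adj (G i)) (fun i => e i d),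
        forall i, hierarchy h (V l i) (e i) &
        determined2 (levels e h) (fun i x y => [&& x \in V l i, y \in V l i & adj x y])].
  have [e [K [kap [c [He Hb]]]]] := lev l.
  have ve : visible (fun i => @adj (G i)) (fun i => e i 0).
    have := visible_set (fun i => @adj (G i)) (V l).
    congr visible; apply: functional_extensionality_dep => i.
    apply: functional_extensionality => x; apply: functional_extensionality => y.
    by rewrite (hier_top (He i)).
  have ne i : nested h (e i).
    split=> [d|d|d x|d x y|x y]; [exact: hier_sym (He i) _|exact: hier_trans (He i) _| | exact:
      hier_nest (He i) _ _ _|exact: hier_bot (He i) _ _].
    by rewrite (hier_top (He i)) andbb; apply: hier_refl (He i) _ _.
  have [e' [K' [kap' [c' [e'0 ve' ne' Hb']]]]] := visible_levels Gsym ve ne Hb.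
  have He' i : hierarchy h (V l i) (e' i).
    split=> [d|d|x y|d x xV|d x y|x y];
      [exact: nested_sym (ne' i) _|exact: nested_trans (ne' i) _| | | exact:
        nested_nest (ne' i) _ _ _|exact: nested_bot (ne' i) _ _].
      by rewrite e'0 (hier_top (He i)).
    by apply: (nested_refl (ne' i)); rewrite e'0 (hier_top (He i)) xV.
  by exists e'; split=> //; apply: determined_edge Hb'.
have [e eP] := dep_choice vlev.
exists N, h, V, e; split=> [l|l|l|i S Sp]; try by case: (eP l).
have [_ /(_ S Sp)[Y YU SY]] := Ucov _ (CG i).
have Ylt : index Y (enum (U (G i))) < N.
  by apply: leq_trans (UN _ (CG i)); rewrite cardE index_mem mem_enum.
by exists (Ordinal Ylt); rewrite /V /= nth_index // mem_enum.
Qed.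

(** * Tame relations and first-order formulas *)

Section Tame.
Variables (Idx : Type) (G : Idx -> finType) (E : forall i, rel (G i)).

Definition info (Z : finType) (es : Z -> forall i, rel (G i)) i (x y : G i) :=
  (x == y, E x y, [ffun z => es z i x y]).

(** The elements of [T i] lie over vertices of the graph through [pi], and pairs are only inspected
    through their vertices. Distinct elements over one vertex are told apart by colours. *)
Definition tame (T : Idx -> finType) (pi : forall i, T i -> G i) (X Y : Type)
    (rho : forall i, (X -> T i) -> Y) : Prop :=
  exists (Z : finType) (es : Z -> forall i, rel (G i)),
    (forall z, visible E (es z)) /\
    determined (fun i x y => info es (pi i x) (pi i y)) rho.

Lemma tame_pull (T T' : Idx -> finType) (pi : forall i, T i -> G i)
    (io : forall i, T' i -> T i) X Y (rho : forall i, (X -> T i) -> Y) :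
  tame pi rho ->
  tame (fun i x => pi i (io i x)) (fun i (x : X -> T' i) => rho i (fun a => io i (x a))).
Proof.
by move=> [Z [es [ve D]]]; exists Z, es; split=> //; apply: det_pull D.
Qed.

Section OneFamily.
Variables (T : Idx -> finType) (pi : forall i, T i -> G i).

Lemma tame_det X Y (rho : forall i, (X -> T i) -> Y) :
  (forall (Z : finType) (es : Z -> forall i, rel (G i)),
     determined (fun i x y => info es (@pi i x) (@pi i y)) rho) -> tame pi rho.
Proof. by move=> D; exists void, (of_void _); split=> [[]|]. Qed.

Lemma tame_ext X Y (rho rho' : forall i, (X -> T i) -> Y) :
  (forall i x, rho i x = rho' i x) -> tame pi rho -> tame pi rho'.
Proof. by move=> H [Z [es [ve D]]]; exists Z, es; split=> //; apply: det_ext D. Qed.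

Lemma tame_reindex X X' Y (s : X -> X') (rho : forall i, (X -> T i) -> Y) :
  tame pi rho -> tame pi (fun i (x : X' -> T i) => rho i (fun a => x (s a))).
Proof. by move=> [Z [es [ve D]]]; exists Z, es; split=> //; apply: det_reindex D. Qed.

Lemma tame_const X Y (c : Y) : tame pi (fun i (x : X -> T i) => c).
Proof. by apply: tame_det => Z es; apply: det_const. Qed.

Lemma tame_color X (K : finType) (kap : forall i, T i -> K) (a : X) :
  tame pi (fun i x => kap i (x a)).
Proof. by apply: tame_det => Z es; apply: det_color. Qed.

Lemma tame_edge X (a b : X) : tame pi (fun i x => E (@pi i (x a)) (@pi i (x b))).
Proof.
apply: tame_det => Z es.
exact: (det_app (fun t : bool * bool * {ffun Z -> bool} => t.1.2) (det_info (fun i x y =>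
  info es (@pi i x) (@pi i y)) a b)).
Qed.

Lemma tame_op X Y Z W (F : Y -> Z -> W) (r1 : forall i, (X -> T i) -> Y)
    (r2 : forall i, (X -> T i) -> Z) :
  tame pi r1 -> tame pi r2 -> tame pi (fun i x => F (r1 i x) (r2 i x)).
Proof.
move=> [Z1 [es1 [ve1 D1]]] [Z2 [es2 [ve2 D2]]].
pose es z := match z with inl z => es1 z | inr z => es2 z end.
exists (Z1 + Z2)%type, es; split=> [[z|z]|]; [exact: ve1|exact: ve2|].
have D b1 b2 := det_info (fun i x y => info es (@pi i x) (@pi i y)) b1 b2.
apply: det_op; [apply: det_trans D1 | apply: det_trans D2].
  apply: det_ext (det_app (fun t : bool * bool * {ffun Z1 + Z2 -> bool} =>
    (t.1, [ffun z => t.2 (inl z)])) (D bool true false)) => i x.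
  by rewrite /info /=; congr (_, _); apply/ffunP=> z; rewrite !ffunE.
apply: det_ext (det_app (fun t : bool * bool * {ffun Z1 + Z2 -> bool} =>
  (t.1, [ffun z => t.2 (inr z)])) (D bool true false)) => i x.
by rewrite /info /=; congr (_, _); apply/ffunP=> z; rewrite !ffunE.
Qed.

Lemma tame_app X Y Z (F : Y -> Z) (rho : forall i, (X -> T i) -> Y) :
  tame pi rho -> tame pi (fun i x => F (rho i x)).
Proof. by move=> [Z' [es [ve D]]]; exists Z', es; split=> //; apply: det_app D. Qed.

Lemma tame_all X Z (s : seq Z) (r : Z -> forall i, (X -> T i) -> bool) :
  (forall z, tame pi (r z)) -> tame pi (fun i x => all (fun z => r z i x) s).
Proof.
move=> D; elim: s => [|z s IH] /=; first exact: tame_const.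
exact: tame_op (D z) IH.
Qed.

Hypothesis Hcov : low_covers E.
Variables (Cp : finType) (cp : forall i, T i -> Cp).
Hypothesis cpi : forall i a b, @pi i a = pi b -> cp a = cp b -> a = b.

Lemma tame_eq X (a b : X) : tame pi (fun i x => x a == x b).
Proof.
apply: tame_det => Z es.
apply: det_ext (det_op (fun (t : bool * bool * {ffun Z -> bool}) (u : Cp * Cp) =>
  t.1.1 && (u.1 == u.2))
  (det_info (fun i x y => info es (@pi i x) (@pi i y)) a b)
  (det_op pair (det_color _ cp a) (det_color _ cp b))) => i x /=.
by apply/andP/eqP => [[/eqP h1 /eqP h2]|->//]; apply: cpi.
Qed.

(** The witnesses of all the variables, including the quantified one, form a set of bounded size and
    hence lie in one member [l] of the cover. There the visible relations are determined by the
    levels of [l], so [det_exists] applies to the safe assignments, and the quantifier becomes a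
    disjunction over [l]. The levels of the members are the new visible relations. *)
Lemma tame_exists (X : finType) (rho : forall i, (option X -> T i) -> bool) :
  tame pi rho -> tame pi (fun i (x : X -> T i) => [exists y, rho i (ocons x y)]).
Proof.
move=> [Z [es [ve D]]].
have /dep_choice[Sp SpP] : forall z, exists Sp : (forall i, G i -> {set G i}) * nat,
    [/\ forall i x, #|Sp.1 i x| <= Sp.2, forall i x, x \in Sp.1 i x & local E (es z) Sp.1].
  by move=> z; have [S1 [p1 h]] := visible_local (ve z); exists (S1, p1).
pose S i x := x |: \bigcup_z (Sp z).1 i x.
pose p0 := (\sum_z (Sp z).2).+1.
have Sp0 i x : #|S i x| <= p0.
  apply: leq_trans (leq_card_setU _ _) _; rewrite cards1 add1n ltnS.
  apply: leq_trans (card_bigcup _) _.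
  by apply: leq_sum => z _; case: (SpP z).
have [N [n [V [e [ve' He HE cov]]]]] := Hcov (#|{: option X}| * p0).
pose safeG l i (x : G i) := S i x \subset V l i.
pose VT l i : {set T i} := [set a | pi a \in V l i].
(* The hierarchy is pulled back along [pi]; the additional level [n.+1] separates the elements over
   the same vertex. *)
pose eT l i d (a b : T i) := if d <= n then e l i d (pi a)
  (pi b) else (a == b) && (pi a \in V l i).
have HeT l i : hierarchy n.+1 (VT l i) (eT l i).
  split=> [d x y|d y x z|x y|d x|d x y|x y]; rewrite /eT.
  - case: ifP => _; first exact: (hier_sym (He l i)).
    by rewrite eq_sym; case: eqP => // ->.
  - case: ifP => _; first exact: (hier_trans (He l i)).
    by move=> /andP[/eqP-> yV] /andP[/eqP<- _]; rewrite eqxx.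
  - by rewrite !inE /= (hier_top (He l i)).
  - rewrite inE => xV; rewrite eqxx xV; case: ifP => // _; exact: (hier_refl (He l i)).
  - case: ifP => [dn|_]; first by rewrite ltnW //; apply: (hier_nest (He l i)).
    move=> /andP[/eqP<- xV]; rewrite eqxx xV; case: ifP => // _.
    exact: (hier_refl (He l i)).
  - by rewrite ltnn => /andP[/eqP].
have LT l Y (R : forall i, G i -> G i -> Y) : determined2 (levels (e l) n) R ->
    determined2 (levels (eT l) n.+1) (fun i a b => R i (pi a) (pi b)).
  move=> /(det_pull pi); apply: det_trans.
  apply: det_ext (det_app (fun t : {ffun 'I_n.+2 -> bool} => [ffun d : 'I_n.+1 =>
    t (widen_ord (leqnSn _) d)])
    (det_info (levels (eT l) n.+1) true false)) => i x.
  by apply/ffunP=> d; rewrite !ffunE /= /eT -ltnS ltn_ord.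
have Dsafe l : determined2 (levels (e l) n) (fun i x y =>
    if safeG l i x && safeG l i y then Some (info es x y) else None).
  have := det_op (fun (a : bool * bool) (b : bool * bool * {ffun Z -> bool}) =>
     if a.1 && a.2 then Some b else None)
    (det_op pair (det_color (levels (e l) n) (safeG l) true)
                 (det_color (levels (e l) n) (safeG l) false))
    (det_op pair (det_op pair (det2_eq (He l)) (HE l))
     (det_ffun (r := fun z i (x : bool -> G i) => [&& (Sp z).1 i (x true) \subset V l i,
       (Sp z).1 i (x false) \subset V l i & es z i (x true) (x false)]) _)).
  have h z : determined (levels (e l) n) (fun i (x : bool -> G i) =>
    [&& (Sp z).1 i (x true) \subset V l i,
       (Sp z).1 i (x false) \subset V l i & es z i (x true) (x false)]).
    by case: (SpP z) => _ _ /(_ n (V l) (e l) (He l) (HE l)).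
  move/(_ h); apply: det_ext => i x /=.
  case: ifP => // /andP[sx sy]; congr Some; rewrite /info.
  have sV y : safeG l i y -> y \in V l i by move/subsetP; apply; rewrite !inE eqxx.
  have sS y z : safeG l i y -> (Sp z).1 i y \subset V l i.
    apply: subset_trans; apply: subset_trans (subsetUr _ _).
    exact: (bigcup_sup (F := fun z => (Sp z).1 i y) z).
  rewrite !sV //=; congr (_, _); apply/ffunP=> z; rewrite !ffunE.
  by rewrite !sS.
pose es' (z : 'I_N * 'I_n.+1) i := e z.1 i z.2.
exists ('I_N * 'I_n.+1)%type, es'; split=> [z|]; first exact: ve'.
have Dl l : determined (fun i x y => info es' (@pi i x) (@pi i y)) (fun i (x : X -> T i) =>
    [exists y in VT l i, [forall a, safeG l i (pi (ocons x y a))] && rho i (ocons x y)]).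
  apply: (det_trans (lam := levels (eT l) n.+1)); last first.
    apply: (det_exists (rho := fun i x => [forall a, safeG l i (pi (x a))] && rho i x)) => //.
    by apply: det_trans (det_safe (fun i a => safeG l i (pi a)) D); apply: LT (Dsafe l).
  apply: det_ext (det_op (fun (t : bool * bool * {ffun 'I_N * 'I_n.+1 -> bool})
    (u : Cp * Cp * bool) =>
      [ffun d : 'I_n.+2 => if d <= n then t.2 (l, inord d)
        else [&& t.1.1, u.1.1 == u.1.2 & u.2]])
    (det_info (fun i x y => info es' (@pi i x) (@pi i y)) true false)
    (det_op pair (det_op pair (det_color _ cp true) (det_color _ cp false))
       (det_color _ (fun i a => pi a \in V l i) true))) => i x.
  apply/ffunP=> d; rewrite !ffunE /= /eT; case: ifP => dn.
    by rewrite /es' /= inordK.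
  rewrite andbA; congr (_ && _).
  by apply/andP/eqP => [[/eqP h1 /eqP h2]|->//]; apply: cpi.
apply: det_ext (det_has (enum 'I_N) Dl) => i x.
apply/hasP/existsP => [[l _ /exists_inP[y _ /andP[_ r]]]|[y r]]; first by exists y.
have [|l lV] := cov i (\bigcup_a S i (pi (ocons x y a))).
  apply: leq_trans (card_bigcup _) _; rewrite -sum_nat_const.
  by apply: leq_sum => a _.
have sf a : safeG l i (pi (ocons x y a)).
  by apply: subset_trans lV; apply: (bigcup_sup a).
exists l; rewrite ?mem_enum //; apply/exists_inP; exists y; last by rewrite r andbT;
  apply/forallP.
by rewrite inE; have /subsetP := sf None; apply; rewrite !inE eqxx.
Qed.

End OneFamily.
End Tame.

Lemma srel_set_rel (A : structure) R (P : pred ((arity R).-tuple A)) t :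
  srel (s := set_rel P) (R := R) t = P t.
Proof.
rewrite /= eqxx; apply/existsP/idP => [[u /andP[/eqP/val_inj->]]|Pt] //.
by exists t; rewrite eqxx.
Qed.

Lemma srel_set_rel_neq (A : structure) R (P : pred ((arity R).-tuple A)) Q
    (t : (arity Q).-tuple A) :
  Q != R -> srel (s := set_rel P) (R := Q) t = srel t.
Proof. by rewrite /= => /negPf ->. Qed.

(** Existence and uniqueness of the value are merged into a single quantifier, in the form handled
    by [tame_exists]. *)
Lemma graph_functionE (A : structure) phi (x y : A) :
  (graph_function phi x == Some y) = ~~ [exists z, sat phi [tuple x; z] (+) (z == y)].
Proof.
rewrite negb_exists; under eq_forallb => z do rewrite negb_add.
rewrite /graph_function; case: pickP => [y' /forallP hy'|/(_ y) ->] //.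
apply/eqP/forallP => [[<-] //|hy].
by have := hy y'; rewrite (eqP (hy' y')) eqxx => /eqP/esym/eqP ->.
Qed.

Lemma map_eq_tnth n (S T : Type) (U : eqType) (f : S -> U) (g : T -> U)
    (s : n.-tuple S) (t : n.-tuple T) :
  (map f s == map g t) = [forall a, f (tnth s a) == g (tnth t a)].
Proof.
apply/eqP/forallP => [h a|h].
  have : [tuple of map f s] = [tuple of map g t] by apply: val_inj.
  by move/(congr1 (fun u => tnth u a)); rewrite !tnth_map => ->.
suff /(congr1 val) : [tuple of map f s] = [tuple of map g t] by [].
by apply: eq_from_tnth => a; rewrite !tnth_map; apply/eqP.
Qed.

Section Formulas.
Variables (Idx : Type) (G : Idx -> finType) (E : forall i, rel (G i)).
Hypothesis Hcov : low_covers E.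
Variables (A : Idx -> structure) (pi : forall i, A i -> G i).
Variables (Cp : finType) (cp : forall i, A i -> Cp).
Hypothesis cpi : forall i a b, @pi i a = pi b -> cp a = cp b -> a = b.
Notation tame := (tame E pi).

Lemma tame_exists_tuple m : forall (X : finType)
  (rho : forall i, (X -> A i) -> m.-tuple (A i) -> bool),
  tame (fun i (x : X + 'I_m -> A i) => rho i (fun a => x (inl a)) [tuple x (inr a) | a < m]) ->
  tame (fun i x => [exists u : m.-tuple (A i), rho i x u]).
Proof.
elim: m => [|m IH] X rho D.
  pose s (z : X + 'I_0) : X := match z with
    | inl a => a | inr b => match notF (ltn_ord b) with end end.
  apply: tame_ext (tame_reindex s D) => i x /=.
  apply/idP/existsP => [r|[u]]; first by eexists; apply: r.
  by congr rho; apply: eq_from_tnth => -[].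
pose s (z : X + 'I_m.+1) : option X + 'I_m := match z with
  | inl a => inl (Some a)
  | inr b => if unlift ord0 b is Some c then inr c else inl None end.
have D' := tame_exists Hcov cpi (IH (option X)
  (fun i x u => rho i (fun a => x (Some a)) [tuple of x None :: u]) _).
apply: tame_ext (D' _) => [i x|] /=.
  apply/existsP/existsP => [[y /existsP[u r]]|[u r]]; first by exists [tuple of y :: u].
  exists (thead u); apply/existsP; exists [tuple of behead u].
  by rewrite -tuple_eta.
apply: tame_ext (tame_reindex s D) => i x /=; congr rho.
apply: eq_from_tnth => b; rewrite tnth_mktuple /s.
by case: unliftP => [c|] ->; rewrite ?tnth0 // tnthS tnth_mktuple.
Qed.

Lemma tuple_cons T n (x : 'I_n -> T) y :
  [tuple of y :: [tuple x a | a < n]] =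
  [tuple ocons x y (unlift ord0 b) | b < n.+1].
Proof.
apply: eq_from_tnth => b; rewrite tnth_mktuple.
by case: unliftP => [c|] -> /=; rewrite ?tnth0 // tnthS tnth_mktuple.
Qed.

Variable s : signature.
Hypothesis Rtame : forall R, R \in rels s ->
  tame (fun i (x : 'I_(arity R) -> A i) => srel [tuple x a | a < arity R]).
Hypothesis ftame : forall f, f \in funs s ->
  tame (fun i (x : bool -> A i) => sfun f (x true) == Some (x false)).

Lemma tame_fun f X (a b : X) : f \in funs s ->
  tame (fun i x => sfun f (x a) == Some (x b)).
Proof. by move/ftame/(tame_reindex (fun t : bool => if t then a else b)). Qed.

(** Functions being partial, a term is handled through its graph, and composition is an existential
    quantification over the intermediate value. *)
Lemma tame_term n (t : term n) : term_over s t ->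
  tame (fun i (x : option 'I_n -> A i) => eval [tuple x (Some a) | a < n] t == Some (x None)).
Proof.
elim: t => [a|f t IH] /=.
  move=> _; apply: tame_ext (tame_eq E cpi (Some a) None) => i x.
  by rewrite tnth_mktuple.
case/andP=> fs /IH {}IH.
apply: tame_ext (tame_exists Hcov cpi (rho := fun i (x : option (option 'I_n) -> A i) =>
  (eval [tuple x (Some (Some a)) | a < n] t == Some (x None)) &&
  (sfun f (x None) == Some (x (Some None)))) _) => [i x|] /=.
  apply/existsP/eqP => [[y /andP[/eqP -> /eqP]] //|].
  by case: (eval _ _) => // y fy; exists y; rewrite eqxx; apply/eqP.
apply: tame_op; last exact: tame_fun.
pose s0 (a : option 'I_n) : option (option 'I_n) := if a is Some b then Some (Some b) else None.
exact: (tame_reindex s0 IH).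
Qed.

Lemma tame_sat n (phi : formula n) : formula_over s phi ->
  tame (fun i (x : 'I_n -> A i) => sat phi [tuple x a | a < n]).
Proof.
elim: phi => {n} [n R ts|n t1 t2|n f t|n phi IH|n phi IH psi IH'|n phi IH] /=.
- case/andP=> Rs /all_tnthP ts_s.
  apply: tame_exists_tuple.
  pose r i (x : 'I_n + 'I_(arity R) -> A i) (b : 'I_(arity R)) :=
    eval [tuple x (inl a) | a < n] (tnth ts b) == Some (x (inr b)).
  apply: tame_ext (tame_op andb (tame_all (enum 'I_(arity R)) (r := fun b i x => r i x b) _)
    (tame_reindex inr (Rtame Rs))) => [i x|b].
    rewrite map_eq_tnth; congr (_ && _); apply/allP/forallP => h b.
      by rewrite tnth_mktuple; apply: h; rewrite mem_enum.
    by have := h b; rewrite tnth_mktuple.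
  pose s0 (a : option 'I_n) : 'I_n + 'I_(arity R) := if a is Some c then inl c else inr b.
  exact: (tame_reindex s0 (tame_term (ts_s b))).
- case/andP=> t1s t2s.
  apply: tame_ext (tame_exists Hcov cpi (tame_op andb (tame_term t1s) (tame_term t2s))) => i x /=.
  by [].
- case/andP=> fs ts.
  have ft : term_over s (App f t) by rewrite /= fs.
  apply: tame_ext (tame_exists Hcov cpi (tame_term ft)) => i x /=.
  apply/existsP/idP => [[y /eqP->]//|].
  by case: (obind _ _) => // y _; exists y.
- by move=> h; apply: tame_app (IH h).
- by case/andP=> h h'; apply: tame_op (IH h) (IH' h').
- move=> h; apply: tame_ext (tame_exists Hcov cpi (tame_reindex (unlift ord0) (IH h))) => i x /=.
  by apply: eq_existsb => y; rewrite tuple_cons.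
Qed.

End Formulas.

(* An element [a] of [A i] is encoded by its vertex [pi a] and the index [cp a] of a copy, one
   bit for each copying operation. *)
Definition tame_structure (Idx : Type) (G : Idx -> finType) (E : forall i, rel (G i))
    (s : signature) (A : Idx -> structure) : Prop :=
  exists r (pi : forall i, A i -> G i) (cp : forall i, A i -> r.-tuple bool),
  [/\ forall i a b, pi i a = pi i b -> cp i a = cp i b -> a = b,
      forall R, R \in rels s -> tame E pi
        (fun i (x : 'I_(arity R) -> A i) => srel [tuple x a | a < arity R]) &
      forall f, f \in funs s -> tame E pi
        (fun i (x : bool -> A i) => sfun f (x true) == Some (x false))].

Definition strip2 (T : Type) (z : T + T) : T := match z with inl x | inr x => x end.

Lemma srel_double (A : structure) (R : nat * nat) (t : 'I_(arity R) -> disjoint_double A) :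
  srel (s := disjoint_double A) (R := R) [tuple t a | a < arity R] =
  ([forall a, is_inl (t a)] || [forall a, ~~ is_inl (t a)]) &&
  srel [tuple strip2 (t a) | a < arity R].
Proof.
apply/existsP/andP => [[u /andP[h ru]]|[h ru]].
  have h' : (forall a, t a = inl (tnth u a)) \/ (forall a, t a = inr (tnth u a)).
    case/orP: h => /eqP h; [left|right] => a.
      have : [tuple t a | a < arity R] = [tuple of map inl u] by apply: val_inj.
      by move/(congr1 (fun v => tnth v a)); rewrite tnth_mktuple tnth_map.
    have : [tuple t a | a < arity R] = [tuple of map inr u] by apply: val_inj.
    by move/(congr1 (fun v => tnth v a)); rewrite tnth_mktuple tnth_map.
  have -> : [tuple strip2 (t a) | a < arity R] = u.
    by apply: eq_from_tnth => a; rewrite tnth_mktuple; case: h' => ->.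
  split=> //; case: h' => h'; apply/orP; [left|right]; apply/forallP => a; by rewrite h'.
exists [tuple strip2 (t a) | a < arity R]; rewrite ru andbT.
case/orP: h => /forallP h; apply/orP; [left|right].
  suff : [tuple t a | a < arity R] = [tuple of map inl [tuple strip2 (t a) | a < arity R]].
    by move/(congr1 val) => /= ->.
  by apply: eq_from_tnth => a; rewrite tnth_mktuple tnth_map tnth_mktuple; case: (t a) (h a).
suff : [tuple t a | a < arity R] = [tuple of map inr [tuple strip2 (t a) | a < arity R]].
  by move/(congr1 val) => /= ->.
by apply: eq_from_tnth => a; rewrite tnth_mktuple tnth_map tnth_mktuple; case: (t a) (h a).
Qed.

Lemma tame_set_rel (Idx : Type) (G : Idx -> finType) (E : forall i, rel (G i))
    (A : Idx -> structure) (pi : forall i, A i -> G i) (S : pred (nat * nat)) R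
    (P : forall i, pred ((arity R).-tuple (A i))) :
  tame E pi (fun i (x : 'I_(arity R) -> A i) => P i [tuple x a | a < arity R]) ->
  (forall Q, S Q -> tame E pi (fun i (x : 'I_(arity Q) -> A i) =>
    srel [tuple x a | a < arity Q])) ->
  forall Q, (Q == R) || S Q -> tame E pi (fun i (x : 'I_(arity Q) -> A i) =>
    srel (s := set_rel (P i)) (R := Q) [tuple x a | a < arity Q]).
Proof.
move=> PT ST Q; have [->|neq] := eqVneq Q R.
  by move=> _; apply: tame_ext PT => i x; rewrite srel_set_rel.
by rewrite orFb => /ST; apply: tame_ext => i x; rewrite srel_set_rel_neq.
Qed.

(** Defining formulas are covered by [tame_sat], a restriction changes nothing in the codes, and a
    copying adds one bit to them. *)
Lemma tame_op_step (Idx : Type) (G : Idx -> finType) (E : forall i, rel (G i))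
    (Hcov : low_covers E) s o (A A' : Idx -> structure) :
  op_wf s o -> tame_structure E s A -> (forall i, op_output o (A i) (A' i)) ->
  tame_structure E (op_sig s o) A'.
Proof.
move=> wf [r [pi [cp [cpi Rt ft]]]].
case: o wf => [R phi|psi|R|f|U M|f phi|U sigma sig0] /= wf H.
- rewrite (functional_extensionality _ _ H); exists r, pi, cp; split=> // Q.
  rewrite !inE; apply: (@tame_set_rel _ G E A pi (fun Q => Q \in rels s) R (fun i =>
    @sat (A i) _ phi)) => //.
  by apply: (tame_sat Hcov cpi Rt ft); case/and3P: wf.
- rewrite (functional_extensionality _ _ H);
  exists r, (fun i x => pi i (val x)), (fun i x => cp i (val x)).
  split=> [i a b e1 e2|Q Qs|f fs]; first exact/val_inj/cpi.
    apply: tame_ext (tame_pull (fun i x => val x) (Rt _ Qs)) => i x /=.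
    by congr srel; apply: eq_from_tnth => a; rewrite tnth_mktuple tnth_map tnth_mktuple.
  apply: tame_ext (tame_pull (fun i x => val x) (ft _ fs)) => i x /=.
  case: (sfun f _) => //= y; case: insubP => [u _ <-|]; first by [].
  move=> yX; transitivity false => //; apply/negbTE/eqP => -[ye].
  by rewrite ye (valP (x false)) in yX.
- rewrite (functional_extensionality _ _ H); exists r, pi, cp; split=> // Q;
  rewrite !inE => /andP[nQ Qs].
  by apply: tame_ext (Rt _ Qs) => i x; rewrite srel_set_rel_neq.
- rewrite (functional_extensionality _ _ H); exists r, pi, cp; split=> // g;
  rewrite !inE => /andP[ng gs].
  by apply: tame_ext (ft _ gs) => i x; rewrite /= (negPf ng).
- have pull X Y (rho : forall i, (X -> A i) -> Y) (t : tame E pi rho) :=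
    tame_pull (T' := fun i => (A i + A i)%type) (fun i z => strip2 z) t.
  rewrite (functional_extensionality _ _ H); exists r.+1, (fun i z => pi i (strip2 z)),
    (fun i z => [tuple of is_inl z :: cp i (strip2 z)]); split.
  + move=> i a b e1 /(congr1 val)[e2 /val_inj e3].
    have : strip2 a = strip2 b by apply: cpi.
    by case: a b e2 {e1 e3} => [a|a] [b|b] //= _ ->.
  + move=> Q; rewrite !inE orbCA /copying.
    apply: (@tame_set_rel _ G E (fun i => unary U [set z : disjoint_double (A i) | ~~ is_inl z])
      _ (fun Q => (Q == (U, 1)) || (Q \in rels s)) (M, 2)
      (fun i t => @twins (A i) (tnth t ord0) (tnth t ord_max))).
      apply: tame_ext (tame_op (fun (b : bool * bool) (c : bool) => (b.1 != b.2) && c)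
        (tame_op pair (tame_color E _ (fun i (z : A i + A i) => is_inl z) ord0)
                      (tame_color E _ (fun i (z : A i + A i) => is_inl z) ord_max))
        (pull _ _ _ (tame_eq E cpi ord0 ord_max))) => i x /=.
      rewrite !tnth_mktuple /twins.
      by case: (x ord0) (x ord_max) => [a|a] [b|b].
    apply: (@tame_set_rel _ G E (fun i => disjoint_double (A i))
      _ (fun Q => Q \in rels s) (U, 1) (fun i t =>
        thead t \in [set z : disjoint_double (A i) | ~~ is_inl z])).
      apply: tame_ext (tame_color E _ (fun i (z : A i + A i) => ~~ is_inl z) ord0) => i x /=.
      by rewrite inE /thead tnth_mktuple.
    move=> Q' Qs; apply: tame_ext (tame_op andb _ (pull _ _ _ (Rt _ Qs))) => [i x|].
      by rewrite srel_double.
    apply: tame_op.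
      apply: tame_ext (tame_all (enum 'I_(arity Q')) (fun a =>
        tame_color E _ (fun i (z : A i + A i) => is_inl z) a)) => i x.
      by apply/allP/forallP => h a; [rewrite h ?mem_enum|].
    apply: tame_ext (tame_all (enum 'I_(arity Q')) (fun a =>
      tame_color E _ (fun i (z : A i + A i) => ~~ is_inl z) a)) => i x.
    by apply/allP/forallP => h a; [rewrite h ?mem_enum|].
  move=> f fs.
  apply: tame_ext (tame_op (fun (b : bool * bool) (c : bool) => (b.1 == b.2) && c)
        (tame_op pair (tame_color E _ (fun i (z : A i + A i) => is_inl z) true)
                      (tame_color E _ (fun i (z : A i + A i) => is_inl z) false))
        (pull _ _ _ (ft _ fs))) => i x /=.
  by case: (x true) (x false) => [a|a] [b|b] //=; case: (sfun f a).
- rewrite (functional_extensionality _ _ H); exists r, pi, cp; split=> // g; rewrite !inE /=.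
  have [->|ng] := eqVneq g f; last exact: ft.
  move=> _; case/andP: wf => _ ps.
  have D := tame_reindex (fun a : 'I_2 =>
    if a == ord0 then Some true else None) (tame_sat Hcov cpi Rt ft ps).
  apply: tame_ext (tame_app negb (tame_exists Hcov cpi (tame_op addb
    D (tame_eq E cpi None (Some false))))) => i x.
  rewrite graph_functionE; congr (~~ _); apply: eq_existsb => z; congr (sat _ _ (+) _).
  by apply: eq_from_tnth => a; rewrite tnth_mktuple; case: a => [[|[|]]].
(* Each run has made its own choice of a set; whatever these choices are, together they form one
   colour of the family. *)
- have [X XP] := dep_choice (fun i => ex2_ind (fun X _ e => ex_intro (fun X =>
  A' i = unary U X) X e) (H i)).
  rewrite (functional_extensionality _ _ XP); exists r, pi, cp; split=> // Q; rewrite !inE.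
  apply: (@tame_set_rel _ G E A pi (fun Q => Q \in rels s) (U, 1) (fun i t =>
    thead t \in X i)) => //.
  apply: tame_ext (tame_color E _ (fun i z => z \in X i) ord0) => i x /=.
  by rewrite /thead tnth_mktuple.
Qed.

Lemma tame_output (Idx : Type) (G : Idx -> finType) (E : forall i, rel (G i))
    (Hcov : low_covers E) t I : forall s (A B : Idx -> structure),
  transduction_from s t I -> tame_structure E s A -> (forall i, output I (A i) (B i)) ->
  tame_structure E t B.
Proof.
elim: I => [|o I IH] s A B /=; first by move=> -> ta /functional_extensionality ->.
move=> [wf It] ta out.
have /dep_choice[A' A'P] : forall i, exists A', op_output o (A i) A' /\ output I A' (B i).
  by move=> i; have [A' h1 h2] := out i; exists A'.
apply: (IH _ A' B It) => [|i]; last by case: (A'P i).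
by apply: tame_op_step wf ta _ => // i; case: (A'P i).
Qed.

Lemma tame_graph (Idx : Type) (P : {fset nat}) (G : Idx -> structure) :
  tame_structure (fun i => @adj (G i)) (graph_sig P) G.
Proof.
exists 0, (fun i x => x), (fun i x => [tuple]); split=> // R.
rewrite !inE => /orP[/eqP->|/imfsetP[p _ ->]].
  apply: tame_ext (tame_edge (fun i => @adj (G i)) _ (ord0 : 'I_2) (ord_max : 'I_2)) => i x.
  congr srel; apply: eq_from_tnth => a; rewrite tnth_mktuple.
  by case: a => [[|[|]]] //= ?; congr x; apply: val_inj.
apply: tame_ext (tame_color (fun i => @adj (G i)) _ (fun i =>
  @colored (G i) p) (ord0 : 'I_1)) => i x.
by congr srel; apply: eq_from_tnth => a; rewrite tnth_mktuple ord1.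
Qed.

(** It provides a variable in every definition: even a constant is defined from an equality between
    variables, see [definable_const]. *)
Definition positive_arity (s : signature) : Prop := forall R, R \in rels s -> 0 < arity R.

Lemma positive_arity_from t I : forall s,
  transduction_from s t I -> positive_arity s -> positive_arity t.
Proof.
elim: I => [|o I IH] s /=; first by move->.
move=> [wf /IH{}IH] ps; apply: IH.
case: o wf => [R phi|psi|R|f|U M|f phi|U sigma sig0] //= wf Q; rewrite !inE.
- by case/orP=> [/eqP->|/ps//]; case/and3P: wf.
- by case/andP=> _ /ps.
- by case/or3P=> [/eqP->|/eqP->|/ps].
- by case/orP=> [/eqP->|/ps].
Qed.

Lemma over_sig_set_rel s (A : structure) R (P : pred ((arity R).-tuple A)) S :
  over_sig s A -> rels S = R |` rels s -> funs S = funs s -> over_sig S (set_rel P).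
Proof.
move=> [hr hf] Sr Sf; split=> [Q|f]; last by rewrite Sf; apply: hf.
rewrite Sr !inE negb_or => /andP[nR nQ] t.
by rewrite srel_set_rel_neq // hr.
Qed.

Lemma over_sig_op s o A A' : op_wf s o -> over_sig s A -> op_output o A A' ->
  over_sig (op_sig s o) A'.
Proof.
case: o => [R phi|psi|R|f|U M|f phi|U sigma sig0] /= wf oA; have [hr hf] := oA.
- by move->; apply: over_sig_set_rel oA _ _.
- move->; split=> [R nR t|f nf x] /=; first exact: hr.
  by rewrite hf.
- move->; split=> [Q|f]; last exact: hf.
  rewrite !inE negb_and negbK; have [->|nQ] := eqVneq Q R => h t.
    by rewrite srel_set_rel.
  by rewrite srel_set_rel_neq // hr.
- move->; split=> [R|g]; first exact: hr.
  rewrite !inE negb_and negbK /= => h x; case: (eqVneq g f) h => [//|nQ] /= h.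
  by rewrite hf.
- move->; apply: (over_sig_set_rel (s := Signature ((U, 1) |` rels s) (funs s))) => //;
  last first.
    by apply/fsetP => Q; rewrite !inE orbCA.
  apply: (over_sig_set_rel (s := s)) => //; split=> [R nR t|f nf [x|x]] /=; last 2 first.
  - by rewrite hf.
  - by rewrite hf.
  by apply/existsP=> -[u]; rewrite hr // andbF.
- move->; split=> [R|g]; first exact: hr.
  rewrite !inE negb_or => /andP[/negPf nf ng] x /=; rewrite nf; exact: hf.
- by move=> [X _ ->]; apply: over_sig_set_rel oA _ _.
Qed.

Lemma over_sig_output t I : forall s A B, transduction_from s t I -> over_sig s A ->
  output I A B -> over_sig t B.
Proof.
elim: I => [|o I IH] s A B /=; first by move=> -> oA ->.
move=> [wf It] oA [A' h1 h2]; apply: IH It _ h2; exact: over_sig_op wf oA h1.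
Qed.

(** Lifts offer nonempty families, so no run gets stuck. This supplies the good completion that
    [angelic] assumes. *)
Lemma output_total I A : exists B, output I A B.
Proof.
elim: I A => [|o I IH] A; first by exists A.
have [A' oA] : exists A', op_output o A A'.
  case: o => [R phi|psi|R|f|U M|f phi|U sigma sig0] /=; try by eexists.
  have /set0Pn[X sX] := sig0 A.
  by exists (unary U X); exists X.
by have [B AB] := IH A'; exists B; exists A'.
Qed.

(** * Angelic choice of the lifts *)

Lemma isomorphic_sym A B : isomorphic A B -> isomorphic B A.
Proof.
move=> [h [[g hK gK] hr hf]]; exists g; split=> [|R t|f x]; first by exists h.
  rewrite -hr; congr srel; apply: eq_from_tnth => a.
  by rewrite !tnth_map gK.
rewrite -{2}[x]gK hf; case: (sfun f (g x)) => //= y; by rewrite hK.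
Qed.

Lemma isomorphic_trans A B C : isomorphic A B -> isomorphic B C -> isomorphic A C.
Proof.
move=> [h [hb hr hf]] [k [kb kr kf]]; exists (k \o h); split=> [|R t|f x].
- exact: bij_comp.
- rewrite -hr -kr; congr srel; apply: eq_from_tnth => a; by rewrite !tnth_map.
- by rewrite /= kf hf; case: (sfun f x).
Qed.

Lemma transduction_from_cat s t u I J :
  transduction_from s t I -> transduction_from t u J -> transduction_from s u (I ++ J).
Proof.
by elim: I s => [|o I IH] s /=; [move-> | move=> [wf h] h'; split=> //; apply: IH].
Qed.

Lemma output_cat I J A B : output (I ++ J) A B <-> exists2 A', output I A A' & output J A' B.
Proof.
elim: I A => [|o I IH] A /=; first by split=> [h|[_ ->]//]; exists A.
split=> [[A1 h /IH[A2 h1 h2]]|[A2 [A1 h h1] h2]].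
  by exists A2 => //; exists A1.
by exists A1 => //; apply/IH; exists A2.
Qed.

Definition is_lift (o : operation) : bool := if o is UnaryLift _ _ _ then true else false.

Lemma output_det J A B B' : ~~ has is_lift J -> output J A B -> output J A B' -> B = B'.
Proof.
elim: J A => [|o J IH] A /=; first by move=> _ -> ->.
rewrite negb_or => /andP[no nJ] [A1 h1 o1] [A2 h2 o2].
have e : A1 = A2 by case: o no h1 h2 => //= *; subst.
by subst; apply: IH nJ o1 o2.
Qed.

(** Ignores which sets a lift allows: runs with suitable sets are built first, and the lifts are
    adjusted to them only in [angelic]. *)
Definition loose_op (o : operation) (A B : structure) : Prop :=
  if o is UnaryLift U _ _ then exists X, B = unary (A := A) U X else op_output o A B.

Fixpoint loose_output (I : transduction) (A B : structure) : Prop :=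
  if I is o :: I' then exists2 A', loose_op o A A' & loose_output I' A' B else B = A.

Lemma loose_output_cat I J A A' B : loose_output I A A' -> loose_output J A' B ->
  loose_output (I ++ J) A B.
Proof.
elim: I A => [|o I IH] A /=; first by move=> ->.
by move=> [A1 h1 h2] h; exists A1 => //; apply: IH.
Qed.

Lemma loose_nolift J A B : ~~ has is_lift J -> loose_output J A B -> output J A B.
Proof.
elim: J A => [|o J IH] A //=; rewrite negb_or => /andP[no nJ] [A1 h1 /(IH _ nJ) h2].
by exists A1 => //; case: o no h1.
Qed.

(** Operations that only add symbols, so that the input remains readable as a reduct. [lift] is true
    while colours are being guessed and false afterwards. *)
Definition expanding (lift : bool) (o : operation) : bool :=
  match o with
  | Extension _ phi => quantifier_free phi
  | FunctionExtension _ phi => quantifier_free phi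
  | UnaryLift _ _ _ => lift
  | _ => false
  end.

Lemma structure_eq (T : finType) (r r' : forall R : nat * nat, (arity R).-tuple T -> bool)
    (f f' : nat -> T -> option T) :
  (forall R t, r R t = r' R t) -> (forall g x, f g x = f' g x) ->
  Structure r f = Structure r' f'.
Proof.
move=> er ef; congr Structure.
  by apply: functional_extensionality_dep => R; apply: functional_extensionality => t.
by apply: functional_extensionality => g; apply: functional_extensionality => x.
Qed.

Definition reduct_to (s : signature) (A : structure) : structure :=
  {| univ := univ A;
     srel := fun R t => (R \in rels s) && srel t;
     sfun := fun f x => if f \in funs s then sfun f x else None |}.

Lemma reduct_to_over s A : over_sig s (reduct_to s A).
Proof. by split=> [R /negPf nR t|f /negPf nf x] /=; rewrite ?nR // nf. Qed.

Lemma reduct_to_id s A : over_sig s A -> reduct_to s A = A.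
Proof.
case: A => T r f [/= hr hf]; apply: structure_eq => [R t|g x] /=.
  by have [//|/hr ->] := boolP (R \in rels s).
by have [//|/hf ->] := boolP (g \in funs s).
Qed.

Lemma reduct_to_expanding s s' lift o A A' :
  rels s `<=` rels s' -> funs s `<=` funs s' ->
  op_wf s' o -> expanding lift o -> loose_op o A A' ->
  reduct_to s A' = reduct_to s A /\
  rels s' `<=` rels (op_sig s' o) /\ funs s' `<=` funs (op_sig s' o).
Proof.
move=> /fsubsetP sr /fsubsetP sf wf.
have relcase R (P : pred ((arity R).-tuple A)) : R \notin rels s' ->
    reduct_to s (set_rel P) = reduct_to s A.
  move=> nR; apply: structure_eq => //= Q t; have [/sr Qs|//] /= := boolP (Q \in rels s).
  by case: eqP => // QR; rewrite -QR Qs in nR.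
case: o wf => [R phi|psi|R|f|U M|f phi|U sigma sig0] //= wf _.
- by move->; rewrite relcase ?fsubsetUr //; case/and3P: wf.
- move->; rewrite fsubsetUr; split=> //; apply: structure_eq => //= g x.
  have [/sf gs|//] := boolP (g \in funs s); case: eqP => // gf.
  by case/andP: wf; rewrite -gf gs.
- by move=> [X ->]; rewrite relcase ?fsubsetUr.
Qed.

(* A lift may only choose sets that can still be completed to a good output; the input is
   recovered from the current structure as its reduct to the initial signature. *)
Lemma angelic s0 (Good : structure -> structure -> Prop) t J : forall s,
  rels s0 `<=` rels s -> funs s0 `<=` funs s ->
  all (expanding true) J -> transduction_from s t J ->
  exists J', [/\ transduction_from s t J', almost_quantifier_free J' &
    forall A, (exists A1, loose_output J A A1 /\ Good (reduct_to s0 A) A1) ->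
    forall A1, output J' A A1 <-> loose_output J A A1 /\ Good (reduct_to s0 A) A1].
Proof.
elim: J => [|o J IH] s sr sf /=.
  by move=> _ ->; exists [::]; split=> // A [A1 [-> g]] A2; split=> [->|[]].
move=> /andP[eo eJ] [wf tJ].
have sr' : rels s0 `<=` rels (op_sig s o).
  by apply: fsubset_trans sr _; case: o eo {wf tJ} => //= *; rewrite fsubsetUr.
have sf' : funs s0 `<=` funs (op_sig s o).
  by apply: fsubset_trans sf _; case: o eo {wf tJ sr'} => //= *; rewrite ?fsubsetUr.
have [J' [tJ' qJ' J'P]] := IH _ sr' sf' eJ tJ.
have red A A' : loose_op o A A' -> reduct_to s0 A' = reduct_to s0 A.
  by move=> h; case: (reduct_to_expanding sr sf wf eo h).
have [lo|nlo] := boolP (is_lift o); last first.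
  have loE A A' : loose_op o A A' <-> op_output o A A' by case: o nlo {wf tJ sr' sf' tJ' red eo}.
  have determined A A' A'' : op_output o A A' -> op_output o A A'' -> A' = A''.
    by case: o nlo {wf tJ sr' sf' tJ' red eo loE} => //= *; subst.
  exists (o :: J'); split=> /= [//||A [A1 [[A' h1 h2] g]] A2].
    rewrite /almost_quantifier_free /= -/(almost_quantifier_free J') qJ' andbT.
    by case: o eo {wf tJ sr' sf' tJ' red nlo loE determined}.
  rewrite -(red _ _ h1) in g *; have J'A := J'P A' (ex_intro _ _ (conj h2 g)).
  split=> [[A'' k1 k2]|[[A'' k1 k2] g2]].
    have e : A'' = A' by apply: determined k1 _; apply/loE.
    by subst A''; move/J'A: k2 => [k2 g2]; split=> //; exists A'.
  have e : A'' = A' by apply: (determined A); apply/loE.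
  by subst A''; exists A'; [apply/loE|apply/J'A].
case: o lo wf tJ sr' sf' tJ' red eo => // U sigma sig0 _ wf tJ sr' sf' tJ' red eo.
pose S (A : structure) : {set {set A}} := [set X : {set A} |
  if excluded_middle_informative (exists A1, loose_output J (unary U X) A1 /\
    Good (reduct_to s0 A) A1) then true else false].
have SP (A : structure) (X : {set A}) : reflect (exists A1, loose_output J (unary U X) A1 /\
    Good (reduct_to s0 A) A1) (X \in S A).
  by rewrite inE; case: excluded_middle_informative => h; constructor.
(* A lift needs a nonempty family also on structures from which nothing good can be reached; there
   the choice does not matter. *)
pose sigma' A := if S A == set0 then setT else S A.
have sig0' A : sigma' A != set0.
  by rewrite /sigma'; case: ifP => [_|->//]; apply/set0Pn; exists set0; rewrite inE.
exists (UnaryLift U sig0' :: J'); split=> // A [A1 [[A' [X AX] h2] g]] A2.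
have XS : X \in S A by apply/SP; exists A1; rewrite -AX.
have sS : sigma' A = S A.
  by rewrite /sigma'; case: eqP => // S0; rewrite S0 inE in XS.
have redX (Y : {set A}) : reduct_to s0 (unary U Y) = reduct_to s0 A.
  by apply: red; exists Y.
split=> [[A'' /= [Y]]|[[A'' [Y ->] k2] g2]].
  rewrite sS => /SP YS ->; move/J'P; rewrite redX => /(_ YS)[k2 g2].
  by split=> //; exists (unary U Y) => //; exists Y.
have YS : Y \in S A by apply/SP; exists A2.
exists (unary U Y); first by exists Y; rewrite ?sS.
by apply/J'P; rewrite redX //; apply/SP.
Qed.

Lemma reduct_op s R A : R \in rels s ->
  reduct_to (Signature (rels s `\ R) (funs s)) A = set_rel (A := reduct_to s A) (R := R) pred0.
Proof.
move=> Rs; apply: structure_eq => //= Q t; rewrite !inE.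
case: eqP => //= _; apply/esym/existsP => -[u]; by rewrite andbF.
Qed.

Lemma function_reduct_op s f A : f \in funs s ->
  reduct_to (Signature (rels s) (funs s `\ f)) A = set_fun (A := reduct_to s A) f (fun=> None).
Proof.
move=> fs; apply: structure_eq => //= g x; rewrite !inE.
by case: eqP.
Qed.

Lemma reducts s s' : rels s' `<=` rels s -> funs s' `<=` funs s ->
  exists J, [/\ transduction_from s s' J, all op_qf J, ~~ has is_lift J &
    forall A, output J (reduct_to s A) (reduct_to s' A)].
Proof.
have [m] := ubnP (#|` rels s| + #|` funs s|).
elim: m s => // m IH s le sr sf.
have [/fset0Pn[R]|/negbNE/eqP r0] := boolP (rels s `\` rels s' != fset0).
  rewrite inE => /andP[nR Rs].
  have [||| J [h1 h2 h3 h4]] := IH (Signature (rels s `\ R) (funs s)) => //=.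
  - by move: le; rewrite (cardfsD1 R (rels s)) Rs add1n addSn ltnS.
  - by rewrite fsubsetD1 sr.
  exists (Reduct R :: J); split=> //= A.
  by exists (reduct_to (Signature (rels s `\ R) (funs s)) A); [apply: reduct_op | apply: h4].
have [/fset0Pn[f]|/negbNE/eqP f0] := boolP (funs s `\` funs s' != fset0).
  rewrite inE => /andP[nf fs].
  have [||| J [h1 h2 h3 h4]] := IH (Signature (rels s) (funs s `\ f)) => //=.
  - by move: le; rewrite (cardfsD1 f (funs s)) fs add1n addnS ltnS.
  - by rewrite fsubsetD1 sf.
  exists (FunctionReduct f :: J); split=> //= A.
  by exists (reduct_to (Signature (rels s) (funs s `\ f)) A);
    [apply: function_reduct_op | apply: h4].
have -> : s = s'.
  case: s s' sr sf r0 f0 {IH le} => r f [r' f'] /= sr sf /eqP + /eqP.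
  rewrite !fsetD_eq0 => h1 h2.
  by congr Signature; apply/eqP; rewrite eqEfsubset ?h1 ?h2.
by exists [::].
Qed.

(** * Quantifier-free expansions *)

Lemma fresh_name s N : exists n, [/\ N <= n, forall k, (n, k) \notin rels s & n \notin funs s].
Proof.
pose m1 := \max_(R <- enum_fset (rels s)) R.1; pose m2 := \max_(f <- enum_fset (funs s)) f.
exists (N + m1 + m2).+1; split=> [|k|]; first lia.
  apply/negP=> h; have : (N + m1 + m2).+1 <= m1.
    by apply: (@leq_bigmax_seq _ _ predT (fun R : nat * nat => R.1) (_, k)).
  lia.
apply/negP=> h; have : (N + m1 + m2).+1 <= m2.
  by apply: (@leq_bigmax_seq _ _ predT (fun f : nat => f)).
lia.
Qed.

Lemma term_over_sub s s' n (t : term n) : funs s `<=` funs s' ->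
  term_over s t -> term_over s' t.
Proof.
move=> /fsubsetP sf; elim: t => //= f t IH /andP[/sf -> /IH]. by [].
Qed.

Lemma formula_over_sub s s' n (phi : formula n) :
  rels s `<=` rels s' -> funs s `<=` funs s' -> formula_over s phi -> formula_over s' phi.
Proof.
move=> sr sf; have sT n' (t : term n') := @term_over_sub s s' n' t sf.
have sF f : f \in funs s -> f \in funs s' by apply/fsubsetP.
elim: phi => {n} [n R ts|n t1 t2|n f t|n phi IH|n phi IH psi IH'|n phi IH] //=.
- by move=> /andP[/(fsubsetP sr) ->]; apply: sub_all => t; apply: sT.
- by move=> /andP[/sT-> /sT->].
- by move=> /andP[/sF-> /sT->].
- by move=> /andP[/IH-> /IH'->].
Qed.

Section Agree.
Variables (T : finType) (s : signature).
Variables (r r' : forall R : nat * nat, (arity R).-tuple T -> bool).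
Variables (f f' : nat -> T -> option T).
Hypothesis er : forall R, R \in rels s -> forall t, @r R t = @r' R t.
Hypothesis ef : forall g, g \in funs s -> forall x, f g x = f' g x.

Lemma eval_agree n (v : n.-tuple T) (t : term n) : term_over s t ->
  eval (A := Structure r f) v t = eval (A := Structure r' f') v t.
Proof.
elim: t => //= g t IH /andP[gs /IH ->].
by case: (eval _ _) => //= x; apply: ef.
Qed.

Lemma sat_agree n (phi : formula n) (v : n.-tuple T) : formula_over s phi ->
  sat (A := Structure r f) phi v = sat (A := Structure r' f') phi v.
Proof.
elim: phi v => {n} [n R ts|n t1 t2|n g t|n phi IH|n phi IH psi IH'|n phi IH] v /=.
- move=> /andP[Rs h]; apply: eq_existsb => u; rewrite er //; congr (_ && _).
  congr (_ == _); elim: (tval ts) h => //= t l IH /andP[h /IH ->].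
  by rewrite eval_agree.
- by move=> /andP[h1 h2]; apply: eq_existsb => u; rewrite !eval_agree.
- move=> /andP[gs ts]; rewrite eval_agree //; case: (eval _ _) => //= x.
  by rewrite ef.
- by move=> h; rewrite IH.
- by move=> /andP[h1 h2]; rewrite IH // IH'.
- by move=> h; apply: eq_existsb => x; apply: IH.
Qed.

End Agree.

Section State.
Variables (Idx : Type) (base : Idx -> structure) (sb : signature).

(** All expansions share the universes [base i], so tuples and relations of successive states are
    compared without transport. *)
Record state := State {
  st_sig : signature;
  st_rel : forall i (R : nat * nat), (arity R).-tuple (base i) -> bool;
  st_fun : forall i, nat -> base i -> option (base i)
}.

Definition expansion (S : state) i : structure := Structure (@st_rel S i) (@st_fun S i).

Variables (lift : bool) (N : nat).

Definition named (s : signature) : Prop :=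
  (forall R, R \in rels s -> (R \in rels sb) || (N <= R.1)) /\
  (forall f, f \in funs s -> (f \in funs sb) || (N <= f)).

Definition start : state := State sb (fun i => @srel (base i)) (fun i => @sfun (base i)).

Lemma expansion_start i : expansion start i = base i.
Proof. by rewrite /expansion /=; case: (base i). Qed.

Definition extends (S S' : state) : Prop :=
  [/\ rels (st_sig S) `<=` rels (st_sig S'), funs (st_sig S) `<=` funs (st_sig S'),
      forall R, R \in rels (st_sig S) -> forall i t, @st_rel S i R t = @st_rel S' i R t &
      forall f, f \in funs (st_sig S) -> forall i x, @st_fun S i f x = @st_fun S' i f x].

Lemma extends_refl S : extends S S.
Proof. by split. Qed.

Lemma extends_trans S1 S2 S3 : extends S1 S2 -> extends S2 S3 -> extends S1 S3.
Proof.
move=> [h1 h2 h3 h4] [k1 k2 k3 k4]; split.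
- exact: fsubset_trans h1 k1.
- exact: fsubset_trans h2 k2.
- by move=> R RS i t; rewrite h3 // k3 // (fsubsetP h1).
- by move=> f fS i x; rewrite h4 // k4 // (fsubsetP h2).
Qed.

Definition valid (S : state) : Prop :=
  [/\ named (st_sig S), extends start S & exists J, [/\ all (expanding lift) J,
    transduction_from sb (st_sig S) J & forall i, loose_output J (base i) (expansion S i)]].

Lemma valid_start : valid start.
Proof.
split; [by split=> R -> | exact: extends_refl |].
by exists [::]; split=> // i; rewrite /= expansion_start.
Qed.

Lemma sat_extends S S' n (phi : formula n) i (v : n.-tuple (base i)) :
  extends S S' -> formula_over (st_sig S) phi ->
  sat (A := expansion S i) phi v = sat (A := expansion S' i) phi v.
Proof.
move=> [_ _ h3 h4]; apply: sat_agree => [R Rs t|f fs x]; [exact: h3|exact: h4].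
Qed.

Definition definable (S : state) k (rho : forall i, k.-tuple (base i) -> bool) : Prop :=
  exists phi : formula k, [/\ quantifier_free phi, formula_over (st_sig S) phi &
    forall i v, sat (A := expansion S i) phi v = rho i v].

Lemma definable_extends S S' k (rho : forall i, k.-tuple (base i) -> bool) :
  extends S S' -> definable S rho -> definable S' rho.
Proof.
move=> le [phi [q o h]]; exists phi; split=> // [|i v].
  by case: le => h1 h2 _ _; apply: formula_over_sub o.
by rewrite -h -(sat_extends _ le).
Qed.

Lemma definable_ext S k (rho rho' : forall i, k.-tuple (base i) -> bool) :
  (forall i v, rho i v = rho' i v) -> definable S rho -> definable S rho'.
Proof. by move=> e [phi [q o h]]; exists phi; split=> // i v; rewrite h. Qed.

Lemma definable_and S k (rho rho' : forall i, k.-tuple (base i) -> bool) :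
  definable S rho -> definable S rho' -> definable S (fun i v => rho i v && rho' i v).
Proof.
move=> [p [q o h]] [p' [q' o' h']]; exists (FAnd p p'); split=> /= [||i v].
- by rewrite q.
- by rewrite o.
- by rewrite h h'.
Qed.

Lemma definable_not S k (rho : forall i, k.-tuple (base i) -> bool) :
  definable S rho -> definable S (fun i v => ~~ rho i v).
Proof. by move=> [p [q o h]]; exists (FNot p); split=> //= i v; rewrite h. Qed.

Lemma definable_eq S k (a b : 'I_k) : definable S (fun i v => tnth v a == tnth v b).
Proof.
exists (FEq (Var a) (Var b)); split=> //= i v.
apply/existsP/eqP => [[x /andP[/eqP[->] /eqP[->]]]//|->].
by exists (tnth v b); rewrite eqxx.
Qed.

Lemma definable_const S k (a : 'I_k) (c : bool) : definable S (fun i (v : k.-tuple (base i)) =>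
  c).
Proof.
have h := definable_eq S a a; case: c.
  by apply: definable_ext h => i v; rewrite eqxx.
by apply: definable_ext (definable_not h) => i v; rewrite eqxx.
Qed.

Lemma definable_fun S k (a : 'I_k) (Z : Type) (zs : seq Z)
    (rho : Z -> forall i, k.-tuple (base i) -> bool) :
  (forall z, definable S (rho z)) -> forall Phi : seq bool -> bool,
  definable S (fun i v => Phi [seq rho z i v | z <- zs]).
Proof.
move=> D; elim: zs => [|z zs IH] Phi /=; first exact: definable_const.
have D1 := definable_and (D z) (IH (fun l => Phi (true :: l))).
have D2 := definable_and (definable_not (D z)) (IH (fun l => Phi (false :: l))).
apply: definable_ext (definable_not (definable_and (definable_not D1) (definable_not D2))) =>
  i v /=.
by case: (rho z i v) => /=; rewrite ?andbT negbK.
Qed.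

(** The truth table of [rho] is chosen classically: it accepts the lists of values of the atoms that
    occur, for some index, at a tuple satisfying [rho]. This turns determined relations into
    formulas. *)
Lemma definable_det S k (a : 'I_k) (Z : finType)
    (atom : Z -> forall i, k.-tuple (base i) -> bool)
    (rho : forall i, k.-tuple (base i) -> bool) :
  (forall z, definable S (atom z)) ->
  (forall i j v w, (forall z, atom z i v = atom z j w) -> rho i v = rho j w) ->
  definable S rho.
Proof.
move=> D H.
pose Phi (l : seq bool) : bool := if excluded_middle_informative (exists i v,
  [seq atom z i v | z <- enum Z] = l /\ rho i v) then true else false.
apply: definable_ext (definable_fun a (enum Z) D Phi) => i v.
rewrite /Phi; case: excluded_middle_informative => [[j [w [/eq_in_map e r]]]|no] /=.
  by rewrite -(H j i w v) // => z; apply: e; rewrite mem_enum.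
by apply/esym/negP=> r; apply: no; exists i, v.
Qed.

Lemma valid_op (S : state) o (S' : state) :
  valid S -> op_wf (st_sig S) o -> expanding lift o -> st_sig S' = op_sig (st_sig S) o ->
  named (st_sig S') -> extends S S' -> (forall i, loose_op o (expansion S i)
    (expansion S' i)) -> valid S'.
Proof.
move=> [nS bS [J [eJ tJ oJ]]] wf eo es nS' le h; split=> //; first exact: extends_trans le.
exists (J ++ [:: o]); rewrite es; split.
- by rewrite all_cat eJ /= eo.
- by apply: transduction_from_cat tJ _; split.
- by move=> i; apply: loose_output_cat (oJ i) _; exists (expansion S' i).
Qed.

Lemma set_rel_extends S n k (P : forall i, pred (k.-tuple (base i))) :
  (n, k) \notin rels (st_sig S) ->
  let S' := State (Signature ((n, k) |` rels (st_sig S)) (funs (st_sig S)))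
    (fun i => @srel (@set_rel (expansion S i) (n, k) (P i))) (@st_fun S) in
  extends S S' /\ forall i (t : k.-tuple (base i)), @st_rel S' i (n, k) t = P i t.
Proof.
move=> nS; split=> [|i t]; last exact: (@srel_set_rel (expansion S i) (n, k) (P i) t).
split=> //; first exact: fsubsetUr.
move=> R RS i t; symmetry; apply: (@srel_set_rel_neq (expansion S i) (n, k) (P i)).
by apply: contraNneq nS => <-.
Qed.

Lemma named_add S n k : (N <= n) || ((n, k) \in rels sb) -> named (st_sig S) ->
  named (Signature ((n, k) |` rels (st_sig S)) (funs (st_sig S))).
Proof.
move=> Nn [h1 h2]; split=> // R; rewrite !inE => /orP[/eqP->|/h1//] /=.
by rewrite orbC.
Qed.

Lemma add_rel S n k (phi : formula k) : valid S -> (N <= n) || ((n, k) \in rels sb) ->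
  (n, k) \notin rels (st_sig S) -> 0 < k -> quantifier_free phi ->
  formula_over (st_sig S) phi ->
  exists S', [/\ valid S', extends S S',
    st_sig S' = Signature ((n, k) |` rels (st_sig S)) (funs (st_sig S)) &
    forall i (t : k.-tuple (base i)), @st_rel S' i (n, k) t = sat (A := expansion S i) phi t].
Proof.
move=> vS Nn nS k0 q o.
have [e1 e2] := set_rel_extends (fun i => sat (A := expansion S i) phi) nS.
eexists; split; last exact: e2; [|exact: e1|by []].
apply: (valid_op (o := @Extension (n, k) phi) vS) => //=.
- by rewrite k0 nS.
- by apply: named_add => //; case: vS.
Qed.

(** The lift allows every set for now; [angelic] cuts it down to the useful choices at the very
    end. *)
Lemma add_set S n (X : forall i, {set base i}) : valid S -> lift -> N <= n ->
  (n, 1) \notin rels (st_sig S) ->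
  exists S', [/\ valid S', extends S S', (n, 1) \in rels (st_sig S') &
    forall i (t : 1.-tuple (base i)), @st_rel S' i (n, 1) t = (thead t \in X i)].
Proof.
move=> vS l Nn nS.
have [e1 e2] := set_rel_extends (fun i t => thead t \in X i) nS.
eexists; split; last exact: e2; [|exact: e1|by rewrite /= !inE eqxx].
have sig0 (A : structure) : [set: {set A}] != set0 by apply/set0Pn; exists set0; rewrite inE.
apply: (valid_op (o := @UnaryLift n (fun A => setT) sig0) vS) => //=.
- by apply: named_add; rewrite ?Nn //; case: vS.
- by move=> i; exists (X i).
Qed.

Lemma add_fun S f (phi : formula 2) : valid S -> (N <= f) || (f \in funs sb) ->
  f \notin funs (st_sig S) -> quantifier_free phi -> formula_over (st_sig S) phi ->
  exists S', [/\ valid S', extends S S',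
    st_sig S' = Signature (rels (st_sig S)) (f |` funs (st_sig S)) &
    forall i x, @st_fun S' i f x = graph_function (A := expansion S i) phi x].
Proof.
move=> vS Nn nS q o.
pose S' := State (Signature (rels (st_sig S)) (f |` funs (st_sig S))) (@st_rel S)
  (fun i => @sfun (@set_fun (expansion S i) f (graph_function (A := expansion S i) phi))).
have le : extends S S'.
  split=> //; first exact: fsubsetUr.
  move=> g gs i x /=; case: eqP => // gf; by rewrite -gf gs in nS.
exists S'; split=> //; last by move=> i x /=; rewrite eqxx.
apply: (valid_op (o := @FunctionExtension f phi) vS) => //=; first by rewrite nS.
case: vS => [[h1 h2] _ _]; split=> // g; rewrite !inE => /orP[/eqP->|/h2//].
by rewrite orbC.
Qed.

(** Requirements survive extensions, so they can be met one after the other. *)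
Lemma meet_requirements (Z : eqType) (zs : seq Z) (Q : Z -> state -> Prop) :
  (forall z S S', extends S S' -> Q z S -> Q z S') ->
  (forall z S, valid S -> z \in zs -> exists S', [/\ valid S', extends S S' & Q z S']) ->
  forall S, valid S -> exists S', [/\ valid S', extends S S' & forall z, z \in zs -> Q z S'].
Proof.
move=> mono step; elim: zs step => [|z zs IH] step S vS.
  by exists S; split=> //; apply: extends_refl.
have [S1 [v1 e1 q1]] := step z S vS (mem_head _ _).
have [z' S2 v2 z'zs|S2 [v2 e2 q2]] := IH _ S1 v1.
  by apply: step => //; rewrite inE z'zs orbT.
exists S2; split=> //; first exact: extends_trans e2.
by move=> z'; rewrite inE => /orP[/eqP->|/q2//]; apply: mono q1.
Qed.

End State.

Lemma sat_FRel (A : structure) n R (ts : (arity R).-tuple (term n)) (v : n.-tuple A)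
    (u : (arity R).-tuple A) :
  (forall j, eval v (tnth ts j) = Some (tnth u j)) -> sat (FRel ts) v = srel u.
Proof.
move=> h /=; apply/existsP/idP => [[w]|r].
  rewrite map_eq_tnth => /andP[/forallP e].
  congr srel; apply: eq_from_tnth => j; by have /eqP := e j; rewrite h => -[].
by exists u; rewrite r andbT map_eq_tnth; apply/forallP => j; rewrite h.
Qed.

(** * Quantifier-free definitions of tame relations over coloured graphs *)

Section Phase1.
Variables (Idx : Type) (Gs : Idx -> structure) (sb : signature) (N : nat).
Hypothesis edge_sb : edge \in rels sb.
Notation valid := (@valid Idx Gs sb true N).
Notation E := (fun i => @adj (Gs i)).

Lemma definable_edge S k (a b : 'I_k) : valid S ->
  definable S (fun i v => E i (tnth v a) (tnth v b)).
Proof.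
case=> _ [h1 _ h3 _] _.
exists (@FRel k edge [tuple (Var a); (Var b)]); split=> // [|i v].
  by rewrite /= (fsubsetP h1).
rewrite (@sat_FRel _ _ edge _ v [tuple tnth v a; tnth v b]) => [|j].
  by rewrite /= -h3.
by case: j => [[|[|]]].
Qed.

Lemma add_colors (K : finType) (kap : forall i, Gs i -> K) S : valid S ->
  exists S', [/\ valid S', extends S S' & forall a k (j : 'I_k),
    definable S' (fun i v => kap i (tnth v j) == a)].
Proof.
move=> vS.
have [||S' [v e q]] := @meet_requirements _ _ sb true N _ (enum K) (fun a S => forall k (j : 'I_k),
    definable S (fun i v => kap i (tnth v j) == a)) _ _ S vS.
- by move=> a S1 S2 le h k j; apply: definable_extends le (h k j).
- move=> a S1 v1 _; have [n [Nn nr _]] := fresh_name (st_sig S1) N.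
  have [S2 [v2 e2 r2 h2]] := add_set (fun i => [set x | kap i x == a]) v1 isT Nn (nr 1).
  exists S2; split=> // k j.
  exists (@FRel k (n, 1) [tuple (Var j)]); split=> // [|i v]; first by rewrite /= r2.
  rewrite (@sat_FRel _ _ (n, 1) _ v [tuple tnth v j]) => [|[[|]]] //.
  by rewrite /= h2 inE.
exists S'; split=> // a; apply: q; exact: mem_enum.
Qed.

(** The graph of [f] depends on finitely many definable atoms, so a function extension makes [f] a
    symbol, and [visible_fun] becomes an equality between two terms of height [D]. *)
Lemma add_visible e : visible E e -> forall S, valid S ->
  exists S', [/\ valid S', extends S S' & forall k (a b : 'I_k),
    definable S' (fun i v => e i (tnth v a) (tnth v b))].
Proof.
elim=> [V|{}e f K kap Psi D ve IH fP] S vS.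
  have [S' [v' e' q]] := add_colors (fun i x => x \in V i) vS.
  exists S'; split=> // k a b; have [qa qb] := (q true k a, q true k b).
  by apply: definable_ext (definable_and qa qb) => i v; rewrite !eqb_id.
have [S1 [v1 e1 q1]] := IH S vS.
have [S2 [v2 e2 q2]] := add_colors kap v1.
pose atom (z : (bool + bool) + (bool + 'I_2 * K)) i (v : 2.-tuple (Gs i)) : bool := match z with
  | inl (inl true) => e i (tnth v ord0) (tnth v ord0)
  | inl (inl false) => e i (tnth v ord0) (tnth v ord_max)
  | inl (inr true) => tnth v ord0 == tnth v ord_max
  | inl (inr false) => E i (tnth v ord0) (tnth v ord_max)
  | inr (inl _) => true
  | inr (inr (j, a)) => kap i (tnth v j) == a
  end.
(* Outside the domain of [e] nothing is known of [f]; the formula is false there and the new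
   function undefined. *)
have [phi [qphi ophi sphi]] : definable S2 (fun i (v : 2.-tuple (Gs i)) =>
    e i (tnth v ord0) (tnth v ord0) && (f i (tnth v ord0) == tnth v ord_max)).
  apply: (definable_det ord0 (atom := atom)) => [z|i j v w h].
    case: z => [[[]|[]]|[u|[j a]]] /=.
    - exact: definable_extends e2 (q1 _ _ _).
    - exact: definable_extends e2 (q1 _ _ _).
    - exact: definable_eq.
    - exact: definable_edge.
    - exact: definable_const ord0 _.
    - exact: q2.
  have h1 := h (inl (inl true)); have h2 := h (inl (inl false)).
  have h3 := h (inl (inr true)); have h4 := h (inl (inr false)).
  have hk (l : 'I_2) : kap i (tnth v l) = kap j (tnth w l).
    by have := h (inr (inr (l, kap j (tnth w l)))); rewrite /= eqxx => /eqP.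
  rewrite /= in h1 h2 h3 h4.
  have [ev|//] /= := boolP (e i (tnth v ord0) (tnth v ord0)); last first.
    by move=> nv; rewrite -h1 (negPf nv).
  have ew : e j (tnth w ord0) (tnth w ord0) by rewrite -h1.
  by rewrite ew /= !fP // h2 h3 h4 !hk.
have [g [Ng _ ng]] := fresh_name (st_sig S2) N.
have [|S3 [v3 e3 s3 h3]] := add_fun v2 _ ng qphi ophi; first by rewrite Ng.
have gE i x : e i x x -> st_fun S3 (i := i) g x = Some (f i x).
  move=> xx; rewrite h3; apply/eqP; rewrite (@graph_functionE (expansion S2 i) phi x (f i x)).
  rewrite negb_exists; apply/forallP => z.
  by rewrite negb_add sphi /tnth /= xx andTb (eq_sym z) eqxx.
have itE i x r : e i x x -> e i (iter r (f i) x) (iter r (f i) x).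
  move=> xx; elim: r => //= r IHr; have := fP i _ IHr (f i (iter r (f i) x)).
  by rewrite eqxx => /esym/andP[/(visible_left ve)[]].
have evE i k (v : k.-tuple (Gs i)) (a : 'I_k) r : e i (tnth v a) (tnth v a) ->
    eval (A := expansion S3 i) v (iter r (App g) (Var a)) = Some (iter r (f i) (tnth v a)).
  by move=> va; elim: r => //= r ->; rewrite /= gE // itE.
exists S3; split=> // [|k a b]; first exact/(extends_trans e1)/(extends_trans e2).
have e13 := extends_trans e2 e3.
have [pa [q_a oa ha]] := definable_extends e13 (q1 k a a).
have [pb [qb ob hb]] := definable_extends e13 (q1 k b b).
exists (FAnd pa (FAnd pb (FEq (iter D (App g) (Var a)) (iter D (App g) (Var b))))).
split=> [||i v] /=.
- by rewrite q_a qb.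
- have og c : term_over (st_sig S3) (iter D (App g) (Var c : term k)).
    by elim: D => //= r ->; rewrite s3 !inE eqxx.
  by rewrite oa ob !og.
rewrite ha hb; have [ea|//] /= := boolP (e i (tnth v a) (tnth v a)).
have [eb|//] /= := boolP (e i (tnth v b) (tnth v b)).
rewrite !evE //; apply/existsP/eqP => [[x /andP[/eqP[->] /eqP[->]]]//|->].
by exists (iter D (f i) (tnth v b)); rewrite eqxx.
Qed.

Lemma add_tame k (a0 : 'I_k) (rho : forall i, ('I_k -> Gs i) -> bool) :
  tame E (fun i x => x) rho -> forall S, valid S ->
  exists S', [/\ valid S', extends S S' & definable S' (fun i v => rho i (tnth v))].
Proof.
move=> [Z [es [ve [K [kap [g D]]]]]] S vS.
have [||S1 [v1 e1 q1]] := @meet_requirements _ _ sb true N _ (enum Z) (fun z S => forall k (a b : 'I_k),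
    definable S (fun i v => es z i (tnth v a) (tnth v b))) _ _ S vS.
- by move=> z S1 S2 le h l a b; apply: definable_extends le (h l a b).
- by move=> z S1 v1 _; have [S2 [v2 e2 q2]] := add_visible (ve z) v1; exists S2.
have [S2 [v2 e2 q2]] := add_colors kap v1.
(* The constant of each structure is guessed too, as a colour shared by all its vertices. *)
have [S3 [v3 e3 q3]] := add_colors (fun i _ => g i) v2.
exists S3; split=> //; first exact/(extends_trans e1)/(extends_trans e2).
pose atom (z : ('I_k * K) + ('I_k * 'I_k * (bool + Z) + K)) i (v : k.-tuple (Gs i)) : bool :=
  match z with
  | inl (a, c) => kap i (tnth v a) == c
  | inr (inl (a, b, inl true)) => tnth v a == tnth v b
  | inr (inl (a, b, inl false)) => E i (tnth v a) (tnth v b)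
  | inr (inl (a, b, inr z)) => es z i (tnth v a) (tnth v b)
  | inr (inr c) => g i == c
  end.
apply: (definable_det a0 (atom := atom)) => [z|i j v w h].
  case: z => [[a c]|[[[a b] [[]|z]]|c]] /=.
  - exact: definable_extends e3 (q2 _ _ _).
  - exact: definable_eq.
  - exact: definable_edge.
  - apply: definable_extends e3 (definable_extends e2 (q1 z _ _ _ _)); exact: mem_enum.
  - exact: (q3 c k a0).
apply: D => [|a|a b].
- by have := h (inr (inr (g j))); rewrite /= eqxx => /eqP.
- by have := h (inl (a, kap j (tnth w a))); rewrite /= eqxx => /eqP.
rewrite /info; congr (_, _, _).
- exact: h (inr (inl (a, b, inl true))).
- exact: h (inr (inl (a, b, inl false))).
by apply/ffunP=> z; rewrite !ffunE; apply: h (inr (inl (a, b, inr z))).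
Qed.

Lemma add_tame_rel k (a0 : 'I_k) (rho : forall i, ('I_k -> Gs i) -> bool) :
  tame E (fun i x => x) rho -> forall S, valid S ->
  exists S', [/\ valid S', extends S S' & exists2 n, (N <= n) && ((n, k) \in rels (st_sig S')) &
    forall i (v : k.-tuple (Gs i)), @st_rel _ _ S' i (n, k) v = rho i (tnth v)].
Proof.
move=> tr S vS; have [S1 [v1 e1 [phi [qp op sp]]]] := add_tame a0 tr vS.
have [n [Nn nr _]] := fresh_name (st_sig S1) N.
have [||S2 [v2 e2 s2 h2]] := add_rel v1 _ (nr k) _ qp op.
- by rewrite Nn.
- by case: k a0 {rho tr phi qp op sp} => // -[].
exists S2; split=> //; first exact: extends_trans e2.
exists n => [|i v]; first by rewrite Nn s2 !inE eqxx.
by rewrite h2 sp.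
Qed.

End Phase1.

(** Passage from the output structure to the vertices. The colour of a vertex lists, for each copy
    index, the colour of the element there, if any; by [cpi] there is at most one. As [c] fixes the
    copy of each argument, an assignment over one tuple of vertices can be carried to any tuple with
    the same colours. *)
Lemma tame_copies (Idx : Type) (G : Idx -> finType) (E : forall i, rel (G i))
    (B : Idx -> finType) (pi : forall i, B i -> G i) (Cp : finType) (cp : forall i, B i -> Cp)
    (cpi : forall i a b, pi i a = pi i b -> cp i a = cp i b -> a = b)
    (X : finType) (rho : forall i, (X -> B i) -> bool) (c : X -> Cp) :
  tame E pi rho -> tame E (fun i x => x) (fun i (x : X -> G i) =>
    [exists u : {ffun X -> B i}, [forall a, (pi i (u a) == x a) && (cp i (u a) ==
      c a)] && rho i u]).
Proof.
move=> [Z [es [ve [K [kap [g D]]]]]]; exists Z, es; split=> //.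
pose pk i x d := [pick b | (pi i b == x) && (cp i b == d)].
have pkE i b : pk i (pi i b) (cp i b) = Some b.
  rewrite /pk; case: pickP => [b' /andP[/eqP e1 /eqP e2]|/(_ b)]; last by rewrite !eqxx.
  by rewrite (cpi _ _ _ e1 e2).
exists ({ffun Cp -> option K} + K)%type, (fun i x => inl [ffun d => omap (kap i) (pk i x d)]),
  (fun i => inr (g i)).
suff H i j (x : X -> G i) (y : X -> G j) : g i = g j ->
    (forall a d, omap (kap i) (pk i (x a) d) = omap (kap j) (pk j (y a) d)) ->
    (forall a b, info E es (x a) (x b) = info E es (y a) (y b)) ->
    [exists u : {ffun X -> B i}, [forall a, (pi i (u a) == x a) && (cp i (u a) ==
      c a)] && rho i u] ->
    [exists u : {ffun X -> B j}, [forall a, (pi j (u a) == y a) && (cp j (u a) ==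
      c a)] && rho j u].
  move=> i j x y [eg] ek el.
  have {}ek a d : omap (kap i) (pk i (x a) d) = omap (kap j) (pk j (y a) d).
    by case: (ek a) => /ffunP/(_ d); rewrite !ffunE.
  by apply/idP/idP; apply: H.
move=> eg ek el /existsP[u /andP[/forallP hu ru]].
have hu1 a : pi i (u a) = x a by case/andP: (hu a) => /eqP.
have hu2 a : cp i (u a) = c a by case/andP: (hu a) => _ /eqP.
have /dep_choice[w wP] : forall a, exists b, [/\ pi j b = y a, cp j b = c a & kap j b =
  kap i (u a)].
  move=> a; have := ek a (c a); rewrite -(hu1 a) -{1}(hu2 a) pkE /=.
  rewrite /pk; case: pickP => //= b /andP[/eqP h1 /eqP h2] [h3].
  by exists b.
apply/existsP; exists (finfun w); apply/andP; split.
  by apply/forallP => a; rewrite ffunE; case: (wP a) => -> -> _; rewrite !eqxx.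
rewrite -(D i j u) // => a; first by rewrite ffunE; case: (wP a).
move=> b; rewrite !ffunE !hu1 el.
by case: (wP a) => -> _ _; case: (wP b) => -> _ _.
Qed.

(** * Interpretation in copies *)

Definition apply_funs (A : structure) (fs : seq nat) (o : option A) : option A :=
  foldr (fun f o => obind (sfun f) o) o fs.

Lemma eval_apps (A : structure) n (v : n.-tuple A) (fs : seq nat) (t : term n) :
  eval v (foldr (@App n) t fs) = apply_funs fs (eval v t).
Proof. by elim: fs => //= f fs ->. Qed.

(** [b] embeds [H i] as the original copies, and the composition of [fs] projects onto them: a
    relation of [H i] between the vertices below given elements becomes an atomic formula on terms.
    [U j] displays the [j]-th bit of the copy index. *)
Record copied (N r : nat) (s s' : signature) (J : transduction) (Idx : Type)
    (H W : Idx -> structure) (q : forall i, W i -> H i * r.-tuple bool)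
    (b : forall i, H i -> W i) (fs : seq nat) (U : 'I_r -> nat) : Prop := Copied {
  copied_from : transduction_from s s' J;
  copied_qf : all op_qf J;
  copied_nolift : ~~ has is_lift J;
  copied_output : forall i, output J (H i) (W i);
  copied_bij : forall i, bijective (q i);
  copied_funs : all (fun f => (f \in funs s') && (N <= f)) fs;
  copied_proj : forall i w, apply_funs fs (Some w) = Some (b i (q i w).1);
  copied_sub : (rels s `<=` rels s') && (funs s `<=` funs s');
  copied_rel : forall R, R \in rels s -> forall i (t : (arity R).-tuple (H i)),
    srel (s := W i) (R := R) [tuple of map (b i) t] = srel t;
  copied_bits : forall j, ((U j, 1) \in rels s') && (N <= U j);
  copied_bit : forall i j w,
    srel (s := W i) (R := (U j, 1)) [tuple w] = tnth (q i w).2 j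
}.

Lemma copies N r s (Idx : Type) (H : Idx -> structure) :
  exists s' J W q b fs U, @copied N r s s' J Idx H W q b fs U.
Proof.
elim: r => [|r [s1 [J [W [q [b [fs [U cW]]]]]]]].
  exists s, [::], H, (fun i x => (x, [tuple])), (fun i x => x), [::], (fun _ => 0).
  split=> //.
  - by move=> i; exists fst => [x|[x t]] //=; congr (_, _); apply: eq_from_tnth => -[].
  - by rewrite !fsubset_refl.
  - by move=> R _ i t; congr srel; apply: eq_from_tnth => a; rewrite tnth_map.
  - by case.
  - by move=> i [].
have [n1 [N1 r1 f1]] := fresh_name s1 N.
have [n2 [N2 r2 f2]] := fresh_name s1 n1.+1.
pose s2 := op_sig s1 (Copying n1 n2).
have [p [Np rp fp]] := fresh_name s2 N.
have n12 : n1 != n2 by lia.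
(* Relates a marked element to its twin and any other one to itself, so that the new function
   projects onto the originals. *)
pose phi : formula 2 :=
  let Ux := @FRel 2 (n1, 1) [tuple (Var ord0)] in
  let Mxy := @FRel 2 (n2, 2) [tuple (Var ord0); (Var ord_max)] in
  FNot (FAnd (FNot (FAnd Ux Mxy)) (FNot (FAnd (FNot Ux) (FEq (Var ord0) (Var ord_max))))).
pose C i := copying (W i) n1 n2.
have relU i (z : W i + W i) : srel (s := C i) (R := (n1, 1)) [tuple z] = ~~ is_inl z.
  rewrite (@srel_set_rel_neq _ (n2, 2) _ (n1, 1)); last by rewrite xpair_eqE andbF.
  rewrite (@srel_set_rel (disjoint_double (W i)) (n1, 1) _ [tuple z]).
  by rewrite inE.
have relM i (z z' : W i + W i) : srel (s := C i) (R := (n2, 2)) [tuple z; z'] = twins z z'.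
  exact: (@srel_set_rel (unary (A := disjoint_double (W i)) n1 [set z : W i + W i | ~~ is_inl z])
    (n2, 2) (fun t => @twins (W i) (tnth t ord0) (tnth t ord_max)) [tuple z; z']).
have relC i (R : nat * nat) (t : 'I_(arity R) -> W i + W i) : R \in rels s1 ->
    srel (s := C i) (R := R) [tuple t a | a < arity R] =
    ([forall a, is_inl (t a)] || [forall a, ~~ is_inl (t a)]) &&
      srel [tuple strip2 (t a) | a < arity R].
  move=> Rs; rewrite (@srel_set_rel_neq _ (n2, 2)); last by apply: contraNneq (r2 2) => <-.
  rewrite (@srel_set_rel_neq (disjoint_double (W i)) (n1, 1));
    last by apply: contraNneq (r1 1) => <-.
  exact: (@srel_double (W i) R t).
have satphi i (z z' : W i + W i) : sat (A := C i) phi [tuple z; z'] = (z' == inl (strip2 z)).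
  have h1 : sat (A := C i) (@FRel 2 (n1, 1) [tuple (Var ord0)]) [tuple z; z'] = ~~ is_inl z.
    by rewrite (@sat_FRel (C i) _ (n1, 1) _ _ [tuple z]) ?relU // => -[[|]].
  have h2 : sat (A := C i) (@FRel 2 (n2, 2) [tuple (Var ord0); (Var ord_max)]) [tuple z;
    z'] = twins z z'.
    by rewrite (@sat_FRel (C i) _ (n2, 2) _ _ [tuple z; z']) ?relM // => -[[|[|]]].
  have h3 : sat (A := C i) (FEq (Var ord0) (Var ord_max)) [tuple z; z'] = (z == z').
    apply/existsP/eqP => [[x /andP[/eqP[<-] /eqP[e]]]|->]; first exact: esym e.
    by exists z'; rewrite !eqxx.
  have -> : sat (A := C i) phi [tuple z; z'] =
      ~~ (~~ (~~ is_inl z && twins z z') && ~~ (~~ ~~ is_inl z && (z == z'))).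
    by rewrite -h1 -h2 -h3.
  by case: z z' {h1 h2 h3} => [x|x] [y|y] //=; rewrite ?andbT negbK eq_sym.
pose W' i := set_fun p (graph_function (A := C i) phi).
pose q' i (z : W' i) : H i * r.+1.-tuple bool :=
  ((q i (strip2 z)).1, [tuple of ~~ is_inl z :: (q i (strip2 z)).2]).
pose b' i x : W' i := inl (b i x).
exists (Signature (rels s2) (p |` funs s2)), (J ++ [:: Copying n1 n2; FunctionExtension p phi]),
  W', q', b', (rcons fs p), (fun j => if unlift ord0 j is Some j' then U j' else n1).
have sub12 R : R \in rels s1 -> R \in rels s2 by move=> Rs; rewrite !inE Rs !orbT.
have pE i (z : W' i) : sfun p z = Some (inl (strip2 z) : W' i).
  rewrite /= eqxx; apply/eqP; rewrite (@graph_functionE (C i) phi z (inl (strip2 z))).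
  by rewrite negb_exists; apply/forallP => z'; rewrite negb_add satphi eqxx.
have sE i f (x : W i) : f != p -> sfun (s := W' i) f (inl x) = omap inl (sfun f x).
  by move=> /negPf /= ->.
split.
- apply: transduction_from_cat (copied_from cW) _; split=> /=; first by rewrite r1 r2.
  by split=> //; rewrite fp /= !inE !eqxx /= !orbT.
- by rewrite all_cat (copied_qf cW).
- by rewrite has_cat negb_or (copied_nolift cW).
- move=> i; apply/output_cat; exists (W i); first exact: copied_output cW i.
  by exists (C i) => //; exists (W' i).
- move=> i; have [g qg gq] := copied_bij cW i.
  exists (fun xc : H i * r.+1.-tuple bool =>
    (if thead xc.2 then inr else inl) (g (xc.1, [tuple of behead xc.2]))).
    move=> z; rewrite /q' /= theadE.
    have -> : [tuple of behead [tuple of ~~ is_inl z :: (q i (strip2 z)).2]] = (q i (strip2 z)).2.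
      by apply: val_inj.
    by rewrite -surjective_pairing qg; case: z.
  move=> [x t]; rewrite /q' /=; case: (thead t) (tuple_eta t) => te /=; rewrite gq /=;
    congr (_, _);
    by rewrite [RHS]te; apply: val_inj.
- rewrite all_rcons /= !inE eqxx Np /=; apply/allP => f /(allP (copied_funs cW))/andP[ff ->].
  by rewrite !inE ff orbT.
- move=> i w.
  have -> : apply_funs (rcons fs p)
    (Some w) = apply_funs fs (sfun p w) by rewrite /apply_funs foldr_rcons.
  rewrite pE; have aE o : apply_funs (A := W' i) fs (omap inl o) = omap inl (apply_funs (A :=
    W i) fs o).
    move: (copied_funs cW) => {cW}; elim: fs => //= f l IH /andP[/andP[fs1 _] /IH ->].
    case: (apply_funs l o) => //= x; rewrite -[RHS]sE //.
    by apply: contraNneq fp => <-.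
  by rewrite (aE (Some (strip2 w))) (copied_proj cW).
- have /andP[h1 h2] := copied_sub cW; apply/andP; split.
    by apply/fsubsetP => R /(fsubsetP h1); apply: sub12.
  by apply: fsubset_trans h2 _; rewrite /= fsubsetUr.
- move=> R Rs i t; have Rs1 : R \in rels s1 by case/andP: (copied_sub cW) => /fsubsetP h1 _;
  apply: h1.
  rewrite -(copied_rel cW Rs).
  have -> : [tuple of map (b' i) t] = [tuple (inl (b i (tnth t a)) : W i + W i) | a < arity R].
    by apply: eq_from_tnth => a; rewrite tnth_mktuple tnth_map.
  rewrite [LHS](relC i R _ Rs1).
  have -> : [forall a : 'I_(arity R), is_inl (inl (b i (tnth t a)) : W i + W i)] by apply/forallP.
  by congr srel; apply: eq_from_tnth => a; rewrite tnth_mktuple tnth_map.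
- move=> j; case: unliftP => [j'|] _; last by rewrite /= !inE eqxx N1.
  by have /andP[/sub12 -> ->] := copied_bits cW j'.
- move=> i j w; case: unliftP => [j'|] ->; last by rewrite [LHS]relU.
  have -> : [tuple w] = [tuple w | a < 1] by apply: eq_from_tnth => a; rewrite tnth_mktuple ord1.
  rewrite [LHS](relC i (U j', 1) (fun=> w)); last by case/andP: (copied_bits cW j').
  have -> : [forall a : 'I_1, is_inl w] || [forall a : 'I_1, ~~ is_inl w].
    by case: w => x; apply/orP; [left|right]; apply/forallP.
  rewrite /= tnthS -(copied_bit cW).
  by congr srel; apply: eq_from_tnth => a; rewrite tnth_mktuple ord1.
Qed.

Lemma over_sig_loose t I : forall s A B, transduction_from s t I -> over_sig s A ->
  loose_output I A B -> over_sig t B.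
Proof.
elim: I => [|o I IH] s A B /=; first by move=> -> oA ->.
move=> [wf It] oA [A' h1 h2]; apply: IH It _ h2.
case: o wf h1 => [R phi|psi|R|f|U M|f phi|U sigma sig0] wf h1;
  try exact: over_sig_op wf oA h1.
by case: h1 => X ->; apply: over_sig_set_rel oA _ _.
Qed.

Lemma expanding_false J : all (expanding false) J -> all op_qf J /\ ~~ has is_lift J.
Proof.
elim: J => //= o J IH /andP[eo /IH[-> /negPf ->]].
by case: o eo => //= R phi ->.
Qed.

Section Interpret.
Variables (Idx : Type) (N r : nat) (s t : signature) (H B : Idx -> structure).
Variables (pi : forall i, B i -> H i) (cp : forall i, B i -> r.-tuple bool).
Hypothesis cpi : forall i a b, @pi i a = pi b -> cp a = cp b -> a = b.
Hypothesis oH : forall i, over_sig s (H i).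
Hypothesis oB : forall i, over_sig t (B i).
Hypothesis tpos : positive_arity t.
Hypothesis tN : (forall R, R \in rels t -> R.1 < N) /\ (forall f, f \in funs t -> f < N).

Definition at_point i (x : H i) (c : r.-tuple bool) (b : B i) : bool :=
  (pi b == x) && (cp b == c).

(** [H] has no copies, so it carries one relation symbol for each choice [c] of the copies in which
    the arguments lie. The positions [pos] allow graphs of functions, whose arguments are indexed by
    [bool]. *)
Definition named_rel k (X : finType) (pos : X -> 'I_k)
  (rho : forall i, (X -> B i) -> bool) : Prop :=
  forall c : {ffun X -> r.-tuple bool}, exists2 n, (N <= n) && ((n, k) \in rels s) &
    forall i (v : k.-tuple (H i)), srel (s := H i) (R := (n, k)) v =
      [exists u : {ffun X -> B i},
        [forall a, at_point (tnth v (pos a)) (c a) (u a)] && rho i u].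

Hypothesis Hrel : forall R, R \in rels t ->
  named_rel id (fun i (u : 'I_(arity R) -> B i) => srel [tuple u a | a < arity R]).
Hypothesis Hfun : forall f, f \in funs t ->
  named_rel (fun b : bool => if b then ord0 else ord_max : 'I_2)
    (fun i u => sfun f (u true) == Some (u false)).
Hypothesis Hdom : named_rel id (fun i (u : 'I_1 -> B i) => true).

(** [B i] sits in [2 ^ r] copies of [H i] as the set of codes [(pi d, cp d)], injectively by [cpi].
    There the bits select which named relation to consult at the projections, so the relations and
    functions of [t] and the set of codes are quantifier-free definable. It remains to restrict to
    the codes and to forget the auxiliary symbols. *)
Lemma interpret : exists J, [/\ transduction_from s t J, all op_qf J, ~~ has is_lift J &
  forall i, exists2 B', output J (H i) B' & isomorphic B' (B i)].
Proof.
have [s1 [J1 [W [q [b [fs [U cW]]]]]]] := copies N r s H.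
(* The symbols named below [N] are dropped: those of the graph could clash with those of [t]. *)
pose s2 := Signature [fset R in rels s1 | N <= R.1] [fset f in funs s1 | N <= f].
have [||J2 [t2 q2 n2 o2]] := @reducts s1 s2.
- by apply/fsubsetP => R; rewrite !inE => /andP[].
- by apply/fsubsetP => f; rewrite !inE => /andP[].
pose W2 i := reduct_to s2 (W i).
have oW i : over_sig s1 (W i) := over_sig_output (copied_from cW) (oH i) (copied_output cW i).
pose S0 := start W2 s2.
have v0 : @valid Idx W2 s2 false 0 S0 by apply: valid_start.
have s2R n k : N <= n -> (n, k) \in rels s1 -> (n, k) \in rels s2 by move=> Nn h;
  rewrite !inE Nn h.
have fs2 : all (fun f => f \in funs s2) fs.
  by apply: sub_all (copied_funs cW) => f /andP[h1 h2]; rewrite !inE h1 h2.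
have projE i x : apply_funs (A := W2 i) fs (Some x) = Some (b i (q i x).1).
  rewrite -(copied_proj cW); elim: fs fs2 {cW} => //= f l IH /andP[fS /IH ->].
  by case: (apply_funs l _) => //= y; rewrite fS.
pose emb i (x : W2 i) (d : B i) : bool := q i x == (pi d, cp d).
have embE i x d : emb i x d = at_point (q i x).1 (q i x).2 d.
  by rewrite /emb /at_point -pair_eqE /= ![_ == pi d]eq_sym ![_ == cp d]eq_sym.
have def k (X : finType) (pos : X -> 'I_k) (a0 : 'I_k) rho : named_rel pos rho ->
    definable S0 (fun i (v : k.-tuple (W2 i)) =>
      [exists u : {ffun X -> B i}, [forall a, emb i (tnth v (pos a)) (u a)] && rho i u]).
  move=> hr; have /dep_choice[nu nuP] : forall c : {ffun X -> r.-tuple bool}, exists n,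
      (N <= n) && ((n, k) \in rels s) /\ forall i (v : k.-tuple (H i)),
      srel (s := H i) (R := (n, k)) v = [exists u : {ffun X -> B i},
        [forall a, at_point (tnth v (pos a)) (c a) (u a)] && rho i u].
    by move=> c; have [n h1 h2] := hr c; exists n.
  have nu1 c : (N <= nu c) && ((nu c, k) \in rels s) by case: (nuP c).
  have nuE c i (v : k.-tuple (H i)) : srel (s := H i) (R := (nu c, k)) v =
      [exists u : {ffun X -> B i}, [forall a, at_point (tnth v (pos a)) (c a) (u a)] && rho i u].
    by case: (nuP c).
  pose atom (z : ('I_k * 'I_r) + {ffun X -> r.-tuple bool}) i (v : k.-tuple (W2 i)) : bool :=
    match z with
    | inl (a, j) => tnth (q i (tnth v a)).2 j
    | inr c => srel (s := H i) (R := (nu c, k)) [tuple (q i (tnth v a)).1 | a < k]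
    end.
  apply: (definable_det a0 (atom := atom)) => [[[a j]|c]|i j v w h].
  - have /andP[Us NU] := copied_bits cW j.
    exists (@FRel k (U j, 1) [tuple (Var a)]); split=> // [|i v].
      by rewrite /= s2R.
    rewrite (@sat_FRel _ _ (U j, 1) _ v [tuple tnth v a]) => [|[[|]]] //.
    by rewrite /= -(copied_bit cW) s2R.
  - have /andP[Nn ns] := nu1 c.
    have ns1 : (nu c, k) \in rels s1 by case/andP: (copied_sub cW) => /fsubsetP h1 _; apply: h1.
    exists (@FRel k (nu c, k) [tuple foldr (@App k) (Var a) fs | a < k]); split=> // [|i v].
      apply/andP; split; first exact: s2R.
      apply/all_tnthP => a; rewrite tnth_mktuple.
      by elim: fs fs2 {cW projE} => //= f l IH /andP[-> /IH].
    rewrite (@sat_FRel _ _ (nu c, k) _ v [tuple b i (q i (tnth v a)).1 | a < k]) => [|a];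
      last first.
      rewrite !tnth_mktuple eval_apps; exact: projE.
    rewrite /= s2R //= -(copied_rel cW ns); congr srel.
    by apply: eq_from_tnth => a; rewrite tnth_mktuple tnth_map tnth_mktuple.
  have key i' (v' : k.-tuple (W2 i')) :
      [exists u : {ffun X -> B i'}, [forall a, emb i' (tnth v' (pos a)) (u a)] && rho i' u] =
      atom (inr [ffun a => (q i' (tnth v' (pos a))).2]) i' v'.
    rewrite /atom nuE; apply: eq_existsb => u; congr (_ && _); apply: eq_forallb => a.
    by rewrite embE tnth_mktuple ffunE.
  rewrite !key -h.
  have -> // : [ffun a => (q i (tnth v (pos a))).2] = [ffun a => (q j (tnth w (pos a))).2].
  by apply/ffunP => a; rewrite !ffunE; apply: eq_from_tnth => l; apply: (h (inl (pos a, l))).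
pose relR R i (v : (arity R).-tuple (W2 i)) :=
  [exists u : {ffun 'I_(arity R) -> B i}, [forall a, emb i (tnth v a) (u a)] &&
    srel [tuple u a | a < arity R]].
pose relF f i (v : 2.-tuple (W2 i)) :=
  [exists u : {ffun bool -> B i}, [forall a :
    bool, emb i (tnth v (if a then ord0 else ord_max)) (u a)] &&
    (sfun f (u true) == Some (u false))].
pose gF f i x := [pick y | [forall z, relF f i [tuple x; z] == (z == y)]].
have base_ext S : @valid Idx W2 s2 false 0 S -> extends S0 S by case.
have notin R : R \in rels t -> R \notin rels s2.
  by move=> /(proj1 tN) lt; rewrite !inE negb_and -ltnNge lt orbT.
have notinf f : f \in funs t -> f \notin funs s2.
  by move=> /(proj2 tN) lt; rewrite !inE negb_and -ltnNge lt orbT.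
have addR (l : seq (nat * nat)) : {subset l <= rels t} ->
  exists S, [/\ @valid Idx W2 s2 false 0 S,
    rels (st_sig S) =i [predU (mem (rels s2)) & (mem l)], funs (st_sig S) = funs s2 &
    forall R, R \in l -> forall i v, @st_rel _ _ S i R v = relR R i v].
  elim: l => [|[n k] l IH] lt.
    by exists S0; split=> // R; rewrite !inE orbF.
  have [|S1 [v1 r1 f1 h1]] := IH; first by move=> R Rl; apply: lt; rewrite inE Rl orbT.
  have Rt : (n, k) \in rels t by apply: lt; rewrite inE eqxx.
  have [Rl|Rnl] := boolP ((n, k) \in l).
    exists S1; split=> // R; first by rewrite r1 !inE; case: eqP => // ->; rewrite Rl orbT.
    by rewrite inE => /orP[/eqP->|]; apply: h1.
  have a0 : 'I_k := Ordinal (tpos Rt).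
  have [phi [qp op sp]] := definable_extends (base_ext _ v1) (def _ _ id a0 _ (Hrel Rt)).
  have [|S2 [v2 e2 s2E h2]] := add_rel (n := n) v1 isT _ (tpos Rt) qp op.
    by rewrite r1 inE /= negb_or Rnl andbT notin.
  exists S2; split=> //.
  - by move=> R; rewrite s2E !inE r1 !inE orbCA.
  - by rewrite s2E.
  - move=> R; rewrite inE => /orP[/eqP->|Rl'] i v; first by rewrite h2 sp.
    by case: e2 => _ _ h3 _; rewrite -h3 ?h1 // r1 inE /= Rl' orbT.
have addF (l : seq nat) : {subset l <= funs t} -> exists S, [/\ @valid Idx W2 s2 false 0 S,
    rels (st_sig S) =i [predU (mem (rels s2)) & (mem (rels t))],
    funs (st_sig S) =i [predU (mem (funs s2)) & (mem l)],
    forall R, R \in rels t -> forall i v, @st_rel _ _ S i R v = relR R i v &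
    forall f, f \in l -> forall i x, @st_fun _ _ S i f x = gF f i x].
  elim: l => [|f l IH] lt.
    have [//|S [v1 r1 f1 h1]] := addR (enum_fset (rels t)).
    by exists S; split=> // f; rewrite f1 !inE orbF.
  have [|S1 [v1 r1 f1 h1 k1]] := IH; first by move=> g gl; apply: lt; rewrite inE gl orbT.
  have ft : f \in funs t by apply: lt; rewrite inE eqxx.
  have [fl|fnl] := boolP (f \in l).
    exists S1; split=> // g; first by rewrite f1 !inE; case: eqP => // ->; rewrite fl orbT.
    by rewrite inE => /orP[/eqP->|]; apply: k1.
  have [phi [qp op sp]] := definable_extends (base_ext _ v1) (def _ _ _ ord0 _ (Hfun ft)).
  have [|S2 [v2 e2 s2E h2]] := add_fun (f := f) v1 isT _ qp op.
    by rewrite f1 inE /= negb_or fnl andbT notinf.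
  exists S2; split=> //.
  - by rewrite s2E.
  - by move=> g; rewrite s2E !inE f1 !inE orbCA.
  - move=> R Rt i v; case: e2 => _ _ h3 _; rewrite -h3 ?h1 // r1 inE /= Rt orbT //.
  - move=> g; rewrite inE => /orP[/eqP->|gl] i x.
      by rewrite h2; apply: eq_pick => y; apply: eq_forallb => z; rewrite sp.
    by case: e2 => _ _ _ h3; rewrite -h3 ?k1 // f1 inE /= gl orbT.
have [//|S [vS rS fS hR hF]] := addF (enum_fset (funs t)).
have [psi [qpsi opsi spsi]] := definable_extends (base_ext _ vS) (def _ _ id ord0 _ Hdom).
pose D i := [set x : expansion S i | sat psi [tuple x]].
pose X i := induced (D i).
have [_ _ [J3 [eJ3 t3 o3]]] := vS; have [q3 n3] := expanding_false eJ3.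
have [||J4 [t4 q4 n4 o4]] := @reducts (st_sig S) t.
- by apply/fsubsetP => R Rt; rewrite rS inE /= Rt orbT.
- by apply/fsubsetP => f ft; rewrite fS inE /= ft orbT.
have oX i : over_sig (st_sig S) (X i).
  have oS := over_sig_loose t3 (reduct_to_over s2 (W i)) (o3 i).
  exact: (@over_sig_op _ (Restriction psi) _ _ opsi oS).
exists (J1 ++ J2 ++ J3 ++ Restriction psi :: J4); split.
- apply: transduction_from_cat (copied_from cW) _; apply: transduction_from_cat t2 _.
  by apply: transduction_from_cat t3 _.
- by rewrite !all_cat (copied_qf cW) q2 q3 /= qpsi q4.
- by rewrite !has_cat !negb_or (copied_nolift cW) n2 n3 /= n4.
move=> i; exists (reduct_to t (X i)).
  apply/output_cat; exists (W i); first exact: copied_output cW i.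
  apply/output_cat; exists (W2 i); first by rewrite -{1}(reduct_to_id (oW i)); apply: o2.
  apply/output_cat; exists (expansion S i); first exact: loose_nolift n3 (o3 i).
  by exists (X i) => //; rewrite -{1}(reduct_to_id (oX i)); apply: o4.
apply: isomorphic_sym.
have [qi qK Kq] := copied_bij cW i.
pose em (d : B i) : W2 i := qi (pi d, cp d).
have emE x d : emb i x d = (x == em d).
  by rewrite /emb /em; apply/eqP/eqP => [<-|->]; rewrite ?qK // Kq.
have eminj : injective em.
  move=> d d' /(congr1 (q i)); rewrite /em !Kq => -[]; exact: cpi.
have inD x : (x \in D i) = [exists d, x == em d].
  rewrite inE spsi; apply/existsP/existsP => [[u]|[d xd]].
    by rewrite andbT => /forallP/(_ ord0); rewrite emE => xu; exists (u ord0).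
  by exists [ffun=> d]; rewrite andbT; apply/forallP => a; rewrite ffunE emE ord1.
have emD d : em d \in D i by rewrite inD; apply/existsP; exists d.
pose h (d : B i) : reduct_to t (X i) := exist _ (em d) (emD d).
exists h; split.
- have /dep_choice[g gP] : forall x : X i, exists d, h d = x.
    move=> [x xD]; have := xD; rewrite inD => /existsP[d /eqP xd]; exists d.
    by apply: val_inj; rewrite /= xd.
  by exists g => [d|x]; [apply: eminj; have := congr1 val (gP (h d)) | apply: gP].
- move=> R u /=; have [Rt|Rn] := boolP (R \in rels t); last by case: (oB i) => hr _; rewrite hr.
  rewrite /= hR //; apply/existsP/idP => [[w /andP[/forallP hw]]|ru].
    congr srel; apply: eq_from_tnth => a; rewrite tnth_mktuple; apply: eminj.
    by have := hw a; rewrite emE => /eqP <-; rewrite !tnth_map.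
  exists [ffun a => tnth u a]; apply/andP; split.
    by apply/forallP => a; rewrite ffunE emE !tnth_map.
  rewrite (_ : [tuple _ | _ < _] = u) //.
  by apply: eq_from_tnth => a; rewrite tnth_mktuple ffunE.
move=> f d /=; have [ft|fn] := boolP (f \in funs t); last by case: (oB i) => _ hf; rewrite hf.
rewrite hF //.
have rF y : relF f i [tuple em d; y] = [exists d', (y == em d') && (sfun f d == Some d')].
  apply/existsP/existsP => [[u /andP[/forallP hu fu]]|[d' /andP[yd fd]]].
    have := hu true; have := hu false; rewrite !emE => yu /eqP/eminj du.
    by exists (u false); rewrite du fu andbT.
  exists [ffun a : bool => if a then d else d']; rewrite !ffunE fd andbT.
  by apply/forallP => -[]; rewrite ffunE emE //; apply: eqxx.
have -> : gF f i (em d) = omap em (sfun f d).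
  rewrite /gF; case: pickP => [y /forallP hy|no].
    have := hy y; rewrite eqxx eqb_id rF => /existsP[d' /andP[/eqP -> /eqP ->]] //.
  case fd : (sfun f d) => [d'|//]; have /negP[] := no (em d'); apply/forallP => z.
  rewrite rF fd; apply/eqP; apply/existsP/eqP => [[d'' /andP[/eqP -> /eqP[->]]]//|->].
  by exists d'; rewrite !eqxx.
by case: (sfun f d) => //= d'; exact: (insubT (fun x => x \in D i) (emD d')).
Qed.

End Interpret.

(** * One transduction for all pairs of an input and an output *)

Lemma name_bound s : exists N,
  (forall R, R \in rels s -> R.1 < N) /\ (forall f, f \in funs s -> f < N).
Proof.
pose m1 := \max_(R <- enum_fset (rels s)) R.1; pose m2 := \max_(f <- enum_fset (funs s)) f.
exists (m1 + m2).+1; split=> [R Rs|f fs]; rewrite ltnS.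
  apply: leq_trans (leq_addr _ _).
  exact: (@leq_bigmax_seq _ _ predT (fun R : nat * nat => R.1) R).
apply: leq_trans (leq_addl _ _).
exact: (@leq_bigmax_seq _ _ predT (fun f : nat => f) f).
Qed.

Section NamedTame.
Variables (Idx : Type) (Gs B : Idx -> structure) (sb : signature) (N r : nat).
Variables (pi : forall i, B i -> Gs i) (cp : forall i, B i -> r.-tuple bool).
Hypothesis edge_sb : edge \in rels sb.
Hypothesis cpi : forall i a b, @pi i a = pi b -> cp a = cp b -> a = b.
Notation valid := (@valid Idx Gs sb true N).

Definition named_in k (X : finType) (pos : X -> 'I_k) (rho : forall i, (X -> B i) -> bool) S :=
  @named_rel Idx N r (st_sig S) (expansion S) B pi cp k X pos rho.

Lemma named_in_extends k X pos rho S S' : extends S S' ->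
  @named_in k X pos rho S -> named_in pos rho S'.
Proof.
move=> [h1 _ h3 _] nS c; have [n /andP[Nn nr] e] := nS c.
exists n; first by rewrite Nn (fsubsetP h1).
by move=> i v; rewrite -e /= h3.
Qed.

Lemma named_in_tame k (X : finType) (a0 : 'I_k) (pos : X -> 'I_k) rho S :
  tame (fun i => @adj (Gs i)) pi rho -> valid S ->
  exists S', [/\ valid S', extends S S' & named_in pos rho S'].
Proof.
move=> tr vS.
pose Q (c : {ffun X -> r.-tuple bool})
  (S : state Gs) := exists2 n, (N <= n) && ((n, k) \in rels (st_sig S)) &
    forall i (v : k.-tuple (Gs i)), @st_rel _ _ S i (n, k) v =
      [exists u : {ffun X -> B i}, [forall a, at_point pi cp (tnth v (pos a)) (c a)
        (u a)] && rho i u].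
have [||S' [v e q]] := @meet_requirements _ _ sb true N _ (enum {ffun X -> r.-tuple bool}) Q _ _ S vS.
- move=> c S1 S2 [h1 _ h3 _] [n /andP[Nn nr] e]; exists n; first by rewrite Nn (fsubsetP h1).
  by move=> i v; rewrite -h3.
- move=> c S1 v1 _.
  have tc := tame_reindex pos (tame_copies cpi c tr).
  by have [S2 [v2 e2 [n h1 h2]]] := add_tame_rel edge_sb a0 tc v1; exists S2; split=> //;
    exists n.
exists S'; split=> // c; apply: q; exact: mem_enum.
Qed.

End NamedTame.

Theorem theorem16 (P : {fset nat}) (C : structure -> Prop)
    (HC : forall G, C G -> colored_graph P G)
    (Hlow : low_shrubdepth_covers P C)
    (t : signature) (I : transduction)
    (HI : transduction_from (graph_sig P) t I) :
  exists J : transduction,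
    [/\ transduction_from (graph_sig P) t J,
        almost_quantifier_free J
      & equivalent_on C I J].
Proof.
(* Since outputs are part of the index, every output of [I] comes from some colouring of its input
   by one and the same [J2]. *)
pose Idx := {GB : structure * structure | C GB.1 /\ output I GB.1 GB.2}.
pose Gs (i : Idx) := (sval i).1; pose B (i : Idx) := (sval i).2.
have CG i : C (Gs i) by case: (svalP i).
have IB i : output I (Gs i) (B i) by case: (svalP i).
have Hcov := visible_cover HC Hlow CG.
have [r [pi [cp [cpi Rt ft]]]] := tame_output Hcov HI (tame_graph P Gs) IB.
have oG i : over_sig (graph_sig P) (Gs i) by case: (HC _ (CG i)).
have oB i : over_sig t (B i) := over_sig_output HI (oG i) (IB i).
have tpos : positive_arity t.
  apply: positive_arity_from HI _ => R; rewrite !inE => /orP[/eqP->//|/imfsetP[p _ ->]] //.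
have [N tN] := name_bound t.
have edge_sb : edge \in rels (graph_sig P) by rewrite !inE eqxx.
have [||S1 [v1 e1 q1]] := @meet_requirements Idx Gs (graph_sig P) true N _ (enum_fset (rels t))
  (fun R S => R \in rels t -> named_in N pi cp id (fun i (u : 'I_(arity R) -> B i) =>
    srel [tuple u a | a < arity R]) S) _ _
  _ (valid_start Gs (graph_sig P) true N).
- by move=> R S S' le h Rs; apply: named_in_extends le (h Rs).
- move=> R S vS Rs; have a0 : 'I_(arity R) := Ordinal (tpos R Rs).
  have [S' [v' e' q']] := named_in_tame edge_sb cpi a0 id (Rt R Rs) vS.
  by exists S'.
have [||S2 [v2 e2 q2]] := @meet_requirements Idx Gs (graph_sig P) true N _ (enum_fset (funs t))
  (fun f S => named_in N pi cp (fun b : bool => if b then ord0 else ord_max : 'I_2)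
    (fun i u => sfun f (u true) == Some (u false)) S) _ _ _ v1.
- by move=> f S S' le; apply: named_in_extends le.
- move=> f S vS fs.
  exact: (named_in_tame edge_sb cpi ord0 (fun b : bool => if b then ord0 else ord_max : 'I_2)
    (ft f fs) vS).
have dom_tame : tame (fun i => @adj (Gs i)) pi (fun i (u : 'I_1 -> B i) => true).
  exact: tame_const.
have [S3 [v3 e3 q3]] := named_in_tame edge_sb cpi ord0 id dom_tame v2.
have [_ _ [J1 [eJ1 tJ1 oJ1]]] := v3.
have oS3 i : over_sig (st_sig S3) (expansion S3 i) := over_sig_loose tJ1 (oG i) (oJ1 i).
have [|||J2 [tJ2 qJ2 nJ2 oJ2]] := interpret (H := expansion S3) cpi oS3 oB tpos tN.
- by move=> R Rs; apply: named_in_extends (extends_trans e2 e3) (q1 R Rs Rs).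
- by move=> f fs; apply: named_in_extends e3 (q2 f fs).
- exact: q3.
(* A coloured graph is good when [J2] turns it into an output of [I], up to isomorphism. *)
pose Good G A1 := exists B0 B', [/\ output I G B0, output J2 A1 B' & isomorphic B' B0].
have [J1' [tJ1' qJ1' JP]] := angelic Good (fsubset_refl _) (fsubset_refl _) eJ1 tJ1.
exists (J1' ++ J2); split.
- exact: transduction_from_cat tJ1' tJ2.
- by rewrite /almost_quantifier_free all_cat qJ2 andbT.
move=> G CGG; have redG : reduct_to (graph_sig P) G = G.
  by apply: reduct_to_id; case: (HC _ CGG).
have run B0 : output I G B0 -> exists A1 B', [/\ loose_output J1 G A1, output J2 A1 B' &
  isomorphic B' B0].
  move=> GB; pose i : Idx := exist _ (G, B0) (conj CGG GB).
  by have [B' h1 h2] := oJ2 i; exists (expansion S3 i), B'; split=> //; apply: (oJ1 i).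
have {}JP A1 : output J1' G A1 <-> loose_output J1 G A1 /\ Good G A1.
  rewrite -{3}redG; apply: JP; rewrite redG.
  have [B0 GB] := output_total I G; have [A2 [B' [h1 h2 h3]]] := run B0 GB.
  by exists A2; split=> //; exists B0, B'.
move=> B1; split=> [[B0 GB iB]|[B' /output_cat[A1 /JP[lA [B0 [B'' [h1 h2 h3]]]] o2] iB]].
  have [A1 [B' [h1 h2 h3]]] := run B0 GB.
  exists B'; last exact: isomorphic_trans h3 iB.
  by apply/output_cat; exists A1 => //; apply/JP; split=> //; exists B0, B'.
(* [J2] has no lifts, hence a single output on [A1]: the one that [Good] compares with an output of
   [I]. *)
exists B0 => //; rewrite (output_det nJ2 h2 o2) in h3.
exact: isomorphic_trans (isomorphic_sym h3) iB.
Qed.
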